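(* Let $g\in\mathbb Q^*$ with $g\neq -1$ and $g$ not the square of a rational number. Let $h$ be the largest positive integer such that $g$ is an $h$-th power of a rational number, and let $\Delta$ be the discriminant of the quadratic field $\mathbb Q(\sqrt g)$. Let $f\ge1$ and $1\le a\le f$ be integers with $(a,f)=1$. Put $b=\Delta/(f,\Delta)$ and, if $b$ is odd, $\gamma=(-1)^{(b-1)/2}(f,\Delta)$. Then $$\delta(a,f,g)=\frac{A(a,f,h)}{\varphi(f)}\left(1+\left(\frac{\gamma}{a}\right)\frac{\mu(2|b|)}{\prod_{p\mid b,\ p\mid h}(p-2)\prod_{p\mid b,\ p\nmid h}(p^2-p-1)}\right),$$ where, when $b$ is even (so that $\mu(2|b|)=0$ and $(\gamma/a)$ is undefined), the term involving $\mu(2|b|)$ is taken to be zero.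
   Context: $p$ always denotes a rational prime; $\zeta_m=e^{2\pi i/m}$; $\mu$ is the Möbius function and $\varphi$ Euler's totient; $(x,y)$ denotes the positive gcd. For $(a,f)=1$, $\sigma_a$ is the automorphism of $\mathbb Q(\zeta_f)$ with $\sigma_a(\zeta_f)=\zeta_f^a$. For $n\ge1$, $g^{1/n}$ denotes an $n$-th root of $g$ (the field $\mathbb Q(\zeta_n,g^{1/n})$ does not depend on the choice). Define $c_a(n)=1$ if the restriction of $\sigma_a$ to $\mathbb Q(\zeta_f)\cap\mathbb Q(\zeta_n,g^{1/n})$ is the identity and $c_a(n)=0$ otherwise, and $$\delta(a,f,g)=\sum_{n=1}^\infty\frac{\mu(n)c_a(n)}{[\mathbb Q(\zeta_f,\zeta_n,g^{1/n}):\mathbb Q]}.$$ Define $A(a,f,h)=\prod_{p\mid (a-1,f)}(1-\frac1p)\prod_{p\nmid f,\ p\mid h}(1-\frac1{p-1})\prod_{p\nmid f,\ p\nmid h}\left(1-\frac1{p(p-1)}\right)$ if $(a-1,f,h)=1$, and $A(a,f,h)=0$ otherwise. $(\gamma/a)$ denotes the Kronecker symbol. *)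

(* Defs.v *)
(* MathComp world, with MathComp-Analysis for the real limits. *)
From HB Require Import structures.
From mathcomp Require Import all_boot all_order all_algebra all_field.
From mathcomp Require Import boolp classical_sets reals topology normedtype.
From mathcomp Require Import sequences.

Set Implicit Arguments.
Unset Strict Implicit.
Unset Printing Implicit Defensive.

Import Order.TTheory GRing.Theory Num.Theory.
Import numFieldNormedType.Exports.

Local Open Scope ring_scope.

(* All number fields live inside algC, the field of algebraic complex numbers. *)

(* For m > 0, m.-root (-1) is the m-th root of -1 of least nonnegative argument,
   e^(i pi / m), so its square is e^(2 i pi / m). *)
Definition zeta (m : nat) : algC := (m.-root (-1)) ^+ 2.

(* Qadj s is Q(s) as an abstract field, embedded in algC by Qadj_inj s. *)
Definition Qadj (s : seq algC) : fieldExtType rat := projT1 (num_field_exists s).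

Definition Qadj_inj (s : seq algC) : {rmorphism Qadj s -> algC} :=
  projT1 (projT2 (num_field_exists s)).

Definition Qadj_gens (s : seq algC) : seq (Qadj s) :=
  s2val (projT2 (projT2 (num_field_exists s))).

Lemma map_Qadj_gens s : map (Qadj_inj s) (Qadj_gens s) = s.
Proof. exact: s2valP (projT2 (projT2 (num_field_exists s))). Qed.

Lemma Qadj_gensP s : <<1 & Qadj_gens s>>%VS = {: Qadj s}%VS.
Proof. exact: s2valP' (projT2 (projT2 (num_field_exists s))). Qed.

Definition degQ (s : seq algC) : nat := \dim {: Qadj s}.

Definition in_Qadj (s : seq algC) (z : algC) : Prop :=
  exists y : Qadj s, Qadj_inj s y = z.

Definition Qzeta (f : nat) : fieldExtType rat := Qadj [:: zeta f].

Definition zetaQ (f : nat) : Qzeta f := head 0 (Qadj_gens [:: zeta f]).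

Lemma zetaQE f : Qadj_inj [:: zeta f] (zetaQ f) = zeta f.
Proof.
by rewrite /zetaQ; have := map_Qadj_gens [:: zeta f]; case: Qadj_gens => // z [|//] [].
Qed.

Lemma zetaX f : zeta f ^+ f = 1.
Proof.
case: f => [|f]; first by rewrite expr0.
by rewrite /zeta -exprM mulnC exprM rootCK // sqrrN expr1n.
Qed.

Lemma sigma_exists (a f : nat) : coprime a f ->
  {s : {rmorphism Qzeta f -> Qzeta f} | s (zetaQ f) = zetaQ f ^+ a}.
Proof.
move=> haf; have [u uP] := Qn_aut_exists haf.
have stab x : exists y, u (Qadj_inj [:: zeta f] x) = Qadj_inj [:: zeta f] y.
  have : x \in <<1; zetaQ f>>%VS.
    suff -> : <<1; zetaQ f>>%VS = {: Qzeta f}%VS by exact: memvf.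
    rewrite -(Qadj_gensP [:: zeta f]) /zetaQ.
    have := map_Qadj_gens [:: zeta f]; case: Qadj_gens => // z [|//] _ /=.
    by rewrite adjoin_seq1.
  case/Fadjoin_polyP => p pQ ->; exists p.[zetaQ f ^+ a].
  rewrite -!horner_map /= rmorphXn /= !zetaQE (uP _ (zetaX f)); congr horner.
  apply/polyP => i; rewrite !coef_map /=.
  have /vlineP[c ->] := polyOverP pQ i.
  by rewrite alg_num_field !fmorph_rat.
have [s sP] := restrict_aut_to_num_field stab.
exists s; apply: (fmorph_inj (Qadj_inj [:: zeta f])).
by rewrite sP rmorphXn /= zetaQE; apply: uP (zetaX f).
Qed.

Definition sigma (a f : nat) (haf : coprime a f) :
  {rmorphism Qzeta f -> Qzeta f} := sval (sigma_exists haf).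

Definition rat_root (g : rat) (n : nat) : algC := n.-root (ratr g).

(* The restriction of sigma_a to the intersection of Q(zeta_f) with
   Q(zeta_n, g^(1/n)) is the identity. *)
Definition sigma_fixes (a f : nat) (haf : coprime a f) (g : rat) (n : nat) : Prop :=
  forall x : Qzeta f,
    in_Qadj [:: zeta n; rat_root g n] (Qadj_inj [:: zeta f] x) ->
    sigma haf x = x.

Definition c_coef (a f : nat) (haf : coprime a f) (g : rat) (n : nat) : nat :=
  if `[< sigma_fixes haf g n >] then 1%N else 0%N.

(* Only used for n > 0. *)
Definition moebius (n : nat) : int :=
  if all (fun p => logn p n == 1%N) (primes n) then (-1) ^+ size (primes n) else 0.

Definition delta_partial (R : realType) (a f : nat) (haf : coprime a f) (g : rat)
    (N : nat) : R :=
  \sum_(1 <= n < N)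
    (moebius n)%:~R * (c_coef haf g n)%:R / (degQ [:: zeta f; zeta n; rat_root g n])%:R.

Definition delta (R : realType) (a f : nat) (haf : coprime a f) (g : rat) : R :=
  limn (delta_partial R haf g).

Definition artin_partial (R : realType) (f h N : nat) : R :=
  \prod_(0 <= p < N | [&& prime p, ~~ (p %| f)%N & ~~ (p %| h)%N])
    (1 - (p%:R * (p%:R - 1))^-1).

(* Only used for a, f, h > 0; a - 1 may be 0, and gcdn 0 f = f. *)
Definition Afactor (R : realType) (a f h : nat) : R :=
  if gcdn (gcdn (a - 1) f) h == 1%N then
    (\prod_(p <- primes (gcdn (a - 1) f)) (1 - p%:R^-1)) *
    (\prod_(p <- primes h | ~~ (p %| f)%N) (1 - (p%:R - 1)^-1)) *
    limn (artin_partial R f h)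
  else 0.

Definition kronecker_prime (m : int) (p : nat) : int :=
  if p == 2%N then
    if (2 %| m)%Z then 0
    else if ((m %% 8)%Z == 1) || ((m %% 8)%Z == 7) then 1 else -1
  else if (p %| m)%Z then 0
  else if [exists x : 'I_p, ((x : nat)%:Z ^+ 2 == m %[mod p])%Z] then 1 else -1.

(* Kronecker symbol (m / a) for a > 0. *)
Definition kronecker (m : int) (a : nat) : int :=
  \prod_(p <- primes a) kronecker_prime m p ^+ logn p a.

(* Trace of the Q-linear map y |-> x * y. *)
Definition field_trace (K : fieldExtType rat) (x : K) : rat :=
  \sum_(i < \dim {:K}) coord (vbasis {:K}) i (x * (vbasis {:K})`_i).

Definition integral_basis (K : fieldExtType rat) (w : (\dim {:K}).-tuple K) : Prop :=
  basis_of {:K} w /\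
  forall x : K, integralOver (intr : int -> K) x <->
    exists c : 'I_(\dim {:K}) -> int, x = \sum_(i < \dim {:K}) w`_i *~ c i.

Definition is_discriminant (K : fieldExtType rat) (D : int) : Prop :=
  exists w : (\dim {:K}).-tuple K, integral_basis w /\
    D%:~R = \det (\matrix_(i < \dim {:K}, j < \dim {:K}) field_trace (w`_i * w`_j)).

(* Main.v *)
Require Import Defs.
From mathcomp Require Import all_boot all_order all_algebra all_field.
From mathcomp Require Import boolp classical_sets reals topology normedtype.
From mathcomp Require Import sequences.
From mathcomp Require Import cyclic exp ring lra zify.

(* For squarefree n put m = lcm(f, n).  Kummer theory over Q(zeta_m) gives
     [Q(zeta_f, zeta_n, g^(1/n)) : Q] = n phi(m) / ((n, h) 2^eps),
   where eps = 1 if n is even and sqrt g lies in Q(zeta_m), and eps = 0 otherwise.  As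
   Q(sqrt g) has conductor |Delta|, eps = 1 holds iff 2 | n, b is odd and b | n, and then
   Delta = gamma b' with b' = b up to sign, gamma and b' fundamental discriminants, gamma | f
   and b' | n.  The intersection of Q(zeta_f) and Q(zeta_n, g^(1/n)) is generated by
   zeta_(f,n) and, when eps = 1, by sqrt gamma, on which sigma_a acts through (gamma/a);
   hence c_a(n) = 1 iff a = 1 mod (f, n) and (gamma/a) = 1 whenever eps = 1.  So the n-th
   term is 1/phi(f) times a multiplicative function W(n), or (1 + (gamma/a)) W(n) when 2|b|
   divides n, and both resulting sums are Euler products, absolutely convergent because
   W(p) = O(1/(p (p - 1))). *)

Set Implicit Arguments.
Unset Strict Implicit.
Unset Printing Implicit Defensive.

Import Order.TTheory GRing.Theory Num.Theory.
Import numFieldNormedType.Exports.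

Local Open Scope ring_scope.

(** The prime 2 is singled out because g is not a square, so h is odd. For odd p the degree drops
    only through p | h: a real p-th root of g lying in an abelian field is rational. Only at p = 2
    can there be a further loss, which is eps. The conductor has two halves: Gauss sums place sqrt
    Delta in Q(zeta_|Delta|), and an automorphism negating the square root of a single prime
    discriminant shows that Q(zeta_m) contains sqrt Delta only if |Delta| divides m. Automorphisms
    are taken on all of [algC], so that sigma_a can be extended to fix zeta_n whenever a = 1 mod (f,
    n). The correction term arises as follows. Summing only over n divisible by 2|b| replaces the
    Euler factor 1 + W(p) by W(p) at each p | 2b. The quotient W(p) / (1 + W(p)) is -1 at p = 2,
    -1/(p - 2) if p divides b and h, and -1/(p^2 - p - 1) if p divides b but not h; the signs
    multiply to mu(2|b|). These factors 1 + W(p) are nonzero even when A vanishes. *)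

(** * Roots of unity *)

(* With c + i s = e^(i theta), x + i t = e^(i phi) in the upper half plane: if phi < theta,
   then theta - phi lies between 0 and theta. *)
Lemma sector_ineq (R : realFieldType) (c s x t : R) :
    0 <= s -> 0 <= t -> c ^+ 2 + s ^+ 2 = 1 -> x ^+ 2 + t ^+ 2 = 1 -> c < x -> x < 1 ->
  0 <= s * x - c * t /\ c < c * x + s * t.
Proof.
move=> s0 t0 cs xt cx x1.
have [c0|c0] := leP 0 c.
  have s_gt0 : 0 < s by rewrite lt_def s0 andbT; apply/eqP => s00; move: cs; rewrite s00; nra.
  have t_gt0 : 0 < t by rewrite lt_def t0 andbT; apply/eqP => t00; move: xt; rewrite t00; nra.
  have ts : t < s by nra.
  split; first by nra.
  have h : (s * t) ^+ 2 - (c * (1 - x)) ^+ 2 = (1 - x) * ((1 - c) * (1 + 2 * c) + (x - c)).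
    have -> : (s * t) ^+ 2 = (1 - c ^+ 2) * (1 - x ^+ 2).
      by rewrite exprMn; congr (_ * _); [rewrite -cs | rewrite -xt]; ring.
    by ring.
  have h1 : 0 < (1 - x) * ((1 - c) * (1 + 2 * c) + (x - c)).
    have h2 : 0 <= (1 - c) * (1 + 2 * c) by apply: mulr_ge0; lra.
    by apply: mulr_gt0; lra.
  have h2 : 0 <= c * (1 - x) by apply: mulr_ge0; lra.
  have h3 : 0 < s * t by apply: mulr_gt0.
  suff : c * (1 - x) < s * t by lra.
  by rewrite -ltr_sqr ?nnegrE ?(ltW h3) // -subr_gt0 h.
split; last by nra.
have [x0|x0] := leP 0 x; first by nra.
have ts : s < t by nra.
nra.
Qed.

(** In angles: if 0 < theta <= phi <= pi, turning phi back by theta strictly increases the cosine.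
    So cos (phi - theta) <= cos phi is possible only when phi < theta. *)
Lemma sector_absurd (R : realFieldType) (c s x t : R) :
    0 <= s -> 0 <= t -> c ^+ 2 + s ^+ 2 = 1 -> x ^+ 2 + t ^+ 2 = 1 ->
    c < 1 -> x * c + t * s <= x -> c < x.
Proof.
move=> s0 t0 cs xt c1 h; rewrite ltNge; apply/negP => xc.
have ts0 : 0 <= t * s by nra.
have x0 : 0 <= x by nra.
have h2 : (t * s) ^+ 2 <= (x * (1 - c)) ^+ 2.
  by rewrite ler_sqr ?nnegrE //; nra.
have h3 : (1 - x ^+ 2) * (1 - c ^+ 2) <= x ^+ 2 * (1 - c) ^+ 2.
  by move: h2; rewrite !exprMn -[in 1 - x ^+ 2]xt -[in 1 - c ^+ 2]cs; nra.
have h4 : (1 - x ^+ 2) * (1 + c) <= x ^+ 2 * (1 - c).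
  have : 0 < 1 - c by lra.
  by move=> hc; rewrite -(ler_pM2r hc); nra.
nra.
Qed.

(** Valued in [algR], a totally ordered field to which the sector inequalities and [nra] apply. *)
Definition algRe (z : algC) : algR := in_algR (Creal_Re z).
Definition algIm (z : algC) : algR := in_algR (Creal_Im z).

Lemma algRe_Im_inj y z : algRe y = algRe z -> algIm y = algIm z -> y = z.
Proof.
by move=> /(congr1 algRval) /= hr /(congr1 algRval) /= hi; rewrite [y]Crect [z]Crect hr hi.
Qed.

Lemma algRe1 : algRe 1 = 1. Proof. by apply/val_inj; rewrite /= (Creal_ReP _ _). Qed.
Lemma algIm1 : algIm 1 = 0. Proof. by apply/val_inj; rewrite /= (Creal_ImP _ _). Qed.
Lemma algReM y z : algRe (y * z) = algRe y * algRe z - algIm y * algIm z.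
Proof.
apply/val_inj; rewrite /= {1}[y]Crect {1}[z]Crect mulC_rect Re_rect //;
 by rewrite ?rpredB ?rpredD ?rpredM.
Qed.
Lemma algImM y z : algIm (y * z) = algRe y * algIm z + algIm y * algRe z.
Proof.
apply/val_inj; rewrite /= {1}[y]Crect {1}[z]Crect mulC_rect Im_rect ?rpredB ?rpredD ?rpredM //.
by rewrite ['Re z * _]mulrC.
Qed.
Lemma algRe_conj y : algRe y^* = algRe y. Proof. by apply/val_inj; rewrite /= Re_conj. Qed.
Lemma algIm_conj y : algIm y^* = - algIm y. Proof. by apply/val_inj; rewrite /= Im_conj. Qed.

Lemma unity_conjE n (z : algC) : (0 < n)%N -> z ^+ n = 1 -> z * z^* = 1.
Proof.
move=> n0 zn; rewrite -normCK.
have : `|z| ^+ n = 1 by rewrite -normrX zn normr1.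
by move/eqP; rewrite pexpr_eq1 // => /eqP ->; rewrite expr1n.
Qed.

Lemma unity_ReIm n (z : algC) : (0 < n)%N -> z ^+ n = 1 -> algRe z ^+ 2 + algIm z ^+ 2 = 1.
Proof.
move=> n0 /(unity_conjE n0) h.
have := algReM z z^*; rewrite h algRe_conj algIm_conj algRe1 => ->; ring.
Qed.

Lemma algR_le (x y : algR) : (x <= y) = (algRval x <= algRval y). Proof. by []. Qed.

Section RootN1.
Variable m : nat.
Hypothesis m_gt1 : (1 < m)%N.
Let w : algC := m.-root (-1).
Let m_gt0 : (0 < m)%N. Proof. exact: ltnW. Qed.
Let wm : w ^+ m = -1. Proof. exact: rootCK. Qed.
Let w2m : w ^+ (2 * m) = 1. Proof. by rewrite mulnC exprM wm sqrrN expr1n. Qed.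
Let m2_gt0 : (0 < 2 * m)%N. Proof. by rewrite muln_gt0. Qed.
Let Imw : 0 <= algIm w. Proof. by rewrite algR_le /= Im_rootC_ge0. Qed.

Let Rew_lt1 : algRe w < 1.
Proof.
have h := unity_ReIm m2_gt0 w2m.
have h1 : algRe w <= 1 by nra.
rewrite lt_neqAle h1 andbT; apply/eqP => h2.
have w1 : w = 1 by apply: algRe_Im_inj; rewrite ?algRe1 ?algIm1 //; nra.
have := wm; rewrite w1 expr1n => /eqP; rewrite -subr_eq0 opprK -(natrD _ 1 1) pnatr_eq0 //.
Qed.

Let ReN1 y : y ^+ m = -1 -> 0 <= algIm y -> algRe y <= algRe w.
Proof. by move=> ym Imy; rewrite algR_le /= rootC_Re_max. Qed.

(** Here z^m is 1 or -1. The value -1 contradicts the maximality of Re w. If z^m = 1 and z is not 1,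
    then w z^* is an m-th root of -1 in the upper half plane, and [sector_ineq] gives it a larger
    real part than w. *)
Let sector1 z : z ^+ (2 * m) = 1 -> 0 <= algIm z -> algRe w < algRe z -> z = 1.
Proof.
move=> z2m Imz wz.
have hz := unity_ReIm m2_gt0 z2m; have hw := unity_ReIm m2_gt0 w2m.
have [z1|z1] := ltP (algRe z) 1; last first.
  apply: algRe_Im_inj; rewrite ?algRe1 ?algIm1; nra.
have [h1 h2] := sector_ineq Imw Imz hw hz wz z1.
have /eqP : (z ^+ m) ^+ 2 = 1 by rewrite -exprM mulnC.
rewrite sqrf_eq1 => /orP[] /eqP zm; last by have := ReN1 zm Imz; rewrite leNgt wz.
have ym : (w * z^* ) ^+ m = -1 by rewrite exprMn -rmorphXn zm rmorph1 mulr1.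
have := ReN1 ym; rewrite algImM algReM algRe_conj algIm_conj.
have -> : algRe w * - algIm z + algIm w * algRe z = algIm w * algRe z - algRe w * algIm z by ring.
have -> : algRe w * algRe z - algIm w * - algIm z = algRe w * algRe z + algIm w * algIm z by ring.
by move=> /(_ h1); rewrite leNgt h2.
Qed.

(* Among the z w^k, the one of largest real part lies in the open sector of half-angle pi/m around
   1, whence it is 1. *)
Let power_of_w z : z ^+ (2 * m) = 1 -> exists j, z = w ^+ j.
Proof.
move=> z2m.
pose F (j : 'I_(2 * m)) : algR := algRe (z * w ^+ j).
have [j _ jmax] := arg_maxP F (P := xpredT) (i0 := Ordinal m2_gt0) isT.
pose y := z * w ^+ j.
have y2m : y ^+ (2 * m) = 1 by rewrite exprMn z2m mul1r -exprM mulnC exprM w2m expr1n.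
have ymax k : algRe (z * w ^+ k) <= algRe y.
  rewrite -(expr_mod _ w2m).
  by have := jmax (Ordinal (ltn_pmod k m2_gt0)) isT.
have wV : w^* = w ^+ (2 * m).-1.
  have w0 : w != 0 by apply/eqP => w0; have := w2m; rewrite w0 expr0n gtn_eqF // => /eqP; rewrite eq_sym oner_eq0.
  by apply: (mulfI w0); rewrite (unity_conjE m2_gt0 w2m) -exprS prednK.
have hy := unity_ReIm m2_gt0 y2m; have hw := unity_ReIm m2_gt0 w2m.
suff y1 : y = 1.
  (* A natural number congruent to -j modulo 2m. *)
  exists (2 * m * j - j)%N.
  have wj : w ^+ j != 0.
    apply/eqP => h; have := y1; rewrite /y h mulr0 => /eqP; by rewrite eq_sym oner_eq0.
  apply: (mulIf wj); rewrite -/y y1 -exprD subnK ?leq_pmull //.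
  by rewrite exprM w2m expr1n.
have [Imy|Imy] := leP 0 (algIm y).
  apply: sector1 => //.
  apply: (sector_absurd Imw Imy hw hy Rew_lt1).
  (* The competitor z w^(j-1) is y w^*: by maximality, turning y back by the angle of w does not
     increase its real part. *)
  have := ymax (j + (2 * m).-1)%N; rewrite exprD mulrA -/y -wV algReM algRe_conj algIm_conj; lra.
have Imy' : 0 <= algIm y^* by rewrite algIm_conj; lra.
have cy2m : y^* ^+ (2 * m) = 1 by rewrite -rmorphXn /= y2m rmorph1.
apply: (can_inj conjCK); rewrite rmorph1; apply: sector1 => //.
have hcy := unity_ReIm m2_gt0 cy2m.
apply: (sector_absurd Imw Imy' hw hcy Rew_lt1).
have := ymax (j.+1)%N; rewrite exprSr mulrA -/y algReM algRe_conj algIm_conj; lra.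
Qed.

Lemma prim_rootN1 : (2 * m).-primitive_root w.
Proof.
have [z zP] := C_prim_root_exists m2_gt0.
have [j zj] := power_of_w (prim_expr_order zP).
have [d dP dvd] := prim_order_exists m2_gt0 w2m.
suff -> : (2 * m)%N = d by [].
apply/eqP; rewrite eqn_dvd dvd andbT (prim_order_dvd zP) zj -exprM mulnC exprM (prim_expr_order dP) expr1n //.
Qed.
End RootN1.

Lemma zeta_prim m : (0 < m)%N -> m.-primitive_root (zeta m).
Proof.
case: m => [//|[_|m _]].
  rewrite /zeta; have -> : 1.-root (-1 : algC) = -1 by rewrite -[LHS]expr1 rootCK.
  by rewrite sqrrN expr1n; apply/andP; split=> //; apply/forallP => i; rewrite ord1; apply/eqP; rewrite unity_rootE expr1n eqxx.
have := exp_prim_root (prim_rootN1 (isT : (1 < m.+2)%N)) 2.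
by rewrite /zeta (gcdn_idPl (dvdn_mulr _ (dvdnn 2))) mulKn.
Qed.

(** * Cyclotomic fields *)

(** Q(zeta_m), and below Z[zeta_m], as predicates on [algC]: the fields for different m then lie in
    one ambient field, on which the automorphisms of [algC] act. *)
Definition Qz (m : nat) (x : algC) : Prop :=
  exists p : {poly rat}, x = (map_poly ratr p).[zeta m].

Definition Zz (m : nat) (x : algC) : Prop :=
  exists p : {poly int}, x = (map_poly intr p).[zeta m].

Lemma QzD m x y : Qz m x -> Qz m y -> Qz m (x + y).
Proof. by move=> [p ->] [q ->]; exists (p + q); rewrite rmorphD hornerD. Qed.

Lemma QzM m x y : Qz m x -> Qz m y -> Qz m (x * y).
Proof. by move=> [p ->] [q ->]; exists (p * q); rewrite rmorphM hornerM. Qed.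

Lemma Qz_rat m r : Qz m (ratr r).
Proof. by exists r%:P; rewrite map_polyC hornerC. Qed.

Lemma Qz_zeta m : Qz m (zeta m).
Proof. by exists 'X; rewrite map_polyX hornerX. Qed.

Lemma QzX m x k : Qz m x -> Qz m (x ^+ k).
Proof.
move=> hx; elim: k => [|k IH]; last by rewrite exprS; apply: QzM.
by rewrite expr0 -(rmorph1 ratr); apply: Qz_rat.
Qed.

Lemma Qz_sum m (I : Type) (r : seq I) (P : pred I) (F : I -> algC) :
  (forall i, P i -> Qz m (F i)) -> Qz m (\sum_(i <- r | P i) F i).
Proof.
move=> h; apply: big_ind => //; last by move=> *; apply: QzD.
by rewrite -(rmorph0 ratr); apply: Qz_rat.
Qed.

Lemma ZzD m x y : Zz m x -> Zz m y -> Zz m (x + y).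
Proof. by move=> [p ->] [q ->]; exists (p + q); rewrite rmorphD hornerD. Qed.

Lemma ZzM m x y : Zz m x -> Zz m y -> Zz m (x * y).
Proof. by move=> [p ->] [q ->]; exists (p * q); rewrite rmorphM hornerM. Qed.

Lemma Zz_int m (c : int) : Zz m c%:~R.
Proof. by exists c%:P; rewrite map_polyC hornerC. Qed.

Lemma Zz_zeta m : Zz m (zeta m).
Proof. by exists 'X; rewrite map_polyX hornerX. Qed.

Lemma ZzX m x k : Zz m x -> Zz m (x ^+ k).
Proof.
move=> hx; elim: k => [|k IH]; last by rewrite exprS; apply: ZzM.
by rewrite expr0; apply: (Zz_int m 1).
Qed.

Lemma Zz_sum m (I : Type) (r : seq I) (P : pred I) (F : I -> algC) :
  (forall i, P i -> Zz m (F i)) -> Zz m (\sum_(i <- r | P i) F i).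
Proof.
by move=> h; apply: big_ind => //; [apply: (Zz_int m 0) | move=> *; apply: ZzD].
Qed.

Lemma Zz_Qz m x : Zz m x -> Qz m x.
Proof.
case=> p ->; exists (map_poly intr p); rewrite -map_poly_comp.
by congr horner; apply: eq_map_poly => c /=; rewrite ratr_int.
Qed.

Lemma Zz_Aint m x : (0 < m)%N -> Zz m x -> x \in Aint.
Proof.
move=> m0 [p ->]; rewrite horner_coef; apply: rpred_sum => i _.
rewrite coef_map /=; apply: rpredM; first exact: Aint_int.
by apply: rpredX; apply: Aint_prim_root (zeta_prim m0).
Qed.

Lemma zeta_pow m n : (0 < n)%N -> (m %| n)%N -> exists k, zeta m = zeta n ^+ k.
Proof.
move=> n0 mn; have nP := zeta_prim n0.
have [|k ->] := prim_rootP nP (x := zeta m); last by exists k.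
by rewrite -(divnK mn) mulnC exprM zetaX expr1n.
Qed.

Lemma Zz_dvd m n x : (0 < n)%N -> (m %| n)%N -> Zz m x -> Zz n x.
Proof.
move=> n0 mn [p ->]; have [k ->] := zeta_pow n0 mn.
rewrite horner_coef; apply: Zz_sum => i _; rewrite coef_map /=.
by apply: ZzM; [apply: Zz_int | do 2!apply: ZzX; apply: Zz_zeta].
Qed.

Lemma Qz_dvd m n x : (0 < n)%N -> (m %| n)%N -> Qz m x -> Qz n x.
Proof.
move=> n0 mn [p ->]; have [k ->] := zeta_pow n0 mn.
rewrite horner_coef; apply: Qz_sum => i _; rewrite coef_map /=.
by apply: QzM; [apply: Qz_rat | do 2!apply: QzX; apply: Qz_zeta].
Qed.

Lemma Qz_aut m (u v : {rmorphism algC -> algC}) x :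
  u (zeta m) = v (zeta m) -> Qz m x -> u x = v x.
Proof.
move=> uv [p ->]; rewrite -!horner_map /= uv -!map_poly_comp; congr horner.
by apply: eq_map_poly => c /=; rewrite !fmorph_rat.
Qed.

Lemma Qz_aut_id m (u : {rmorphism algC -> algC}) x :
  u (zeta m) = zeta m -> Qz m x -> u x = x.
Proof. by move=> uz; apply: (@Qz_aut m u idfun). Qed.

Lemma aut_zeta k m : coprime k m ->
  exists u : {rmorphism algC -> algC}, u (zeta m) = zeta m ^+ k.
Proof. by move=> /Qn_aut_exists[u uP]; exists u; apply/uP/zetaX. Qed.

Lemma aut_zeta_dvd (u : {rmorphism algC -> algC}) d m k : (0 < m)%N -> (d %| m)%N ->
  u (zeta m) = zeta m ^+ k -> u (zeta d) = zeta d ^+ k.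
Proof.
by move=> m0 dm uz; have [j ->] := zeta_pow m0 dm; rewrite rmorphXn /= uz exprAC.
Qed.

Lemma zetaX_eq m i j : (0 < m)%N -> (zeta m ^+ i == zeta m ^+ j) = (i == j %[mod m]).
Proof. by move=> m0; apply: eq_prim_root_expr; apply: zeta_prim. Qed.

Lemma aut_zeta_exp (u : {rmorphism algC -> algC}) m : (0 < m)%N ->
  exists2 k, coprime k m & u (zeta m) = zeta m ^+ k.
Proof.
move=> m0; have mP := zeta_prim m0.
have [k [ck h]] : exists k, coprime k m /\ u (zeta m) = zeta m ^+ k; last by exists k.
have uP : m.-primitive_root (u (zeta m)) by rewrite fmorph_primitive_root.
have [k hk] := prim_rootP mP (prim_expr_order uP).
by exists k; split=> //; move: uP; rewrite hk prim_root_exp_coprime.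
Qed.

Lemma chinese_exists a f n : (0 < a)%N -> (0 < f)%N -> (0 < n)%N ->
    coprime a f -> a = 1 %[mod gcdn f n] ->
  exists k, [/\ coprime k (lcmn f n), k = a %[mod f] & k = 1 %[mod n]].
Proof.
move=> a0 f0 n0 caf /eqP; rewrite eqn_mod_dvd // => /dvdnP[t ht].
have [u v huv _] := egcdnP f n0.
(* From a - 1 = t (f, n) and u n = v f + (f, n), this k is also a + v t f. *)
pose k := (1 + n * (u * t))%N.
have ka : k = a %[mod f].
  have -> : k = (v * t * f + a)%N by rewrite /k; move: ht huv; rewrite [gcdn f n]gcdnC; nia.
  by rewrite modnMDl.
have k1 : k = 1 %[mod n] by rewrite /k addnC mulnC modnMDl.
exists k; split=> //.
have cf : coprime k f by rewrite -coprime_modl ka coprime_modl.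
have cn : coprime k n by rewrite -coprime_modl k1 coprime_modl coprime1n.
have lcm_dvd : (lcmn f n %| f * n)%N by rewrite dvdn_lcm dvdn_mulr // dvdn_mull.
by apply: coprime_dvdr lcm_dvd _; rewrite coprimeMr cf.
Qed.

Lemma ratr_Cyclotomic m : (0 < m)%N ->
  map_poly ratr (map_poly intr 'Phi_m : {poly rat}) = cyclotomic (zeta m) m.
Proof.
move=> m0; rewrite -(Cintr_Cyclotomic (zeta_prim m0)) -map_poly_comp.
by apply: eq_map_poly => c /=; rewrite ratr_int.
Qed.

(** Write x as q(zeta_m) with deg q < phi(m). Every primitive m-th root of unity is the image of
    zeta_m under an automorphism, which fixes x; hence q - x has phi(m) distinct roots and q is
    constant. *)
Lemma Qz_fixed_rat m x : (0 < m)%N -> Qz m x ->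
  (forall u : {rmorphism algC -> algC}, u x = x) -> exists r, x = ratr r.
Proof.
move=> m0 [p hp] xfix; have mP := zeta_prim m0.
pose Phi : {poly rat} := map_poly intr 'Phi_m.
have PhiC : map_poly ratr Phi = cyclotomic (zeta m) m by exact: ratr_Cyclotomic.
pose q := p %% Phi.
have hq : x = (map_poly ratr q).[zeta m].
  rewrite hp [in LHS](divp_eq p Phi) rmorphD rmorphM /= hornerD hornerM PhiC.
  by have := mP; rewrite -(root_cyclotomic mP) => /rootP->; rewrite mulr0 add0r.
have Phi0 : Phi != 0 by apply/monic_neq0/monic_map/Cyclotomic_monic.
have szq : (size q <= totient m)%N.
  rewrite -ltnS -(size_Cyclotomic m).
  have -> : size ('Phi_m) = size Phi by rewrite size_map_inj_poly // => a b /eqP; rewrite eqr_int => /eqP.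
  by rewrite ltn_modp.
pose rs := [seq zeta m ^+ k | k <- seq.filter (fun k => coprime k m) (iota 0 m)].
have szrs : size rs = totient m.
  rewrite size_map size_filter totient_count_coprime -sum1_count big_mkcond /=.
  rewrite [in LHS](_ : iota 0 m = index_iota 0 m) ?/index_iota ?subn0 //.
  by apply: eq_bigr => i _; rewrite coprime_sym; case: coprime.
pose r := map_poly ratr q - x%:P.
have szr : (size r <= totient m)%N.
  apply: (leq_trans (size_polyD _ _)); rewrite geq_max size_map_poly szq size_polyN.
  by apply: leq_trans (size_polyC_leq1 _) _; rewrite totient_gt0.
have r0 : r = 0.
  apply: (@roots_geq_poly_eq0 _ r rs); last by rewrite szrs.
    apply/allP => y; case/mapP => k; rewrite mem_filter => /andP[ck _] ->.
    have [u hu] := aut_zeta ck.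
    rewrite /root !hornerE -hu subr_eq0 -(xfix u) [in u x]hq -horner_map /= -map_poly_comp.
    by apply/eqP; congr horner; apply: eq_map_poly => c /=; rewrite fmorph_rat.
  rewrite map_inj_in_uniq ?filter_uniq ?iota_uniq // => i j.
  rewrite !mem_filter !mem_iota !add0n => /andP[_ /= im] /andP[_ /= jm] /eqP.
  by rewrite zetaX_eq // !modn_small // => /eqP.
exists q`_0.
have : r`_0 = 0 by rewrite r0 coef0.
by rewrite coefB coef_map coefC /= => /eqP; rewrite subr_eq0 => /eqP.
Qed.

(** Complex conjugation inverts roots of unity, and inversion commutes with u. This is the form in
    which the commutativity of the Galois group is used. *)
Lemma Qz_aut_conjC m (u : {rmorphism algC -> algC}) x : (0 < m)%N ->
  Qz m x -> u x^* = (u x)^*.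
Proof.
move=> m0; have conjz (z : algC) : z ^+ m = 1 -> z^* = z^-1.
  move=> zm; have h := unity_conjE m0 zm; have z0 : z != 0.
    by apply: contra_eq_neq h => ->; rewrite mul0r eq_sym oner_eq0.
  by apply: (mulfI z0); rewrite h divff.
apply: (@Qz_aut m (u \o Num.conj_op) (Num.conj_op \o u)) => /=.
by rewrite !conjz -?rmorphXn ?zetaX ?rmorph1 // fmorphV.
Qed.

Lemma Creal_odd_expr_inj n (x y : algC) : odd n ->
  x \is Num.real -> y \is Num.real -> x ^+ n = y ^+ n -> x = y.
Proof.
move=> on xr yr xy; have n0 : (0 < n)%N by case: n on {xy}.
have [y0|y0] := eqVneq y 0.
  by move: xy; rewrite y0 expr0n gtn_eqF // => /eqP; rewrite expf_eq0 n0 => /eqP.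
have tn : (x / y) ^+ n = 1 by rewrite expr_div_n xy divff // expf_neq0.
have tr : x / y \is Num.real by rewrite rpred_div.
have nt : `|x / y| = 1 by apply/eqP; rewrite -(@pexpr_eq1 _ _ n) // -normrX tn normr1.
have /eqP := real_normK tr; rewrite nt expr1n eq_sym sqrf_eq1 => /orP[] /eqP ht.
  by rewrite -[x](divfK y0) ht mul1r.
move: tn; rewrite ht -signr_odd on expr1 => /eqP.
by rewrite -subr_eq0 -opprD oppr_eq0 -(natrD _ 1 1) pnatr_eq0.
Qed.

Lemma real_root_exists p (g : rat) : odd p ->
  exists2 y : algC, y \is Num.real & y ^+ p = ratr g.
Proof.
move=> op; have p0 : (0 < p)%N by case: p op.
have [g0|g0] := leP 0 g.
  exists (p.-root (ratr g)); last by rewrite rootCK.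
  by rewrite ger0_real // rootC_ge0 // ler0q.
(* For g < 0 the root [p.-root] of least argument is in general not the real one. *)
exists (- p.-root (ratr (- g))).
  by rewrite rpredN ger0_real // rootC_ge0 // ler0q oppr_ge0 ltW.
by rewrite exprNn -signr_odd op expr1 rootCK // rmorphN mulN1r opprK.
Qed.

(* The real p-th root y of g lies in Q(zeta_m); as Q(zeta_m) is abelian, every conjugate of y is again
   real, hence equal to y. *)
Lemma Qz_root_rat m p x (g : rat) : (0 < m)%N -> prime p -> odd p -> (p %| m)%N ->
  Qz m x -> x ^+ p = ratr g -> exists r, g = r ^+ p.
Proof.
move=> m0 pp op pm hx xp; have p0 := prime_gt0 pp.
have [y yr yp] := real_root_exists g op.
have [y0|y0] := eqVneq y 0.
  exists 0; apply: (fmorph_inj (ratr : {rmorphism rat -> algC})).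
  by rewrite /= -yp y0 rmorphXn /= rmorph0.
have x0 : x != 0.
  by apply: contra_eq_neq yp => x0; rewrite -xp x0 expr0n gtn_eqF // expf_neq0.
have hy : Qz m y.
  have : (y / x) ^+ p = 1 by rewrite expr_div_n xp yp divff // -yp expf_neq0.
  case/(prim_rootP (zeta_prim p0)) => k /(canRL (divfK x0)) ->.
  by apply: QzM => //; apply: QzX; apply: Qz_dvd (Qz_zeta p).
have yfix (u : {rmorphism algC -> algC}) : u y = y.
  apply: (Creal_odd_expr_inj op) => //; last by rewrite -rmorphXn yp /= fmorph_rat.
  by apply/CrealP; rewrite -(Qz_aut_conjC u m0 hy) (CrealP yr).
have [r hr] := Qz_fixed_rat m0 hy yfix.
exists r; apply: (fmorph_inj (ratr : {rmorphism rat -> algC})).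
by rewrite /= -yp hr rmorphXn.
Qed.

(** * Square roots of prime discriminants *)

Lemma aut_crt a f n : (0 < a)%N -> (0 < f)%N -> (0 < n)%N ->
    coprime a f -> a = 1 %[mod gcdn f n] ->
  exists u : {rmorphism algC -> algC}, u (zeta f) = zeta f ^+ a /\ u (zeta n) = zeta n.
Proof.
move=> a0 f0 n0 caf ha; have [k [ck kf kn]] := chinese_exists a0 f0 n0 caf ha.
have [u hu] := aut_zeta ck; have l0 : (0 < lcmn f n)%N by rewrite lcmn_gt0 f0.
exists u; split.
  rewrite (aut_zeta_dvd l0 (dvdn_lcml f n) hu); apply/eqP; rewrite zetaX_eq //; exact/eqP.
rewrite (aut_zeta_dvd l0 (dvdn_lcmr f n) hu) -[RHS]expr1; apply/eqP; rewrite zetaX_eq //; exact/eqP.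
Qed.

Section GaussSum.
Variable q : nat.
Hypothesis q_prime : prime q.
Hypothesis q_odd : odd q.
Let q_gt0 : (0 < q)%N. Proof. exact: prime_gt0. Qed.

(** The additive character x |-> e^(2 i pi x / q) of the prime field. *)
Definition gauss_e (x : 'F_q) : algC := zeta q ^+ (x : nat).
Local Notation e := gauss_e.

Let eD x y : e (x + y) = e x * e y.
Proof.
have -> : x + y = (x + y)%N%:R by rewrite natrD !natr_Zp.
by rewrite /e val_Fp_nat // expr_mod ?zetaX // exprD.
Qed.

Let e0 : e 0 = 1. Proof. by rewrite /e expr0. Qed.

Let eN x : e x * e (- x) = 1. Proof. by rewrite -eD subrr e0. Qed.

Let sum_e : \sum_x e x = 0.
Proof.
have e1 : e 1 != 1.
  rewrite /e (val_Fp_nat q_prime 1) modn_small ?prime_gt1 // expr1.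
  by have := zetaX_eq 1 0 q_gt0; rewrite expr1 expr0 => ->; rewrite !modn_small ?prime_gt1.
have : \sum_x e x = e 1 * \sum_x e x.
  rewrite mulr_sumr (reindex_inj (addrI 1)) /=.
  by apply: eq_bigr => x _; rewrite eD.
move/eqP; rewrite -subr_eq0 -{1}[\sum_x e x]mul1r -mulrBl mulf_eq0 subr_eq0 eq_sym (negPf e1).
by move/eqP.
Qed.

Let sum_eM y : y != 0 -> \sum_x e (y * x) = 0.
Proof. by move=> y0; rewrite -[RHS]sum_e [RHS](reindex_inj (mulfI y0)) /=. Qed.

Let two_neq0 : (2 : 'F_q) != 0.
Proof.
apply/eqP => /(congr1 (fun x : 'F_q => x : nat)).
rewrite (val_Fp_nat q_prime 2) modn_small //.
by have := prime_gt1 q_prime; case: (q) q_odd => [|[|[|]]].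
Qed.

(** The quadratic Gauss sum, summed over squares instead of weighted by the Legendre symbol; [S'] is
    its complex conjugate. *)
Let S : algC := \sum_(x : 'F_q) e (x ^+ 2).
Let S' : algC := \sum_(x : 'F_q) e (- x ^+ 2).

(** Substituting x = y + u turns the double sum into sum_u e(u^2) sum_y e(2 u y), where only u = 0
    survives because q is odd. *)
Let mulSS' : S * S' = q%:R.
Proof.
rewrite mulr_sumr.
under eq_bigr => y _ do rewrite mulr_suml (reindex_inj (addrI y)) /=.
rewrite exchange_big /= (bigD1 0) //= [X in _ + X]big1 ?addr0.
  under eq_bigr => y _ do rewrite addr0 eN.
  by rewrite sumr_const card_Fp.
move=> u u0; transitivity (e (u ^+ 2) * \sum_y e (2 * u * y)).
  rewrite mulr_sumr; apply: eq_bigr => y _; rewrite -!eD; congr e; ring.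
by rewrite sum_eM ?mulr0 // mulf_neq0.
Qed.

Let N (k : 'F_q) : nat := \sum_(x : 'F_q | x ^+ 2 == k) 1.

Let N0 : N 0 = 1%N.
Proof.
by rewrite /N (big_pred1 0) // => x; rewrite expf_eq0.
Qed.

Let N2 (x0 : 'F_q) : x0 != 0 -> N (x0 ^+ 2) = 2%N.
Proof.
move=> x00; rewrite /N sum1_card (eq_card (B := [set x0; - x0])) ?cards2.
  by rewrite -subr_eq0 opprK -mulr2n -mulr_natl mulf_neq0.
by move=> x; rewrite !inE -eqf_sqr.
Qed.

Let Ncase k : N k = 0%N \/ exists x : 'F_q, x ^+ 2 = k.
Proof.
have [x /eqP hx|h] := pickP (fun x : 'F_q => x ^+ 2 == k); first by right; exists x.
by left; rewrite /N big_pred0.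
Qed.

Let SE : S = \sum_k (N k)%:R * e k.
Proof.
rewrite /S (partition_big (fun x : 'F_q => x ^+ 2) xpredT) //=.
apply: eq_bigr => k _; rewrite /N natr_sum mulr_suml.
by apply: eq_bigr => x /eqP ->; rewrite mul1r.
Qed.

Let S'E : S' = \sum_k (N (- k))%:R * e k.
Proof.
rewrite /S' (partition_big (fun x : 'F_q => - x ^+ 2) xpredT) //=.
apply: eq_bigr => k _; rewrite /N natr_sum mulr_suml.
rewrite (eq_bigl (fun x : 'F_q => x ^+ 2 == - k)) => [|x]; last by rewrite eqr_oppLR.
by apply: eq_bigr => x /eqP ->; rewrite opprK mul1r.
Qed.

Let sumN : \sum_k N k = q.
Proof.
rewrite -[RHS](card_Fp q_prime) -sum1_card.
by rewrite [in RHS](partition_big (fun x : 'F_q => x ^+ 2) xpredT).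
Qed.

(* If -1 is a square then S' = S.  Otherwise N k + N (-k) <= 2 for all k, and equality holds on
   summing over k, so that S + S' = 2 sum_k e k = 0. *)
Let S2 : S ^+ 2 = q%:R \/ S ^+ 2 = - q%:R.
Proof.
have [i /eqP hi|hi] := pickP (fun i : 'F_q => i ^+ 2 == -1).
  left; rewrite -mulSS' expr2; congr (_ * _).
  have i0 : i != 0 by apply/eqP => i0; move: hi; rewrite i0 expr0n => /eqP; rewrite eq_sym oppr_eq0 oner_eq0.
  rewrite [in LHS]/S (reindex_inj (mulfI i0)) /=.
  by apply: eq_bigr => x _; rewrite exprMn hi mulN1r.
right; have MP k : (N k + N (- k) <= 2 ?= iff (N k + N (- k) == 2))%N.
  split=> //; have [->|k0] := eqVneq k 0; first by rewrite oppr0 N0.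
  have [->|[x hx]] := Ncase k; have [->|[y hy]] := Ncase (- k) => //.
  - rewrite -hy N2 //; apply/eqP => y0; move: hy k0; rewrite y0 expr0n => /eqP.
    by rewrite eq_sym oppr_eq0 => ->.
  - rewrite -hx N2 //; apply/eqP => x0; move: hx k0; rewrite x0 expr0n => /eqP.
    by rewrite eq_sym => ->.
  have x0 : x != 0 by apply/eqP => x0; move: hx k0; rewrite x0 expr0n => /eqP; rewrite eq_sym => ->.
  have := hi (y / x); rewrite expr_div_n hx hy mulNr divff ?eqxx //.
have [_] := leqif_sum (fun k (_ : xpredT k) => MP k).
rewrite big_split /= sumN [X in (_ + X)%N](reindex_inj oppr_inj) /=.
under [X in (_ + X)%N]eq_bigr => k _ do rewrite opprK.
rewrite sumN sum_nat_const card_Fp // muln2 addnn eqxx => /esym/forallP hM.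
have : S + S' = 0.
  transitivity (2 * \sum_x e x); last by rewrite sum_e mulr0.
  rewrite SE S'E -big_split mulr_sumr /=; apply: eq_bigr => k _.
  by rewrite -mulrDl -natrD (eqP (hM k)).
by move/eqP; rewrite addrC addr_eq0 => /eqP S'S; rewrite expr2 -mulSS' S'S mulrN opprK.
Qed.

(** In the Gauss sum 0 has one square root and any other k has none or two, whence the form 1 + 2
    eta. This form later determines the sign of the square, and the Kronecker symbol at 2. *)
Lemma gauss_sqrt : exists eta, Zz q eta /\
  ((1 + 2 * eta) ^+ 2 = q%:R \/ (1 + 2 * eta) ^+ 2 = - q%:R).
Proof.
exists (\sum_(k : 'F_q | k != 0) (N k)./2%:R * e k); split.
  apply: Zz_sum => k _; apply: ZzM; first exact: (Zz_int q (N k)./2).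
  by apply: ZzX; apply: Zz_zeta.
suff -> : 1 + 2 * (\sum_(k : 'F_q | k != 0) (N k)./2%:R * e k) = S by exact: S2.
rewrite SE [RHS](bigD1 (0 : 'F_q)) //=; congr (_ + _); first by rewrite N0 e0 mulr1.
rewrite mulr_sumr.
apply: eq_bigr => k k0; rewrite mulrA; congr (_ * _); rewrite -natrM; congr _%:R.
have [->|[x hx]] := Ncase k; first by [].
by rewrite -hx N2 //; apply/eqP => x0; move: hx k0; rewrite x0 expr0n => <-; rewrite eqxx.
Qed.
End GaussSum.

Lemma Aint_rat_int (r : rat) : (ratr r : algC) \in Aint -> exists c : int, r = c%:~R.
Proof.
move=> hr; have /intrP[c hc] := Cint_rat_Aint (Crat_rat r) hr.
exists c; apply: (fmorph_inj (ratr : {rmorphism rat -> algC})); by rewrite /= hc ratr_int.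
Qed.

Lemma Aint_div_dvd (d c : int) (z : algC) : z \in Aint -> c%:~R = d%:~R * z -> (d %| c)%Z.
Proof.
move=> zA hz; have [d0|d0] := eqVneq d 0.
  by move: hz; rewrite d0 mul0r => /eqP; rewrite intr_eq0 => /eqP ->.
have dC : (d%:~R : algC) != 0 by rewrite intr_eq0.
have zE : z = ratr (c%:~R / d%:~R).
  by rewrite rmorphM fmorphV /= !ratr_int; apply: (mulfI dC); rewrite -hz mulrC divfK.
have [k hk] : exists k : int, (c%:~R / d%:~R : rat) = k%:~R by apply: Aint_rat_int; rewrite -zE.
apply/dvdzP; exists k; apply/eqP; rewrite -(eqr_int rat) rmorphM /= -hk divfK // intr_eq0 //.
Qed.

(** (c - 1) / 4 = eta + eta^2 is an algebraic integer. For Gauss sums this decides between q and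
    -q. *)
Lemma sqrt_mod4 (eta : algC) (c : int) : eta \in Aint ->
  (1 + 2 * eta) ^+ 2 = c%:~R -> (4 %| c - 1)%Z.
Proof.
move=> eA h; apply: (@Aint_div_dvd _ _ (eta + eta ^+ 2)); first by rewrite rpredD ?rpredX.
by rewrite rmorphB /= -h; ring.
Qed.

(** For odd p the condition selects (-1)^((p-1)/2) p, the one of p and -p whose square root lies in
    Q(zeta_p). *)
Definition prime_disc (p : nat) (d : int) : bool :=
  if p == 2%N then d \in ([:: -4; 8; -8] : seq int)
  else (`|d|%N == p) && (4 %| d - 1)%Z.

Lemma zeta4 : zeta 4%N ^+ 2 = -1.
Proof.
have h : zeta 4%N ^+ 2 != 1 by have := zetaX_eq 2 0 (isT : (0 < 4)%N); rewrite expr0 => ->.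
have /eqP : (zeta 4%N ^+ 2) ^+ 2 = 1 by rewrite -exprM zetaX.
by rewrite sqrf_eq1 (negPf h) => /eqP.
Qed.

Lemma zeta8 : zeta 8%N ^+ 4 = -1.
Proof.
have h : zeta 8%N ^+ 4 != 1 by have := zetaX_eq 4 0 (isT : (0 < 8)%N); rewrite expr0 => ->.
have /eqP : (zeta 8%N ^+ 4) ^+ 2 = 1 by rewrite -exprM zetaX.
by rewrite sqrf_eq1 (negPf h) => /eqP.
Qed.

(* The last clause makes |d| the exact p-part of the conductor of t: some automorphism fixes the
   roots of unity of order |d| / p but not t. *)
Definition is_sqrt_gen (p : nat) (d : int) (t : algC) : Prop :=
  [/\ Zz `|d|%N t, t ^+ 2 = d%:~R,
      (odd `|d|%N -> exists2 eta, Zz `|d|%N eta & t = 1 + 2 * eta) &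
      exists k, [/\ (0 < k)%N, coprime k `|d|%N, k = 1 %[mod `|d| %/ p] &
        forall u : {rmorphism algC -> algC},
          u (zeta `|d|%N) = zeta `|d|%N ^+ k -> u t = - t]].

Lemma prime_disc_sqrt p d : prime p -> prime_disc p d -> exists t, is_sqrt_gen p d t.
Proof.
move=> pp; rewrite /prime_disc; case: eqVneq => [->|p2].
  have hz (m : nat) k : Zz m (2 * zeta m ^+ k).
    by apply: ZzM; [apply: (Zz_int m 2) | apply: ZzX; apply: Zz_zeta].
  rewrite !inE => /or3P[] /eqP ->.
  - exists (2 * zeta 4%N); split=> //; first by apply: (hz 4 1).
      by rewrite exprMn zeta4; ring.
    exists 3%N; split=> // u /= hu; rewrite rmorphM rmorph_nat /= hu exprS zeta4; ring.
  (* zeta_8 - zeta_8^3 = sqrt 2, and in the next case zeta_8 + zeta_8^3 = sqrt (-2). The exponent 5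
     is 1 mod 4 and sends zeta_8 to - zeta_8. *)
  - have t2 : (2 * (zeta 8%N - zeta 8%N ^+ 3)) ^+ 2 = 8 :> algC.
      transitivity (4 * (zeta 8%N ^+ 2 - 2 * zeta 8%N ^+ 4 + zeta 8%N ^+ 4 * zeta 8%N ^+ 2)); first by ring.
      by rewrite zeta8; ring.
    exists (2 * (zeta 8%N - zeta 8%N ^+ 3)); split=> //.
      rewrite mulrBr -mulN1r; apply: ZzD; first exact: (hz 8 1).
      by apply: ZzM; [apply: (Zz_int 8 (-1)) | apply: hz].
    exists 5%N; split=> // u hu; have {}hu : u (zeta 8%N) = zeta 8%N ^+ 5 := hu.
    move: zeta8 hu; move: (zeta 8%N) => z z8 hu.
    rewrite rmorphM rmorph_nat rmorphB rmorphXn /= hu.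
    transitivity (2 * (z ^+ 4 * z - (z ^+ 4) ^+ 3 * z ^+ 3)); [|rewrite z8]; ring.
  - have t2 : (2 * (zeta 8%N + zeta 8%N ^+ 3)) ^+ 2 = - 8 :> algC.
      transitivity (4 * (zeta 8%N ^+ 2 + 2 * zeta 8%N ^+ 4 + zeta 8%N ^+ 4 * zeta 8%N ^+ 2)); first by ring.
      by rewrite zeta8; ring.
    exists (2 * (zeta 8%N + zeta 8%N ^+ 3)); split=> //.
      by rewrite mulrDr; apply: ZzD; first exact: (hz 8 1).
    exists 5%N; split=> // u hu; have {}hu : u (zeta 8%N) = zeta 8%N ^+ 5 := hu.
    move: zeta8 hu; move: (zeta 8%N) => z z8 hu.
    rewrite rmorphM rmorph_nat rmorphD rmorphXn /= hu.
    transitivity (2 * (z ^+ 4 * z + (z ^+ 4) ^+ 3 * z ^+ 3)); [|rewrite z8]; ring.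
case/andP=> /eqP hd d4; have p0 := prime_gt0 pp.
have op : odd p by apply: contraNT p2 => /(prime_oddPn pp) ->.
have [eta [hz hs]] := gauss_sqrt pp op; pose t := 1 + 2 * eta.
have tZ : Zz p t by apply: ZzD; [apply: (Zz_int p 1) | apply: ZzM => //; apply: (Zz_int p 2)].
have etaA : eta \in Aint by apply: Zz_Aint hz.
have t2 : t ^+ 2 = d%:~R.
  have dp : d = p%:Z \/ d = - p%:Z by lia.
  case: hs => hs.
    have := sqrt_mod4 (c := p%:Z) etaA hs; case: dp d4 => -> // *; exfalso; lia.
  have := sqrt_mod4 (c := - p%:Z) etaA; rewrite hs rmorphN /= => /(_ erefl).
  case: dp d4 => -> //; last by rewrite rmorphN.
  move=> *; exfalso; lia.
exists t; rewrite /is_sqrt_gen hd; split=> //; first by move=> _; exists eta.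
(* If no such k existed, every automorphism would fix t, and t would be a rational integer whose
   square is p up to sign. *)
apply: contrapT => hk.
have ufix (u : {rmorphism algC -> algC}) : u t = t.
  have [k ck hu] := aut_zeta_exp u p0.
  apply: contrapT => ut.
  apply: hk; exists k; split=> //.
  - by case: k ck {hu} => // ; rewrite /coprime gcd0n => /eqP p1; move: pp; rewrite p1.
  - by rewrite divnn p0 !modn1.
  move=> v hv; have vt : v t = u t by apply: Qz_aut (Zz_Qz tZ); rewrite hv hu.
  have /eqP : (u t) ^+ 2 = t ^+ 2 by rewrite -rmorphXn t2 /= rmorph_int.
  by rewrite eqf_sqr vt => /orP[/eqP/ut|/eqP].
have [r hr] := Qz_fixed_rat p0 (Zz_Qz tZ) ufix.
have [c hc] : exists c : int, r = c%:~R.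
  by apply: Aint_rat_int; rewrite -hr; apply: Zz_Aint tZ.
have : c ^+ 2 = d.
  apply/eqP; rewrite -(eqr_int algC) rmorphXn /= -t2 hr hc ratr_int //.
move/(congr1 absz); rewrite hd abszX => hp.
by have := lognX p `|c| 2; rewrite hp logn_prime // eqxx; lia.
Qed.

(** * Fundamental discriminants and the Kronecker symbol *)

Definition sqfree (n : nat) : Prop :=
  (0 < n)%N /\ forall p, prime p -> ~~ (p ^ 2 %| n)%N.

Lemma sqfree_dvd d n : (d %| n)%N -> sqfree n -> sqfree d.
Proof.
move=> dn [n0 h]; split; first exact: dvdn_gt0 dn.
by move=> p /h; apply: contra => /dvdn_trans; apply.
Qed.

Lemma sqfree_mul_prime p m : prime p -> sqfree (p * m) -> ~~ (p %| m)%N.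
Proof. by move=> pp [_ /(_ _ pp)]; apply: contra => pm; rewrite expnS expn1 dvdn_mul. Qed.

(** D = 1 is included, so that gamma and the cofactors in decompositions are covered. Squarefreeness
    rules out e = 0 mod 4, which leaves the residues 2 and 3 in the second case. *)
Definition fund_disc (D : int) : Prop := exists e : int, sqfree `|e|%N /\
  ((D = e /\ (e %% 4)%Z = 1) \/ (D = 4 * e /\ (e %% 4)%Z <> 1)).

Lemma fund_disc_gt0 D : fund_disc D -> (0 < `|D|)%N.
Proof. by case=> e [[e0 _]] [] [-> _] //; lia. Qed.

Lemma prime_disc_pow p d : prime p -> prime_disc p d ->
  exists2 j, (0 < j)%N & `|d|%N = (p ^ j)%N.
Proof.
move=> pp; rewrite /prime_disc; case: eqP => [->|_ /andP[/eqP -> _]]; last by exists 1%N.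
by rewrite !inE => /or3P[] /eqP ->; [exists 2%N | exists 3%N | exists 3%N].
Qed.

Lemma odd_mod4_sign (p : nat) : odd p ->
  (4 %| (if (p %% 4 == 1)%N then p%:Z else - p%:Z) - 1)%Z.
Proof. by case: ifP => /eqP; lia. Qed.

(** The sign of d is chosen to keep the cofactor fundamental. For odd p, d = 1 mod 4, so dividing by
    d preserves the residue of e mod 4; for p = 2, the choice among -4, 8 and -8 makes the odd
    cofactor 1 mod 4. *)
Lemma fund_disc_decomp D p : fund_disc D -> prime p -> (p %| `|D|)%N ->
  exists d c, [/\ prime_disc p d, fund_disc c, D = d * c & ~~ (p %| `|c|)%N].
Proof.
case=> e [sqe he] pp; have [p2|p2] := eqVneq p 2%N.
  rewrite p2 {p p2 pp} => D2; have e4 : ~~ (2 ^ 2 %| `|e|)%N by case: sqe => _; apply.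
  case: he => [[De e1]|[De e1]]; first by exfalso; lia.
  have [e3|e2] : (e %% 4)%Z = 3 \/ (e %% 4)%Z = 2 by lia.
    exists (-4), (- e); rewrite /prime_disc /= !inE; split; [by []| |lia|lia].
    by exists (- e); rewrite abszN; split=> //; left; split=> //; lia.
  have [e' ee'] : exists e', e = 2 * e' by exists (e %/ 2)%Z; lia.
  have sqe' : sqfree `|e'| by apply: sqfree_dvd sqe; rewrite ee' abszM dvdn_mull.
  have [e3|e3] : (e' %% 4)%Z = 3 \/ (e' %% 4)%Z = 1 by lia.
    exists (-8), (- e'); rewrite /prime_disc /= !inE; split; [by rewrite orbT| |lia|lia].
    by exists (- e'); rewrite abszN; split=> //; left; split=> //; lia.
  exists 8, e'; rewrite /prime_disc /= !inE; split; [by rewrite orbT| |lia|lia].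
  by exists e'; split=> //; left.
have op : odd p by apply: contraNT p2 => /(prime_oddPn pp) ->.
have p4 : ~~ (p %| 4)%N by rewrite (_ : 4%N = (2 ^ 2)%N) // Euclid_dvdX // dvdn_prime2 // (negPf p2).
move=> pD; have pe : (p %| `|e|)%N.
  case: he => [[De _]|[De _]]; first by rewrite -De.
  move: pD; rewrite De abszM Euclid_dvdM // => /orP[|//].
  by rewrite (negPf p4).
pose d : int := if (p %% 4 == 1)%N then p%:Z else - p%:Z.
have dabs : `|d|%N = p by rewrite /d; case: ifP => _ //; rewrite abszN.
have d4 : (4 %| d - 1)%Z by apply: odd_mod4_sign.
have /dvdzP[e' ee'] : (d %| e)%Z by rewrite dvdzE dabs.
have eabs : `|e|%N = (p * `|e'|)%N by rewrite ee' abszM dabs mulnC.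
have sqe' : sqfree `|e'| by apply: sqfree_dvd sqe; rewrite eabs dvdn_mull.
have pe' : ~~ (p %| `|e'|)%N by apply: sqfree_mul_prime => //; rewrite -eabs.
have e'4 : (e' %% 4)%Z = (e %% 4)%Z.
  case/dvdzP: d4 => k hk; have dk : d = k * 4 + 1 by rewrite -hk subrK.
  by rewrite ee' dk mulrDr mulr1 mulrA modzMDl.
have pd : prime_disc p d by rewrite /prime_disc (negPf p2) dabs eqxx.
case: he => [[De e1]|[De e1]].
  exists d, e'; split=> //; last by rewrite De ee' mulrC.
  by exists e'; split=> //; left; rewrite e'4.
exists d, (4 * e'); split=> //; last 2 first.
- by rewrite De ee'; ring.
- by rewrite abszM Euclid_dvdM // negb_or pe' andbT.
by exists e'; split=> //; right; rewrite e'4.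
Qed.

Lemma fund_disc_abs1 D : fund_disc D -> `|D|%N = 1%N -> D = 1.
Proof. by case=> e [_ [[-> h]|[-> h]]]; lia. Qed.

(** Obtained by multiplying the square roots of prime discriminants; products of elements 1 + 2 eta
    are again of that form. *)
Lemma fund_disc_sqrt D : fund_disc D ->
  exists s, [/\ Zz `|D|%N s, s ^+ 2 = D%:~R &
    odd `|D|%N -> exists2 eta, Zz `|D|%N eta & s = 1 + 2 * eta].
Proof.
have [n hn] := ubnP `|D|%N; elim: n => // n IH in D hn * => fD.
have D0 := fund_disc_gt0 fD.
have [D1|D1] := eqVneq `|D|%N 1%N.
  rewrite (fund_disc_abs1 fD D1); exists 1; split; first exact: (Zz_int _ 1).
    by rewrite expr1n.
  by exists 0; [exact: (Zz_int _ 0) | ring].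
have D_gt1 : (1 < `|D|)%N by lia.
have pp := pdiv_prime D_gt1.
have [d [c [pd fc Ddc pc]]] := fund_disc_decomp fD pp (pdiv_dvd _).
have [j j0 dj] := prime_disc_pow pp pd.
have Dabs : `|D|%N = (`|d| * `|c|)%N by rewrite Ddc abszM.
have c0 := fund_disc_gt0 fc.
have d1 : (1 < `|d|)%N by rewrite dj -{1}(expn0 (pdiv `|D|)) ltn_exp2l // prime_gt1.
have [||sc [scZ sc2 scodd]] := IH c => //; first by rewrite Dabs in hn; nia.
have [t [tZ t2 todd _]] := prime_disc_sqrt pp pd.
have dD : (`|d| %| `|D|)%N by rewrite Dabs dvdn_mulr.
have cD : (`|c| %| `|D|)%N by rewrite Dabs dvdn_mull.
exists (t * sc); split.
- by apply: ZzM; [apply: Zz_dvd tZ | apply: Zz_dvd scZ].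
- by rewrite exprMn t2 sc2 Ddc rmorphM.
rewrite Dabs oddM => /andP[/todd[eta etaZ ->] /scodd[eta' eta'Z ->]].
have Z1 : Zz (`|d| * `|c|) eta by rewrite -Dabs; apply: Zz_dvd etaZ.
have Z2 : Zz (`|d| * `|c|) eta' by rewrite -Dabs; apply: Zz_dvd eta'Z.
exists (eta + eta' + 2 * (eta * eta')); last by ring.
by apply: ZzD; [apply: ZzD | apply: ZzM; [apply: (Zz_int _ 2) | apply: ZzM]].
Qed.

(* Write D = d c with d the prime discriminant at p.  If the p-part of D did not divide m, some
   automorphism would fix zeta_(m |c|), hence sqrt D and sqrt c, and negate sqrt d. *)
Lemma conductor_dvd D m s : (0 < m)%N -> fund_disc D -> s ^+ 2 = D%:~R -> Qz m s ->
  (`|D| %| m)%N.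
Proof.
move=> m0 fD s2 sQ; have D0 := fund_disc_gt0 fD.
apply/(dvdn_partP _ D0) => p; rewrite mem_primes => /and3P[pp _ pD].
have [d [c [pd fc Ddc pc]]] := fund_disc_decomp fD pp pD.
have [j j0 dj] := prime_disc_pow pp pd; have c0 := fund_disc_gt0 fc.
have Dabs : `|D|%N = (p ^ j * `|c|)%N by rewrite Ddc abszM dj.
have -> : ((`|D|%N)`_p = p ^ j)%N.
  have pj0 : (0 < p ^ j)%N by rewrite expn_gt0 prime_gt0.
  have cpc : coprime p `|c| by rewrite prime_coprime.
  by rewrite p_part Dabs (lognM p pj0 c0) (pfactorK j pp) (logn_coprime cpc) addn0.
apply: contrapT => /negP pjm.
have [t [tZ t2 _ [k [k0 ck k1 hk]]]] := prime_disc_sqrt pp pd.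
have [sc [scZ sc2 _]] := fund_disc_sqrt fc.
pose M := (m * `|c|)%N; have M0 : (0 < M)%N by rewrite muln_gt0 m0.
(* p^j does not divide m and |c| is prime to p, so (|d|, M) is a proper divisor of |d| = p^j. It
   therefore divides |d| / p, modulo which k is 1. *)
have gM : (gcdn `|d| M %| `|d| %/ p)%N.
  rewrite dj; have /(dvdn_pfactor _ _ pp)[i ij gi] := dvdn_gcdl (p ^ j) M.
  rewrite gi -(prednK j0) expnS mulKn ?prime_gt0 // dvdn_exp2l //.
  have : i != j.
    apply: contraNneq pjm => ij'; rewrite -(@Gauss_dvdl _ _ `|c|).
      by rewrite -/M -{1}ij' -gi dvdn_gcdr.
    by rewrite coprimeXl // prime_coprime.
  by move=> ij'; rewrite -ltnS prednK // ltn_neqAle ij' ij.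
have d0 : (0 < `|d|)%N by rewrite dj expn_gt0 prime_gt0.
have k1' : k = 1 %[mod gcdn `|d| M].
  by rewrite -(modn_dvdm k gM) k1 modn_dvdm.
have [u [u1 u2]] := aut_crt k0 d0 M0 ck k1'.
have us : u s = s by apply: (Qz_aut_id u2); apply: Qz_dvd sQ; rewrite // dvdn_mulr.
have usc : u sc = sc by apply: (Qz_aut_id u2); apply: Qz_dvd (Zz_Qz scZ); rewrite // dvdn_mull.
have ut := hk u u1.
have /eqP : (s * sc) ^+ 2 = (t * c%:~R) ^+ 2.
  by rewrite !exprMn s2 sc2 t2 Ddc rmorphM /=; ring.
have tc0 : t * c%:~R != 0.
  rewrite mulf_neq0 ?intr_eq0 -?absz_gt0 //.
  by have : t ^+ 2 != 0; [rewrite t2 intr_eq0 -absz_gt0 | rewrite expf_eq0].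
have key x : x = t * c%:~R -> u x = x -> False.
  move=> ->; rewrite rmorphM rmorph_int /= ut mulNr => /eqP; rewrite eq_sym -subr_eq0 opprK.
  by rewrite -mulr2n mulrn_eq0 (negPf tc0).
rewrite eqf_sqr => /orP[] /eqP hs; first by apply: (key _ hs); rewrite rmorphM us usc.
apply: (key (- (s * sc))); first by rewrite hs opprK.
by rewrite rmorphN rmorphM us usc.
Qed.

(** * Frobenius congruences and the Kronecker symbol *)

Definition congA (p : nat) (x y : algC) : Prop := exists2 z, z \in Aint & x = y + p%:R * z.

Lemma congA_trans p y x z : congA p x y -> congA p y z -> congA p x z.
Proof. by case=> a aA -> [b bA ->]; exists (b + a); [rewrite rpredD | ring]. Qed.

Lemma congA_sym p x y : congA p x y -> congA p y x.
Proof. by case=> a aA ->; exists (- a); [rewrite rpredN | ring]. Qed.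

Lemma congA_exprD p x y : prime p -> x \in Aint -> y \in Aint ->
  congA p ((x + y) ^+ p) (x ^+ p + y ^+ p).
Proof.
move=> pp xA yA; rewrite exprDn; case: p pp => // n pp.
rewrite big_ord_recr big_ord_recl /= subnn subn0 bin0 binn !expr0 mul1r mulr1 !mulr1n.
pose z := \sum_(i < n) x ^+ (n.+1 - bump 0 i) * y ^+ bump 0 i *+ ('C(n.+1, bump 0 i) %/ n.+1)%N.
exists z; first by apply: rpred_sum => i _; rewrite rpredMn // rpredM // rpredX.
rewrite -addrA [X in _ + X]addrC addrA; congr (_ + _); rewrite mulr_sumr.
apply: eq_bigr => i _; rewrite mulr_natl -mulrnA divnK //.
by apply: prime_dvd_bin => //; rewrite /bump /= add1n ltnS ltn_ord.
Qed.

(** The algebraic integers y with u y = y^p modulo p are closed under sums, by the binomial theorem,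
    and under products; they include the integers and zeta_m. Working modulo p among all algebraic
    integers avoids choosing a prime above p. *)
Lemma frobenius p m (u : {rmorphism algC -> algC}) x : prime p -> (0 < m)%N ->
  u (zeta m) = zeta m ^+ p -> Zz m x -> congA p (u x) (x ^+ p).
Proof.
move=> pp m0 hu [P ->]; rewrite horner_coef.
have zA : zeta m \in Aint by apply: Aint_prim_root (zeta_prim m0).
pose good y := y \in Aint /\ congA p (u y) (y ^+ p).
pose Q : {poly algC} := map_poly intr P; rewrite -/Q.
suff [_ h] : good (\sum_(i < size Q) Q`_i * zeta m ^+ i) by exact: h.
have goodD y z : good y -> good z -> good (y + z).
  case=> yA [a aA ya] [zA' [b bA zb]]; split; first by rewrite rpredD.
  apply: congA_trans (congA_sym (congA_exprD pp yA zA')).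
  by exists (a + b); [rewrite rpredD | rewrite rmorphD /= ya zb; ring].
have goodM y z : good y -> good z -> good (y * z).
  case=> yA [a aA ya] [zA' [b bA zb]]; split; first by rewrite rpredM.
  exists (a * z ^+ p + b * y ^+ p + p%:R * (a * b)).
    by rewrite !rpredD ?rpredM ?rpredX ?rpred_nat.
  by rewrite rmorphM /= ya zb exprMn; ring.
have good0 : good 0.
  by split=> //; exists 0 => //; rewrite rmorph0 expr0n (gtn_eqF (prime_gt0 pp)) mulr0 addr0.
have good1 : good 1 by split=> //; exists 0 => //; rewrite rmorph1 expr1n; ring.
have goodN y : good y -> good (- y).
  case=> yA [a aA ya]; split; first by rewrite rpredN.
  rewrite rmorphN /= ya exprNn; have [p2|op] := even_prime pp.
    (* For p = 2 the power (-y)^p is y^p, which agrees with - y^p modulo 2. *)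
    exists (- a - y ^+ p); first by rewrite rpredB ?rpredN ?rpredX.
    by rewrite p2; ring.
  by exists (- a); [rewrite rpredN | rewrite -signr_odd op; ring].
have goodn n : good n%:R by elim: n => // n IH; rewrite -natr1; apply: goodD.
have goodz (c : int) : good c%:~R.
  by case: c => n; [exact: goodn | rewrite NegzE rmorphN /=; apply/goodN/goodn].
have goodX y n : good y -> good (y ^+ n).
  by move=> hy; elim: n => // n IH; rewrite exprS; apply: goodM.
apply: big_ind => // i _; apply: goodM; first by rewrite /Q coef_map; apply: goodz.
by apply: goodX; split=> //; exists 0 => //; rewrite hu; ring.
Qed.

Lemma euler_criterion p (m : int) : prime p -> odd p -> ~~ (p %| m)%Z ->
  (p %| m ^+ p./2 - kronecker_prime m p)%Z.
Proof.
move=> pp op pm; rewrite /kronecker_prime.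
have p2 : p != 2%N by apply: contraTneq op => ->.
rewrite (negPf p2) (negPf pm).
have chp := pchar_Fp pp; rewrite (dvdz_pcharf chp) rmorphB rmorphXn /=.
pose y : 'F_p := m%:~R; rewrite -/y.
have y0 : y != 0 by rewrite /y -(dvdz_pcharf chp).
have Fpm (x : 'F_p) : x != 0 -> x ^+ p.-1 = 1.
  move=> x0; apply: (mulfI x0); rewrite -exprS prednK ?prime_gt0 // mulr1.
  by have := expf_card x; rewrite card_Fp.
have p12 : p.-1 = (2 * p./2)%N by lia.
have sq_eq (x : nat) : ((x%:Z) ^+ 2 == m %[mod p])%Z = ((x%:R : 'F_p) ^+ 2 == y).
  by rewrite eqz_mod_dvd (dvdz_pcharf chp) rmorphB rmorphXn /= subr_eq0 pmulrn.
case: ifP => [/existsP[x]|/existsP hx].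
  rewrite sq_eq => /eqP hx; rewrite -hx -exprM -p12 subr_eq0 Fpm //.
  by apply: contraNneq y0 => x0; rewrite -hx x0 expr0n.
have nsq (x : 'F_p) : x ^+ 2 != y.
  apply/negP => hxy; apply: hx.
  have xp : (x < p)%N by rewrite -{2}(Fp_cast pp) ltn_ord.
  by exists (Ordinal xp); rewrite sq_eq /= natr_Zp.
have p1_gt0 : (0 < p.-1)%N by have := prime_gt1 pp; lia.
pose rs := enum [pred x : 'F_p | x != 0].
have rsP : all p.-1.-unity_root rs.
  by apply/allP => x; rewrite mem_enum inE => /Fpm; rewrite unity_rootE => ->.
have szrs : (p.-1 <= size rs)%N.
  rewrite -cardE; have := cardC1 (0 : 'F_p); rewrite card_Fp // => <-.
  by apply: subset_leq_card; apply/fintype.subsetP => x; rewrite !inE.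
have /hasP[r _ rP] := has_prim_root p1_gt0 rsP (enum_uniq _) szrs.
(* With y = r^k and r of order p - 1, the value y^((p-1)/2) = 1 would make k even and y a square. *)
have [[k _] /= hk] := prim_rootP rP (Fpm _ y0).
have /eqP : (y ^+ p./2) ^+ 2 = 1 by rewrite -exprM mulnC -p12 Fpm.
rewrite sqrf_eq1 => /orP[/eqP h1|/eqP ->]; last by rewrite rmorphN subrr.
exfalso; move/eqP: h1; rewrite hk -exprM -(prim_order_dvd rP) p12 dvdn_pmul2r.
  by move=> /dvdnP[j hj]; have := nsq (r ^+ j); rewrite -exprM hk hj eqxx.
by have := prime_gt1 pp; lia.
Qed.

(** Since s^2 is rational, u s is s or -s. For odd p, u s = s^p = D^((p-1)/2) s modulo p, and
    Euler's criterion decides the sign. For p = 2 the two signs agree modulo 2, so Frobenius is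
    applied to eta instead: eta^2 = c - eta with c = (D - 1) / 4, and the parity of c is read off
    from D mod 8. *)
Lemma kronecker_prime_sqrt p D s (u : {rmorphism algC -> algC}) :
    prime p -> ~~ (p %| D)%Z -> D != 0 -> Zz `|D|%N s -> s ^+ 2 = D%:~R ->
    (odd `|D|%N -> exists2 eta, Zz `|D|%N eta & s = 1 + 2 * eta) ->
    u (zeta `|D|%N) = zeta `|D|%N ^+ p ->
  u s = (kronecker_prime D p)%:~R * s.
Proof.
move=> pp pD D0 sZ s2 sodd hu; have Da0 : (0 < `|D|)%N by rewrite absz_gt0.
have sA := Zz_Aint Da0 sZ.
have us : u s = s \/ u s = - s.
  have /eqP : (u s) ^+ 2 = s ^+ 2 by rewrite -rmorphXn s2 /= rmorph_int.
  by rewrite eqf_sqr => /orP[] /eqP; [left | right].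
have [p2|op] := even_prime pp.
  rewrite p2 in pD pp hu *.
  have Dodd : odd `|D| by move: pD; rewrite dvdzE dvdn2 negbK.
  have [eta etaZ seta] := sodd Dodd; have etaA := Zz_Aint Da0 etaZ.
  have [z zA hz] := frobenius pp Da0 hu etaZ.
  have /dvdzP[c hc] : (4 %| D - 1)%Z by apply: (sqrt_mod4 etaA); rewrite -seta.
  have eta2 : eta ^+ 2 = c%:~R - eta.
    have h4 : (4 : algC) != 0 by rewrite pnatr_eq0.
    apply: (mulfI h4); have : (1 + 2 * eta) ^+ 2 = 1 + 4 * c%:~R.
      by rewrite -seta s2 (_ : D = c * 4 + 1) ?rmorphD ?rmorphM //=; [ring | lia].
    by move=> h; transitivity ((1 + 2 * eta) ^+ 2 - 1 - 4 * eta); [ring | rewrite h; ring].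
  rewrite /kronecker_prime eqxx (negPf pD).
  case: us => us; rewrite us; move: us; rewrite seta rmorphD rmorphM rmorph1 rmorph_nat /= hz eta2 => us.
    have c2 : (2 %| c)%Z.
      apply: (@Aint_div_dvd _ _ (eta - z)); first by rewrite rpredB.
      have h2 : (2 : algC) != 0 by rewrite pnatr_eq0.
      apply: (mulfI h2); apply/eqP; rewrite -subr_eq0; apply/eqP.
      transitivity (1 + 2 * (c%:~R - eta + 2 * z) - (1 + 2 * eta)); [ring | by rewrite us subrr].
    by rewrite ifT ?mul1r //; apply/orP; left; apply/eqP; lia.
  have c2 : (2 %| c + 1)%Z.
    apply: (@Aint_div_dvd _ _ (- z)); first by rewrite rpredN.
    have h2 : (2 : algC) != 0 by rewrite pnatr_eq0.
    rewrite rmorphD rmorph1 /=; apply: (mulfI h2); apply/eqP; rewrite -subr_eq0; apply/eqP.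
    transitivity (1 + 2 * (c%:~R - eta + 2 * z) - - (1 + 2 * eta)); [ring | by rewrite us subrr].
  by rewrite ifF ?rmorphN ?mulN1r //; apply/negP => /orP[] /eqP; lia.
have hp := prime_gt1 pp; have [z zA hz] := frobenius pp Da0 hu sZ.
have /dvdzP[k hk] := euler_criterion pp op pD.
set kr := kronecker_prime D p in hk *.
have sp : s ^+ p = (D ^+ p./2)%:~R * s.
  rewrite -[in LHS](odd_double_half p) op add1n exprS -mul2n exprM s2 rmorphXn /=; ring.
have hus : u s = kr%:~R * s + p%:R * (k%:~R * s + z).
  rewrite hz sp (_ : D ^+ p./2 = kr + k * p) ?rmorphD ?rmorphM /=; last by rewrite -hk; ring.
  by rewrite -pmulrn; ring.
have yA : k%:~R * s + z \in Aint by rewrite rpredD ?rpredM ?Aint_int.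
have krE : kr = 1 \/ kr = -1.
  rewrite /kr /kronecker_prime (negPf pD) ifF; last by apply: contraTF op => /eqP ->.
  by case: ifP; [left | right].
(* The wrong sign would make 2 s divisible by p; multiplying by s, p would divide 2 D. *)
have bad (e : int) : `|e|%N = 2%N -> e%:~R * s = p%:R * (k%:~R * s + z) -> False.
  move=> e2 he; have : (p %| e * D)%Z.
    apply: (@Aint_div_dvd _ _ ((k%:~R * s + z) * s)); first by rewrite rpredM.
    transitivity (e%:~R * s * s); first by rewrite rmorphM /= -s2; ring.
    by rewrite he -pmulrn; ring.
  rewrite dvdzE abszM Euclid_dvdM // e2 => /orP[/(@dvdn_leq _ 2 isT) p2|]; last by rewrite -dvdzE (negPf pD).
  by move: op; rewrite (_ : p = 2%N) //; apply/eqP; rewrite eqn_leq p2.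
case: krE us hus => -> [] -> //; rewrite ?rmorphN ?rmorph1 ?mul1r ?mulN1r // => h; exfalso.
  by apply: (bad (-2)); rewrite // -[RHS](addKr s) -h rmorphN /=; ring.
by apply: (bad 2); rewrite // -[RHS](addKr (- s)) -h; ring.
Qed.

Lemma kronecker_mul D p n : prime p -> (0 < n)%N ->
  kronecker D (p * n) = kronecker_prime D p * kronecker D n.
Proof.
move=> pp n0; have p0 := prime_gt0 pp; have pn0 : (0 < p * n)%N by rewrite muln_gt0 p0.
have ext m : (0 < m)%N -> (m %| p * n)%N ->
  kronecker D m = \prod_(q <- primes (p * n)) kronecker_prime D q ^+ logn q m.
  move=> m0 mpn; rewrite /kronecker.
  have hperm : perm_eq (primes m) [seq q <- primes (p * n) | q \in primes m].
    apply: uniq_perm; rewrite ?filter_uniq ?primes_uniq // => q.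
    rewrite mem_filter andb_idr // !mem_primes pn0 m0 => /and3P[-> _ /dvdn_trans]; exact.
  rewrite (perm_big _ hperm) big_filter big_mkcond; apply: eq_bigr => q _.
  case: ifPn => // qm; rewrite (_ : logn q m = 0%N) ?expr0 //.
  by apply/eqP; rewrite -leqn0 leqNgt logn_gt0.
rewrite (ext n) ?dvdn_mull // (ext (p * n)%N) //.
have ppn : p \in primes (p * n) by rewrite mem_primes pp pn0 dvdn_mulr.
rewrite !(bigD1_seq p) ?primes_uniq //= mulrA -exprS; congr (_ * _).
  by rewrite lognM // (pfactorK 1 pp).
by apply: eq_bigr => q qp; rewrite lognM // (logn_prime _ pp) (negPf qp).
Qed.

(** Induction on a: for a = p b, u acts on zeta_|D| as the composite of the automorphisms with
    exponents p and b. *)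
Lemma kronecker_sqrt a D s (u : {rmorphism algC -> algC}) :
    (0 < a)%N -> coprime a `|D|%N -> D != 0 -> Zz `|D|%N s -> s ^+ 2 = D%:~R ->
    (odd `|D|%N -> exists2 eta, Zz `|D|%N eta & s = 1 + 2 * eta) ->
    u (zeta `|D|%N) = zeta `|D|%N ^+ a ->
  u s = (kronecker D a)%:~R * s.
Proof.
move=> a0 ca D0 sZ s2 sodd.
have [n hn] := ubnP a; elim: n => // n IH in a u hn a0 ca *.
have [a1|a1] := eqVneq a 1%N.
  rewrite a1 expr1 => /Qz_aut_id h; rewrite (h _ (Zz_Qz sZ)) /kronecker big_nil; ring.
have a_gt1 : (1 < a)%N by lia.
have pp := pdiv_prime a_gt1; have /dvdnP[b hab] := pdiv_dvd a.
set p := pdiv a in pp hab; rewrite mulnC in hab.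
move: ca; rewrite hab coprimeMl => /andP[cp cb].
have b0 : (0 < b)%N by move: a0; rewrite hab muln_gt0 => /andP[].
have [u1 h1] := aut_zeta cp; have [u2 h2] := aut_zeta cb.
move=> hu; have : u s = (u1 \o u2) s.
  by apply: Qz_aut (Zz_Qz sZ); rewrite hu /= h2 rmorphXn /= h1 exprM.
move=> -> /=; rewrite (IH b) //; last by have := prime_gt1 pp; nia.
rewrite rmorphM rmorph_int /= (kronecker_prime_sqrt pp _ D0 sZ s2 sodd h1); last first.
  by rewrite dvdzE -prime_coprime.
by rewrite kronecker_mul // rmorphM /=; ring.
Qed.

(** * Discriminants of quadratic fields *)

Lemma nat_sqfree_part n : (0 < n)%N -> exists c k, [/\ sqfree c, (0 < k)%N & n = (c * k ^ 2)%N].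
Proof.
have [m hm] := ubnP n; elim: m => // m IH in n hm * => n0.
have [[p [pp /dvdnP[n' hn']]]|nsq] := EM (exists p, prime p /\ (p ^ 2 %| n)%N).
  have p1 := prime_gt1 pp; have n'0 : (0 < n')%N by move: n0; rewrite hn' muln_gt0 => /andP[].
  have [||c [k [sc k0 hk]]] := IH n' => //.
    have : (n' * 1 < n' * p ^ 2)%N by rewrite ltn_pmul2l // -(exp1n 2) ltn_exp2r.
    by move: hm; rewrite hn'; lia.
  exists c, (k * p)%N; split=> //; first by rewrite muln_gt0 k0 prime_gt0.
  by rewrite hn' hk; ring.
exists n, 1%N; split=> //; last by rewrite muln1.
by split=> // p pp; apply/negP => h; apply: nsq; exists p.
Qed.

Lemma rat_sqfree_part (g : rat) : g != 0 ->
  exists d : int, exists t : rat, [/\ sqfree `|d|, t != 0 & g = d%:~R * t ^+ 2].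
Proof.
(* g = N / (denq g)^2, so the squarefree part of the integer N, with its sign, serves for g. *)
move=> g0; pose N := numq g * denq g.
have N0 : (0 < `|N|)%N by rewrite absz_gt0 mulf_neq0 ?numq_eq0 ?denq_eq0.
have [c [k [sc k0 hk]]] := nat_sqfree_part N0.
have dg0 : (denq g)%:~R != 0 :> rat by rewrite intr_eq0 denq_eq0.
exists ((-1) ^+ (N < 0)%R * c%:Z), (k%:R / (denq g)%:~R); split.
- by rewrite abszMsign.
- by rewrite mulf_neq0 ?invr_eq0 // pnatr_eq0 -lt0n.
have hN : N%:~R = ((-1) ^+ (N < 0)%R * c%:Z)%:~R * k%:R ^+ 2 :> rat.
  have -> : N%:~R = ((-1) ^+ (N < 0)%R * c%:Z * k%:Z ^+ 2)%:~R :> rat.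
    by congr (_%:~R); rewrite [LHS]intEsign hk -mulnn !PoszM expr2 -!mulrA.
  by rewrite rmorphM rmorphXn.
rewrite expr_div_n mulrA -hN rmorphM /= expr2 invfM mulrA mulfK // -[LHS]divq_num_den //.
Qed.

Lemma div4_exact (d : int) : (d %% 4)%Z = 1 -> ((1 - d) %/ 4)%Z * 4 = 1 - d.
Proof. lia. Qed.

Lemma sqr_mod4 (z : int) : exists k, z ^+ 2 = 4 * k + (z %% 2)%Z.
Proof.
have [[k ->]|[k ->]] : (exists k, z = 2 * k) \/ (exists k, z = 2 * k + 1).
  have [h|h] : (z %% 2)%Z = 0 \/ (z %% 2)%Z = 1 by lia.
    by left; exists (z %/ 2)%Z; lia.
  by right; exists (z %/ 2)%Z; lia.
- by exists (k ^+ 2); rewrite (_ : ((2 * k) %% 2)%Z = 0); [ring | lia].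
- by exists (k ^+ 2 + k); rewrite (_ : ((2 * k + 1) %% 2)%Z = 1); [ring | lia].
Qed.

(** For (a + b sqrt d) / 2 the divisibility says that the norm is an integer. It lets a and b be
    both odd when d = 1 mod 4, and forces both to be even when d = 2 or 3 mod 4, which is the next
    lemma but one of integrality below. *)
Lemma half_int_1 (a b d : int) : (d %% 4)%Z = 1 -> (4 %| a ^+ 2 - d * b ^+ 2)%Z ->
  exists x, a = b + 2 * x.
Proof.
move=> d1; have [A ->] := sqr_mod4 a; have [B ->] := sqr_mod4 b.
have [k ->] : exists k, d = 4 * k + 1 by exists (d %/ 4)%Z; lia.
set w := 4 * B + _; rewrite (_ : (4 * k + 1) * w = 4 * (k * w) + w); last by ring.
rewrite /w; move: (k * _) => z h.
by exists ((a - b) %/ 2)%Z; lia.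
Qed.

Lemma half_int_23 (a b d : int) : (d %% 4)%Z != 1 -> (d %% 4)%Z != 0 ->
    (4 %| a ^+ 2 - d * b ^+ 2)%Z ->
  exists2 a', a = 2 * a' & exists b', b = 2 * b'.
Proof.
move=> d1 d0; have [A ->] := sqr_mod4 a; have [B ->] := sqr_mod4 b.
rewrite mulrDr mulrCA; move: (d * B) => z h.
have hb : (b %% 2)%Z = 0.
  have [//|hb] : (b %% 2)%Z = 0 \/ (b %% 2)%Z = 1 by clear; lia.
  by move: h; rewrite hb mulr1; lia.
move: h; rewrite hb mulr0 addr0 => h.
by exists (a %/ 2)%Z; [lia | exists (b %/ 2)%Z; lia].
Qed.

Lemma int_mul_eq1_sqr (m n : int) : m * n = 1 -> m ^+ 2 = 1.
Proof.
move/(congr1 absz); rewrite abszM => /eqP; rewrite muln_eq1 => /andP[/eqP h _].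
by rewrite [m]intEsign h mulr1 sqrr_sign.
Qed.

Lemma det_mx2 (R : comPzRingType) (A : 'M[R]_2) :
  \det A = A 0 0 * A 1 1 - A 0 1 * A 1 0.
Proof.
rewrite (expand_det_row A 0) !big_ord_recl big_ord0 addr0 /cofactor !det_mx11 !mxE /=.
rewrite ?addn0 ?add0n expr0 expr1 mul1r mulN1r mulrN.
by congr (A _ _ * A _ _ - A _ _ * A _ _); apply: val_inj.
Qed.

Section Quadratic.
Variables (K : fieldExtType rat) (iota : {rmorphism K -> algC}) (s : K) (d : int).
Hypothesis d_sqfree : sqfree `|d|.
Hypothesis s2 : s ^+ 2 = d%:~R.
Hypothesis s_gen : <<1; s>>%VS = {: K}%VS.
Hypothesis d_nonsquare : ~ exists r : rat, d%:~R = r ^+ 2.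

Definition quad_elt (u v : rat) : K := u%:A + v *: s.
Local Notation el := quad_elt.

Let intA (c : int) : (c%:~R : K) = (c%:~R : rat)%:A.
Proof. by rewrite alg_num_field ratr_int. Qed.

Let el_s : el 0 1 = s. Proof. by rewrite /el scale0r add0r scale1r. Qed.

Let elM u v u' v' : el u v * el u' v' = el (u * u' + v * v' * d%:~R) (u * v' + v * u').
Proof.
rewrite /el !mulrDl !mulrDr -!scalerAl -!scalerAr !mul1r mulr1 -expr2 s2 intA !scalerA.
by rewrite !scalerDl -!addrA; congr (_ + _); rewrite [RHS]addrC -addrA.
Qed.

Let elD u v u' v' : el u v + el u' v' = el (u + u') (v + v').
Proof. by rewrite /el !scalerDl addrACA. Qed.

Let quad_exists x : exists u v, x = el u v.
Proof.
have : x \in <<1; s>>%VS by rewrite s_gen memvf.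
case/Fadjoin1_polyP => p ->; elim/poly_ind: p => [|p c [u [v IH]]].
  by exists 0, 0; rewrite /el rmorph0 horner0 !scale0r addr0.
exists (v * d%:~R + c), u.
rewrite rmorphD rmorphM /= map_polyX map_polyC /= !hornerE IH -[X in _ * X]el_s elM.
have -> : c%:A = el c 0 by rewrite /el scale0r addr0.
by rewrite elD; congr el; ring.
Qed.

Let el_eq0 u v : el u v = 0 -> u = 0 /\ v = 0.
Proof.
move=> h; have [v0|v0] := eqVneq v 0.
  move: h; rewrite /el v0 scale0r addr0 => /eqP; rewrite scaler_eq0 oner_eq0 orbF => /eqP.
  by [].
exfalso; apply: d_nonsquare; exists (- u / v).
have hs : s = (- u / v)%:A.
  apply: (scalerI v0); rewrite scalerA mulrC divfK // scaleNr.
  by apply/eqP; rewrite -addr_eq0 addrC; apply/eqP.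
have : (in_alg K) d%:~R = in_alg K ((- u / v) ^+ 2) by rewrite rmorphXn /= -hs s2 intA.
exact: fmorph_inj.
Qed.

Let el_inj u v u' v' : el u v = el u' v' -> u = u' /\ v = v'.
Proof.
move=> h; have [] := @el_eq0 (u - u') (v - v').
  by apply/eqP; rewrite /el !scalerBl addrACA -opprD subr_eq0; apply/eqP.
by move=> /eqP hu /eqP hv; split; apply/eqP; rewrite -subr_eq0.
Qed.

Let dim2 : \dim {: K} = 2%N.
Proof.
pose X := [tuple 1; s].
have : basis_of {: K} X.
  rewrite /basis_of; apply/andP; split.
    rewrite eqEsubv subvf /=; apply/subvP => x _.
    have [u [v ->]] := quad_exists x.
    by rewrite rpredD // rpredZ // memv_span // !inE eqxx ?orbT.
  apply/freeP => k; rewrite !big_ord_recl big_ord0 addr0 /= => h i.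
  have [k0 k1] := el_eq0 h.
  by case: i => [[|[|//]]] hi /=; [rewrite -k0|rewrite -k1]; congr k; apply: val_inj.
by move/size_basis.
Qed.

(** The size k is a variable because \dim occurs in the type of the basis and has to be replaced by
    2. The trace of s is p + t. As s^2 is a scalar, q (p + t) = 0; were p + t nonzero, q = 0 would
    make b_0 an eigenvector and s the rational number p. *)
Let trace_mulE k (b : k.-tuple K) u v : k = 2%N -> basis_of {: K} b ->
  \sum_(i < k) coord b i (el u v * b`_i) = 2 * u.
Proof.
move=> k2; subst k => hb; have fb := basis_free hb.
have l0 : ord0 = 0 :> 'I_2 by apply: val_inj.
have l1 : lift ord0 ord0 = 1 :> 'I_2 by apply: val_inj.
have mb x : x = coord b 0 x *: b`_0 + coord b 1 x *: b`_1.
  by rewrite [LHS](coord_basis hb (memvf x)) !big_ord_recl big_ord0 addr0 l1 l0.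
pose p := coord b 0 (s * b`_0); pose q := coord b 1 (s * b`_0).
pose r := coord b 0 (s * b`_1); pose t := coord b 1 (s * b`_1).
have sb0 : s * b`_0 = p *: b`_0 + q *: b`_1 by exact: mb.
have sb1 : s * b`_1 = r *: b`_0 + t *: b`_1 by exact: mb.
have c00 : coord b 0 b`_0 = 1 by have := coord_free 0 0 fb; rewrite eqxx.
have c11 : coord b 1 b`_1 = 1 by have := coord_free 1 1 fb; rewrite eqxx.
have c01 : coord b 0 b`_1 = 0 by rewrite (coord_free 1 0 fb).
have c10 : coord b 1 b`_0 = 0 by rewrite (coord_free 0 1 fb).
have b0 : b`_0 != 0 by apply: contra_eq_neq c00 => ->; rewrite linear0 eq_sym oner_eq0.
have q0 : q * (p + t) = 0.
  have : coord b 1 (s * (s * b`_0)) = 0.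
    by rewrite mulrA -expr2 s2 intA -scalerAl mul1r linearZ /= c10 mulr0.
  rewrite sb0 mulrDr -!scalerAr sb0 sb1 !scalerDr !scalerA !linearD /= !linearZ /= c10 c11 => <-.
  ring.
have pt : p + t = 0.
  apply/eqP; apply: contraT => pt; move/eqP: q0; rewrite mulf_eq0 (negPf pt) orbF => /eqP q0.
  have : s = el p 0.
    by apply: (mulIf b0); rewrite sb0 q0 scale0r addr0 /el scale0r addr0 -scalerAl mul1r.
  by rewrite -el_s => /el_inj[_ /eqP]; rewrite oner_eq0.
rewrite !big_ord_recl big_ord0 addr0 l1 l0.
rewrite /el !mulrDl -!scalerAl !mul1r !linearD /= !linearZ /=.
rewrite c00 c11 -/p -/t.
transitivity (u + u + v * (p + t)); [ring | by rewrite pt mulr0 addr0].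
Qed.

Let traceE u v : field_trace (el u v) = 2 * u.
Proof. exact: trace_mulE dim2 (vbasisP _). Qed.

Let d0 : d != 0.
Proof. by rewrite -absz_gt0; case: d_sqfree. Qed.

(** The trace 2u and the norm u^2 - d v^2 are rational algebraic integers. The conjugate is taken by
    an automorphism tau of [algC] negating the image of s; it exists since that image lies in a
    cyclotomic field and is irrational. *)
Let Aint_el u v : integralOver (intr : int -> K) (el u v) ->
  exists a b : int, [/\ 2 * u = a%:~R, 2 * v = b%:~R & (4 %| a ^+ 2 - d * b ^+ 2)%Z].
Proof.
case=> P Pm Px; pose x := iota (el u v).
have xA : x \in Aint.
  apply: (@root_monic_Aint (map_poly intr P)); last 2 first.
  - exact: monic_map.
  - by apply/polyOverP => i; rewrite coef_map /= intr_int.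
  rewrite /root -(_ : map_poly iota (map_poly intr P) = map_poly intr P).
    by rewrite horner_map /= (rootP Px) rmorph0.
  by rewrite -map_poly_comp; apply: eq_map_poly => c /=; rewrite rmorph_int.
pose S := iota s; have S2 : S ^+ 2 = d%:~R by rewrite -rmorphXn s2 /= rmorph_int.
have xE : x = ratr u + ratr v * S.
  rewrite /x /el rmorphD /= -[v *: s]mulr_algl rmorphM /= !alg_num_field.
  by rewrite !fmorph_rat.
have fd : fund_disc d \/ fund_disc (4 * d).
  have [h|h] := eqVneq (d %% 4)%Z 1; first by left; exists d; split=> //; left.
  by right; exists d; split=> //; right; split=> //; apply/eqP.
have [m m0 SQ] : exists2 m, (0 < m)%N & Qz m S.
  have [D [fD [c c0 hc]]] : exists D, fund_disc D /\ exists2 c : int, c != 0 & D = c ^+ 2 * d.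
    by case: fd => h; [exists d; split=> //; exists 1; rewrite ?mul1r
                      |exists (4 * d); split=> //; exists 2].
  have [s' [s'Z s'2 _]] := fund_disc_sqrt fD.
  exists `|D|%N; first exact: fund_disc_gt0.
  have cC : (c%:~R : algC) != 0 by rewrite intr_eq0.
  have /eqP : (s' / c%:~R) ^+ 2 = S ^+ 2.
    by rewrite expr_div_n s'2 hc S2 rmorphM rmorphXn /= mulrC mulKf // expf_neq0.
  have h e : Qz `|D|%N (ratr e * s') by apply: QzM (Zz_Qz s'Z); apply: Qz_rat.
  rewrite eqf_sqr => /orP[] /eqP hS.
    by rewrite -hS mulrC -(ratr_int _ c) -fmorphV; apply: h.
  rewrite -[S]opprK -hS mulrC -mulNr -(ratr_int _ c) -fmorphV -rmorphN; exact: h.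
have [tau tauS] : exists tau : {rmorphism algC -> algC}, tau S = - S.
  apply: contrapT => hn; apply: d_nonsquare.
  have [r hr] : exists r, S = ratr r.
    apply: (Qz_fixed_rat m0 SQ) => tau; have /eqP : (tau S) ^+ 2 = S ^+ 2.
      by rewrite -rmorphXn S2 /= rmorph_int.
    by rewrite eqf_sqr => /orP[/eqP //|/eqP h]; exfalso; apply: hn; exists tau.
  exists r; apply: (fmorph_inj (ratr : {rmorphism rat -> algC})).
  by rewrite /= ratr_int -S2 hr rmorphXn.
have x'A : tau x \in Aint by rewrite Aint_aut.
have x'E : tau x = ratr u - ratr v * S.
  transitivity (tau (ratr u) + tau (ratr v) * tau S); last by rewrite tauS !fmorph_rat mulrN.
  rewrite xE rmorphD; congr (_ + _); exact: rmorphM.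
have [a ha] : exists a : int, 2 * u = a%:~R.
  apply: Aint_rat_int; rewrite (_ : ratr _ = x + tau x) ?rpredD //.
  by rewrite x'E xE rmorphM /= ratr_nat; ring.
have [n hn] : exists n : int, u ^+ 2 - d%:~R * v ^+ 2 = n%:~R.
  apply: Aint_rat_int; rewrite (_ : ratr _ = x * tau x) ?rpredM //.
  by rewrite x'E xE rmorphB rmorphM !rmorphXn /= ratr_int -S2; ring.
have hdv : d%:~R * (2 * v) ^+ 2 = (a ^+ 2 - 4 * n)%:~R :> rat.
  by rewrite rmorphB rmorphXn rmorphM /= -ha -hn; ring.
(* d (2v)^2 is an integer, so the squared denominator of 2v divides the squarefree d. *)
have [b hb] : exists b : int, 2 * v = b%:~R.
  set w := 2 * v in hdv *; have wE := divq_num_den w.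
  have dw : (denq w)%:~R != 0 :> rat by rewrite intr_eq0 denq_eq0.
  have hw : d * numq w ^+ 2 = (a ^+ 2 - 4 * n) * denq w ^+ 2.
    have nE : (numq w)%:~R = w * (denq w)%:~R :> rat by rewrite -[X in _ = X * _]wE divfK.
    apply/eqP; rewrite -(eqr_int rat) [X in X == _]rmorphM [X in _ == X]rmorphM /= -hdv.
    by rewrite !rmorphXn /= nE exprMn mulrA.
  have dv2 : (`|denq w| ^ 2 %| `|d|)%N.
    have : (`|denq w| ^ 2 %| `|d| * `|numq w| ^ 2)%N.
      by rewrite -!abszX -abszM hw abszM dvdn_mull.
    by rewrite Gauss_dvdl // coprimeXl // coprimeXr // coprime_sym coprime_num_den.
  have dw1 : `|denq w|%N = 1%N.
    apply/eqP; rewrite eqn_leq absz_gt0 denq_eq0 andbT leqNgt; apply/negP => h1.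
    have pp := pdiv_prime h1.
    have [_ /(_ _ pp)/negP] := d_sqfree; apply; apply: dvdn_trans dv2.
    by rewrite dvdn_exp2r // pdiv_dvd.
  exists (numq w); rewrite -[LHS]wE (_ : denq w = 1) ?divr1 //.
  by rewrite -(gtz0_abs (denq_gt0 w)) dw1.
exists a, b; split=> //; apply/dvdzP; exists n; apply/eqP.
have e1 : (a ^+ 2 - d * b ^+ 2)%:~R = a%:~R ^+ 2 - d%:~R * b%:~R ^+ 2 :> rat.
  by rewrite rmorphB rmorphXn rmorphM rmorphXn.
have e2 : (a ^+ 2 - 4 * n)%:~R = a%:~R ^+ 2 - 4 * n%:~R :> rat.
  by rewrite rmorphB rmorphXn rmorphM.
have e3 : (n * 4)%:~R = n%:~R * 4 :> rat by rewrite rmorphM.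
by rewrite -(eqr_int rat) e1 e3 -hb hdv e2; apply/eqP; ring.
Qed.

Let int_el u v : (exists2 P : {poly int}, P \is monic & root (map_poly intr P) (el u v)) ->
  integralOver (intr : int -> K) (el u v).
Proof. by case=> P; exists P. Qed.

(* omega = al + be sqrt d generates the ring of integers. *)
Let omega : exists al be : rat, exists D : int,
  [/\ fund_disc D, D%:~R = 4 * d%:~R * be ^+ 2, integralOver (intr : int -> K) (el al be),
      exists2 c : int, c != 0 & c ^+ 2 * d = D &
      forall u v, integralOver (intr : int -> K) (el u v) ->
        exists x y : int, u = x%:~R + y%:~R * al /\ v = y%:~R * be].
Proof.
have [d1|d1] := eqVneq (d %% 4)%Z 1.
  exists 2^-1, 2^-1, d; split.
  - by exists d; split=> //; left.
  - by field.
  - apply: int_el; exists ('X^2 - 'X + ((1 - d) %/ 4)%Z%:P).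
      rewrite monicE lead_coefE -[X in _ == X](_ : 'X^2`_2 = 1 :> int); last by rewrite coefXn.
      rewrite (_ : size _ = 3%N) /=; last first.
        rewrite -addrA size_polyDl ?size_polyXn //.
        apply: (leq_ltn_trans (size_polyD _ _)); rewrite size_polyN size_polyX gtn_max /=.
        by apply: (leq_ltn_trans (size_polyC_leq1 _)).
      by rewrite !coefE.
    rewrite /root rmorphD rmorphB rmorphXn /= map_polyX map_polyC /= !hornerE /= intA.
    rewrite expr2 elM.
    have -> : - el 2^-1 2^-1 = el (- 2^-1) (- 2^-1) by rewrite /el !scaleNr opprD.
    have hA (c : rat) : c%:A = el c 0 by rewrite /el scale0r addr0.
    have h4 : (((1 - d) %/ 4)%Z)%:~R = (1 - d%:~R) / 4 :> rat.
      apply: (mulIf (_ : 4 != 0 :> rat)) => //; rewrite divfK // -[4 : rat]/((4 : int)%:~R).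
      by rewrite -rmorphM /= div4_exact // rmorphB.
    rewrite hA !elD h4 [X in el X _](_ : _ = 0); last by field.
    rewrite [X in el _ X](_ : _ = 0); last by field.
    by rewrite /el !scale0r addr0.
  - by exists 1; rewrite ?mul1r.
  move=> u v /Aint_el[a [b [ha hb h4]]].
  have [x hx] := half_int_1 d1 h4.
  exists x, b; split; last by apply: (mulfI (_ : 2 != 0 :> rat)) => //; rewrite hb; field.
  by apply: (mulfI (_ : 2 != 0 :> rat)) => //; rewrite ha hx rmorphD rmorphM /=; field.
exists 0, 1, (4 * d); split.
- by exists d; split=> //; right; split=> //; apply/eqP.
- by rewrite rmorphM /=; ring.
- apply: int_el; exists ('X^2 - d%:P); first exact: monicXnsubC.
  rewrite /root rmorphB rmorphXn /= map_polyX map_polyC /= !hornerE /= el_s -?expr2 s2.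
  by rewrite subrr.
- by exists 2.
move=> u v /Aint_el[a [b [ha hb h4]]].
have d4 : (d %% 4)%Z != 0.
  apply/eqP => /dvdz_mod0P; rewrite dvdzE => h.
  by case: d_sqfree => _ /(_ 2%N isT)/negP; apply.
have [a' ha' [b' hb']] := half_int_23 d1 d4 h4.
exists a', b'; split; apply: (mulfI (_ : 2 != 0 :> rat)) => //.
  by rewrite ha ha' rmorphM mulr0 addr0.
by rewrite hb hb' rmorphM mulr1.
Qed.

(** The family w and (1, omega) express each other with integer coefficients. The transition
    determinant M is thus a unit, and its square, by which the trace determinants differ, is 1. *)
Let disc_core k (w : k.-tuple K) (D : int) : k = 2%N ->
  (forall x : K, integralOver (intr : int -> K) x <->
    exists c : 'I_k -> int, x = \sum_(i < k) w`_i *~ c i) ->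
  D%:~R = \det (\matrix_(i < k, j < k) field_trace (w`_i * w`_j)) ->
  fund_disc D /\ exists2 c : int, c != 0 & c ^+ 2 * d = D.
Proof.
move=> k2; subst k => hw hD.
have [al [be [D' [fD' D'E oint hc hxy]]]] := omega.
suff -> : D = D' by [].
have winth (i : 'I_2) : integralOver (intr : int -> K) w`_i.
  apply/hw; exists (fun j => (j == i)%:Z); rewrite (bigD1 i) //= eqxx big1 ?addr0 //.
  by move=> j /negPf ->.
have [u0 [v0 w0]] := quad_exists w`_0; have [u1 [v1 w1]] := quad_exists w`_1.
have [x0 [y0 [hu0 hv0]]] : exists x y : int, u0 = x%:~R + y%:~R * al /\ v0 = y%:~R * be.
  by apply: hxy; rewrite -w0; apply: (winth 0).
have [x1 [y1 [hu1 hv1]]] : exists x y : int, u1 = x%:~R + y%:~R * al /\ v1 = y%:~R * be.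
  by apply: hxy; rewrite -w1; apply: (winth 1).
have be0 : be != 0.
  apply/eqP => be0; move: D'E; rewrite be0 expr0n mulr0 => /eqP; rewrite intr_eq0 => /eqP D0.
  by have := fund_disc_gt0 fD'; rewrite D0.
have comb u v : integralOver (intr : int -> K) (el u v) ->
    exists c0 c1 : int, u = u0 * c0%:~R + u1 * c1%:~R /\ v = v0 * c0%:~R + v1 * c1%:~R.
  move/hw => [c hcc]; exists (c 0), (c 1); apply: el_inj; rewrite hcc !big_ord_recl big_ord0 addr0.
  have -> : lift ord0 ord0 = 1 :> 'I_2 by apply: val_inj.
  have l0 : ord0 = 0 :> 'I_2 by apply: val_inj.
  have elZ u' v' (e : int) : el u' v' *~ e = el (u' * e%:~R) (v' * e%:~R).
    by rewrite -scaler_int /el scalerDr !scalerA ![e%:~R * _]mulrC.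
  by rewrite l0 w0 w1 !elZ elD.
have [c0 [c1 [hc0 hc1]]] : exists c0 c1 : int, 1 = u0 * c0%:~R + u1 * c1%:~R /\ 0 = v0 * c0%:~R + v1 * c1%:~R.
  apply: comb; apply: int_el; exists ('X - 1%:P); first exact: monicXsubC.
  by rewrite /root rmorphB /= map_polyX map_polyC /= !hornerE /el scale1r scale0r addr0 subrr.
have [e0 [e1 [he0 he1]]] := comb _ _ oint.
pose M := x0 * y1 - x1 * y0.
have hM : M * (c0 * e1 - c1 * e0) = 1.
  apply/eqP; rewrite -(eqr_int rat); apply/eqP; apply: (mulfI be0).
  rewrite rmorph1 mulr1.
  transitivity ((u0 * c0%:~R + u1 * c1%:~R) * (v0 * e0%:~R + v1 * e1%:~R) -
                (u0 * e0%:~R + u1 * e1%:~R) * (v0 * c0%:~R + v1 * c1%:~R)).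
    by rewrite hu0 hu1 hv0 hv1 /M !(rmorphM, rmorphB) /=; ring.
  by rewrite -hc0 -hc1 -he0 -he1; ring.
have hM2 := int_mul_eq1_sqr hM.
apply/eqP; rewrite -(eqr_int rat) hD D'E det_mx2 !mxE /= w0 w1 !elM !traceE.
apply/eqP; transitivity (4 * d%:~R * be ^+ 2 * (M ^+ 2)%:~R); last by rewrite hM2 mulr1.
rewrite hu0 hu1 hv0 hv1 /M rmorphXn rmorphB !rmorphM /=; ring.
Qed.

Lemma quadratic_disc D : is_discriminant K D ->
  fund_disc D /\ exists2 c : int, c != 0 & c ^+ 2 * d = D.
Proof. by case=> w [[_ hw] hD]; apply: (disc_core dim2 hw hD). Qed.
End Quadratic.

(** The only two facts about the discriminant that the sequel uses. *)
Lemma rat_root_disc (g : rat) (D : int) : g != 0 -> (~ exists r : rat, g = r ^+ 2) ->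
  is_discriminant (Qadj [:: rat_root g 2]) D ->
  fund_disc D /\ exists2 t : rat, t != 0 & g = D%:~R * t ^+ 2.
Proof.
move=> g0 gns; set K := Qadj _ => hD.
have [d [t [sd t0 gE]]] := rat_sqfree_part g0.
have [s0 [s0E s0gen]] : exists s0 : K, Qadj_inj _ s0 = rat_root g 2 /\ <<1; s0>>%VS = {: K}%VS.
  rewrite /K; have := map_Qadj_gens [:: rat_root g 2]; have := Qadj_gensP [:: rat_root g 2].
  by case: (Qadj_gens _) => // z [|//]; rewrite adjoin_seq1 => hz /= [h]; exists z.
have s02 : s0 ^+ 2 = g%:A.
  apply: (fmorph_inj (Qadj_inj [:: rat_root g 2])).
  by rewrite rmorphXn /= s0E alg_num_field fmorph_rat /rat_root rootCK.
pose s := t^-1 *: s0.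
have s2 : s ^+ 2 = d%:~R.
  rewrite /s exprZn s02 scalerA gE exprVn mulrC mulfK ?expf_neq0 //.
  by rewrite alg_num_field ratr_int.
have sgen : <<1; s>>%VS = {: K}%VS.
  apply/eqP; rewrite eqEsubv subvf /= -s0gen; apply/FadjoinP; split; first exact: sub1v.
  by rewrite -[s0](scalerKV t0) rpredZ // memv_adjoin.
have dns : ~ exists r : rat, d%:~R = r ^+ 2.
  by case=> r hr; apply: gns; exists (r * t); rewrite gE hr exprMn.
have [fD [c c0 cD]] := quadratic_disc (Qadj_inj _) sd s2 sgen dns hD.
split=> //; exists (t / c%:~R); first by rewrite mulf_neq0 ?invr_eq0 ?intr_eq0.
have cq : (c%:~R : rat) != 0 by rewrite intr_eq0.
by rewrite gE -cD rmorphM rmorphXn /=; field.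
Qed.

(** * Sums over squarefree integers *)

(* The squarefree positive integers all of whose prime factors are < N. *)
Fixpoint smooth (N : nat) : seq nat :=
  if N is N'.+1 then
    if prime N' then smooth N' ++ [seq (N' * n)%N | n <- smooth N'] else smooth N'
  else [:: 1%N].

Lemma ltS_mono p N : ((p < N)%N <= (p < N.+1)%N)%N.
Proof. by case: (ltnP p N) => // h; rewrite (leqW h). Qed.

Lemma smoothP N n : reflect ((0 < n)%N /\ forall p, (logn p n <= (p < N)%N)%N) (n \in smooth N).
Proof.
apply: (iffP idP).
  elim: N n => [|N IH] n /=.
    by rewrite inE => /eqP ->; split=> // p; rewrite logn1.
  case: ifP => pN; last first.
    by move=> /IH[n0 h]; split=> // p; apply: leq_trans (h p) (ltS_mono p N).
  rewrite mem_cat => /orP[/IH[n0 h]|/mapP[m /IH[m0 h] ->]].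
    by split=> // p; apply: leq_trans (h p) (ltS_mono p N).
  split=> [|p]; first by rewrite muln_gt0 prime_gt0.
  rewrite (lognM p (prime_gt0 pN) m0) (logn_prime p pN); have [->|_] := eqVneq p N.
    by have := h N; rewrite ltnn ltnSn leqn0 => /eqP ->.
  by apply: leq_trans (h p) (ltS_mono p N).
elim: N n => [|N IH] n [n0 h] /=.
  rewrite inE; apply: contraT => n1; have n_gt1 : (1 < n)%N by lia.
  by have := h (pdiv n); rewrite ltn0 leqn0 -[_ == 0%N]negbK -lt0n logn_gt0 pi_pdiv n_gt1.
have lt_neq p : p != N -> (p < N.+1)%N = (p < N)%N by rewrite ltnS leq_eqVlt => /negPf ->.
have [logN|logN] := eqVneq (logn N n) 0%N.
  have : n \in smooth N.
    apply: IH; split=> // p; have [->|pN] := eqVneq p N; first by rewrite logN.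
    by rewrite -lt_neq //.
  by case: ifP => // _; rewrite mem_cat => ->.
have := logN; rewrite -lt0n logn_gt0 mem_primes => /and3P[pN _ /dvdnP[m hm]].
rewrite pN mem_cat; apply/orP; right; apply/mapP; exists m; last by rewrite hm mulnC.
have m0 : (0 < m)%N by move: n0; rewrite hm muln_gt0 => /andP[].
apply: IH; split=> // p; have := h p.
rewrite hm (lognM p m0 (prime_gt0 pN)) (logn_prime p pN).
have [->|pN'] := eqVneq p N; last by rewrite addn0 lt_neq.
by rewrite ltnn ltnSn addn1.
Qed.

Lemma smooth_uniq N : uniq (smooth N).
Proof.
elim: N => //= N IH; case: ifP => // pN; rewrite cat_uniq IH map_inj_uniq ?IH ?andbT /=.
  apply/hasPn => _ /mapP[m /smoothP[m0 _] ->]; apply/negP => /smoothP[_ /(_ N)].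
  by rewrite ltnn (lognM N (prime_gt0 pN) m0) (logn_prime N pN) eqxx.
by move=> x y /eqP; rewrite eqn_pmul2l ?prime_gt0 // => /eqP.
Qed.

Arguments smooth : simpl never.

Lemma prod_primes_smooth (R : comPzRingType) (u w : nat -> R) N n : n \in smooth N ->
  \prod_(0 <= p < N | prime p) (if (p %| n)%N then w p else u p) =
  (\prod_(p <- primes n) w p) * \prod_(0 <= p < N | prime p && ~~ (p %| n)%N) u p.
Proof.
move=> /smoothP[n0 h]; rewrite (bigID (fun p => p %| n)%N) /=; congr (_ * _).
  rewrite (eq_bigr w); last by move=> p /andP[_ ->].
  rewrite -big_filter; apply: perm_big; apply: uniq_perm; rewrite ?filter_uniq ?primes_uniq ?iota_uniq //.
  move=> p; rewrite mem_filter mem_primes n0 /= mem_index_iota /= -andbA.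
  apply: andb_id2l => pp; apply: andb_idr => pn.
  have : (0 < logn p n)%N by rewrite logn_gt0 mem_primes pp n0.
  by have := h p; case: (p < N)%N => //; lia.
by apply: eq_bigr => p /andP[_ /negPf ->].
Qed.

(** The factor u at the primes not dividing n is left free: taking u = 0 at the primes dividing t
    will impose t | n. *)
Lemma sum_smooth (R : comPzRingType) (u w : nat -> R) N :
  \sum_(n <- smooth N) \prod_(0 <= p < N | prime p) (if (p %| n)%N then w p else u p) =
  \prod_(0 <= p < N | prime p) (u p + w p).
Proof.
elim: N => [|N IH]; first by rewrite big_seq1 !big_geq.
have rec (F : nat -> R) : \prod_(0 <= p < N.+1 | prime p) F p =
    (\prod_(0 <= p < N | prime p) F p) * (if prime N then F N else 1).
  by rewrite !(big_mkcond prime) /= big_nat_recr.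
rewrite rec /smooth -/smooth; case: ifP => pN; last first.
  by rewrite mulr1 -IH; apply: eq_bigr => n _; rewrite rec pN mulr1.
rewrite big_cat big_map /= -IH mulrDr !mulr_suml; congr (_ + _).
  rewrite big_seq [RHS]big_seq; apply: eq_bigr => n /smoothP[n0 h].
  rewrite rec pN ifF //; apply/negP => Nn; have := h N; rewrite ltnn leqn0 => /eqP.
  by move/eqP; rewrite eqn0Ngt logn_gt0 mem_primes pN n0 Nn.
apply: eq_bigr => n _; rewrite rec pN dvdn_mulr //; congr (_ * _).
rewrite big_nat_cond [RHS]big_nat_cond; apply: eq_bigr => p /andP[/andP[_ pltN] pp].
by rewrite Euclid_dvdM // dvdn_prime2 // (ltn_eqF pltN).
Qed.

(** The boolean test of [moebius], usable as a condition in sums. *)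
Definition squarefree (n : nat) : bool := (0 < n)%N && all (fun p => logn p n == 1%N) (primes n).

Lemma squarefreeP n : reflect ((0 < n)%N /\ forall p, (logn p n <= 1)%N) (squarefree n).
Proof.
apply: (iffP andP) => [[n0 /allP h]|[n0 h]]; split=> //.
  move=> p; case: (posnP (logn p n)) => [-> //|]; rewrite logn_gt0 => /h /eqP -> //.
by apply/allP => p; rewrite -logn_gt0 => hp; rewrite eqn_leq h.
Qed.

Lemma smooth_squarefree N n : n \in smooth N -> squarefree n.
Proof.
move=> /smoothP[n0 h]; apply/squarefreeP; split=> // p; apply: leq_trans (h p) _.
exact: leq_b1.
Qed.

Lemma squarefree_smooth N n : squarefree n -> (n < N)%N -> n \in smooth N.
Proof.
move=> /squarefreeP[n0 h] nN; apply/smoothP; split=> // p.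
case: ltnP => pN; first exact: h.
rewrite leqNgt logn_gt0 mem_primes; apply/negP => /and3P[_ _ /(dvdn_leq n0)].
by rewrite leqNgt (leq_trans nN pN).
Qed.

Lemma big_uniq_nat (R : nmodType) (s : seq nat) (F : nat -> R) m M : uniq s ->
    (forall n, n \in s -> (m <= n < M)%N) ->
  \sum_(n <- s) F n = \sum_(m <= n < M | n \in s) F n.
Proof.
move=> us hs; rewrite -[RHS]big_filter; apply: perm_big; apply: uniq_perm => //.
  by rewrite filter_uniq // iota_uniq.
move=> n; rewrite mem_filter andb_idr // mem_index_iota; exact: hs.
Qed.

Section EulerSum.
Variables (R : realType) (F A : nat -> R) (B : R).
Hypothesis F_le : forall n, squarefree n -> `|F n| <= A n.
Hypothesis F0 : forall n, ~~ squarefree n -> F n = 0.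
Hypothesis A_bound : forall N, \sum_(n <- smooth N) A n <= B.

Let G n : R := if squarefree n then A n else 0.
Let A_ge0 n : squarefree n -> 0 <= A n.
Proof. by move=> /F_le; apply: le_trans. Qed.
Let G_ge0 n : 0 <= G n. Proof. by rewrite /G; case: ifP => // /A_ge0. Qed.
Let FG n : `|F n| <= G n.
Proof. by rewrite /G; case: ifPn => [/F_le|/F0 ->]; rewrite ?normr0. Qed.

Let SG (N : nat) : R := \sum_(1 <= n < N) G n.

Let SG_nd : nondecreasing_seq SG.
Proof.
move=> m n mn; rewrite /SG; case: m mn => [|m] mn; first by rewrite big_geq ?sumr_ge0.
by rewrite [leRHS](@big_cat_nat _ _ _ m.+1) //= lerDl sumr_ge0.
Qed.

Let smooth_pos N n : n \in smooth N -> (0 < n)%N. Proof. by case/smoothP. Qed.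

(** Exceeds N and all entries of [smooth N], which gives both sums a common range. *)
Let bnd N : nat := ((\max_(n <- smooth N) n).+1 + N)%N.

Let smooth_lt N n : n \in smooth N -> (1 <= n < bnd N)%N.
Proof.
move=> hn; rewrite (smooth_pos hn) /= /bnd addSn ltnS.
by apply: leq_trans (leq_addr _ _); apply: (@leq_bigmax_seq _ _ xpredT id).
Qed.

Let SG_le N : SG N <= B.
Proof.
apply: le_trans (A_bound N); rewrite (big_uniq_nat A (smooth_uniq N) (@smooth_lt N)).
case: N => [|N].
  rewrite /SG big_geq //; apply: sumr_ge0 => n hn; apply: A_ge0; exact: smooth_squarefree hn.
have bN : (N.+1 <= bnd N.+1)%N by rewrite /bnd; lia.
rewrite (@big_cat_nat _ _ _ N.+1) //= -[leLHS]addr0; apply: lerD; last first.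
  by apply: sumr_ge0 => n hn; apply: A_ge0; apply: smooth_squarefree hn.
rewrite /SG [leRHS]big_mkcond /=; apply: ler_sum_nat => n /andP[n1 nN].
rewrite /G; case: ifPn => sn; first by rewrite squarefree_smooth.
by case: ifPn => // /smooth_squarefree; rewrite (negPf sn).
Qed.

Let SG_cvg : cvgn SG.
Proof.
apply: nondecreasing_is_cvgn => //; exists B => _ [N _ <-]; exact: SG_le.
Qed.

Let diff_le N : `|\sum_(n <- smooth N) F n - \sum_(1 <= n < N) F n| <= limn SG - SG N.
Proof.
(* [smooth 0] is [:: 1] while the other sum is empty, so for N = 0 the difference is F 1. *)
case: N => [|N].
  rewrite big_seq1 big_geq // subr0 /SG big_geq // subr0.
  apply: (le_trans (FG 1)); have := nondecreasing_cvgn_le SG_nd SG_cvg 2.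
  by rewrite /SG big_nat1.
have bN : (N.+1 <= bnd N.+1)%N by rewrite /bnd; lia.
rewrite (big_uniq_nat F (smooth_uniq N.+1) (@smooth_lt N.+1)).
rewrite (@big_cat_nat _ _ _ N.+1 1 (bnd N.+1)) //= (_ : \sum_(1 <= n < N.+1) F n =
   \sum_(1 <= n < N.+1 | n \in smooth N.+1) F n); last first.
  rewrite [RHS]big_mkcond /=; apply: eq_big_nat => n /andP[n1 nN].
  case: ifPn => // hn; apply: F0; apply: contra hn => sn; exact: squarefree_smooth.
rewrite addrAC subrr add0r; apply: le_trans (_ : SG (bnd N.+1) - SG N.+1 <= _); last first.
  by rewrite lerD2r; apply: nondecreasing_cvgn_le.
rewrite /SG (@big_cat_nat _ _ _ N.+1 1 (bnd N.+1)) //= addrAC subrr add0r.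
apply: le_trans (ler_norm_sum _ _ _) _; rewrite big_mkcond /=.
by apply: ler_sum => n _; case: ifP.
Qed.

(** Every squarefree n < N is in [smooth N], so the two partial sums differ by terms with n >= N
    only, hence by at most a tail of the dominating series. That series converges because its sums
    over [smooth N] are bounded. *)
Lemma euler_sum_cvg (L : R) : ((fun N => \sum_(n <- smooth N) F n) @ \oo --> L)%classic ->
  ((fun N => \sum_(1 <= n < N) F n) @ \oo --> L)%classic.
Proof.
move=> hE.
have h0 : ((fun N => \sum_(n <- smooth N) F n - \sum_(1 <= n < N) F n) @ \oo --> (0 : R))%classic.
  apply/norm_cvg0P; apply: (@squeeze_cvgr _ _ _ _ (fun=> 0) (fun N => limn SG - SG N)).
  - by near=> N; rewrite normr_ge0 diff_le.
  - exact: cvg_cst.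
  - by rewrite -[X in (_ --> X)%classic](subrr (limn SG)); apply: cvgB; [exact: cvg_cst | exact: SG_cvg].
rewrite -[X in (_ --> X)%classic]subr0.
rewrite (_ : (fun N => \sum_(1 <= n < N) F n) = (fun N => \sum_(n <- smooth N) F n -
   (\sum_(n <- smooth N) F n - \sum_(1 <= n < N) F n))); last by apply: funext => N; rewrite subKr.
exact: cvgB.
Unshelve. all: by end_near. Qed.
End EulerSum.

Lemma sum_inv_pronic_le (R : realType) N :
  \sum_(0 <= p < N | prime p) ((p%:R * (p%:R - 1))^-1 : R) <= 1.
Proof.
have hge p : (1 < p)%N -> 0 <= ((p%:R * (p%:R - 1))^-1 : R).
  by move=> p1; rewrite invr_ge0 mulr_ge0 // subr_ge0 ler1n ltnW.
have key M : \sum_(2 <= p < M.+2) ((p%:R * (p%:R - 1))^-1 : R) = 1 - M.+1%:R^-1.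
  elim: M => [|M IH]; first by rewrite big_geq // invr1 subrr.
  rewrite big_nat_recr //= IH -(natr1 M.+1) addrK.
  have h1 : (M.+1%:R : R) != 0 by rewrite pnatr_eq0.
  have h2 : (M.+1%:R + 1 : R) != 0 by rewrite natr1 pnatr_eq0.
  by move: (M.+1%:R : R) h1 h2 => x h1 h2; field; rewrite ?h1 ?h2.
have -> : \sum_(0 <= p < N | prime p) ((p%:R * (p%:R - 1))^-1 : R) =
          \sum_(2 <= p < N | prime p) ((p%:R * (p%:R - 1))^-1 : R).
  case: N => [|[|N]]; [by rewrite !big_geq | by rewrite big_mkcond big_nat1 [RHS]big_geq |].
  rewrite [RHS](big_nat_widenl 2 0) //; apply: eq_bigl => -[|[|p]] //.
  by rewrite andbT.
case: N => [|[|N]]; [by rewrite big_geq // ler01 | by rewrite big_geq // ler01 |].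
apply: le_trans (_ : \sum_(2 <= p < N.+2) ((p%:R * (p%:R - 1))^-1 : R) <= _).
  by rewrite big_mkcond; apply: ler_sum_nat => p /andP[p1 _]; case: ifP => // _; apply: hge.
by rewrite key lerBlDr lerDl invr_ge0.
Qed.

(** The sum is the product of the factors 1 + |w p|, each at most exp |w p|. *)
Lemma sum_smooth_le_expR (R : realType) (w : nat -> R) (C : R) N :
    (forall p, prime p -> `|w p| <= C * (p%:R * (p%:R - 1))^-1) ->
  \sum_(n <- smooth N) \prod_(p <- primes n) `|w p| <= expR C.
Proof.
move=> hw; have C0 : 0 <= C.
  have h21 : (2%:R - 1 : R) = 1 by rewrite -[2%:R](natrD _ 1 1) addrK.
  have := hw 2%N isT; rewrite h21 mulr1.
  move=> /(le_trans (normr_ge0 _)); rewrite pmulr_lge0 // invr_gt0; exact: ltr0n.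
rewrite (_ : \sum_(n <- _) _ = \prod_(0 <= p < N | prime p) (1 + `|w p|)); last first.
  rewrite -sum_smooth big_seq [RHS]big_seq; apply: eq_bigr => n hn.
  by rewrite (prod_primes_smooth _ _ hn) [X in _ * X]big1 ?mulr1.
apply: le_trans (_ : \prod_(0 <= p < N | prime p) expR `|w p| <= _).
  by apply: ler_prod => p _; rewrite addr_ge0 //= expR_ge1Dx.
rewrite -expR_sum ler_expR; apply: le_trans (_ : C * 1 <= _); last by rewrite mulr1.
apply: le_trans (ler_wpM2l C0 (sum_inv_pronic_le R N)).
by rewrite mulr_sumr; apply: ler_sum.
Qed.

Lemma squarefree_dvdP t n : squarefree t -> (0 < n)%N ->
  reflect (forall p, prime p -> (p %| t)%N -> (p %| n)%N) (t %| n)%N.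
Proof.
move=> /squarefreeP[t0 ht] n0; apply: (iffP idP) => [tn p _ pt|h]; first exact: dvdn_trans tn.
apply/(dvdn_partP _ t0) => p; rewrite mem_primes => /and3P[pp _ pt].
rewrite p_part (_ : logn p t = 1%N) ?expn1; first exact: h.
by apply/eqP; rewrite eqn_leq ht logn_gt0 mem_primes pp t0 pt.
Qed.

(** An n not divisible by t misses some prime of t, where the factor is 0; t < N ensures that this
    prime occurs in the product. *)
Lemma sum_smooth_dvd (R : realType) (w : nat -> R) t N : squarefree t -> (t < N)%N ->
  \sum_(n <- smooth N) (if (t %| n)%N then \prod_(p <- primes n) w p else 0) =
  \prod_(0 <= p < N | prime p) ((~~ (p %| t)%N)%:R + w p).
Proof.
move=> st tN; rewrite -sum_smooth big_seq [RHS]big_seq; apply: eq_bigr => n hn.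
have [n0 _] := smoothP _ _ hn; have [t0 _] := squarefreeP _ st.
rewrite (prod_primes_smooth _ _ hn); case: ifPn => tn.
  rewrite [X in _ * X]big1 ?mulr1 // => p /andP[pp pn].
  by rewrite (contra (fun h => dvdn_trans h tn) pn).
have /existsNP[p /not_implyP[pp /not_implyP[pt pn]]] :
    ~ forall p, prime p -> (p %| t)%N -> (p %| n)%N.
  by move=> h; move/negP: tn; apply; apply/(squarefree_dvdP st n0).
rewrite (@big_cat_nat _ _ _ p.+1) //=; last by rewrite (leq_ltn_trans _ tN) // dvdn_leq.
rewrite [X in _ * (X * _)]big_mkcond big_nat_recr //= pp pt /=.
have -> : (p %| n)%N = false by apply/negP.
by rewrite mulr0 mul0r mulr0.
Qed.

Lemma squarefree_dvd_sum_cvg (R : realType) (w : nat -> R) (C L : R) t :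
    (forall p, prime p -> `|w p| <= C * (p%:R * (p%:R - 1))^-1) -> squarefree t ->
    ((fun N => \prod_(0 <= p < N | prime p) ((~~ (p %| t)%N)%:R + w p)) @ \oo --> L)%classic ->
  ((fun N => \sum_(1 <= n < N)
    (if squarefree n && (t %| n)%N then \prod_(p <- primes n) w p else 0)) @ \oo --> L)%classic.
Proof.
move=> hw st hL.
apply: (@euler_sum_cvg R _ (fun n => \prod_(p <- primes n) `|w p|) (expR C)).
- move=> n ->; rewrite /= -normr_prod; case: ifP => // _.
  by rewrite normr0 normr_ge0.
- by move=> n /negPf ->.
- by move=> N; apply: sum_smooth_le_expR.
apply: cvg_trans hL; apply: near_eq_cvg; near=> N.
rewrite -(sum_smooth_dvd w st); last by near: N; exists t.+1.
rewrite big_seq [RHS]big_seq; apply: eq_bigr => n hn.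
by rewrite (smooth_squarefree hn).
Unshelve. all: by end_near. Qed.

(** * Radical extensions *)

Section Kummer.
Variables (F0 : fieldType) (L : fieldExtType F0) (E : {subfield L}) (x z : L) (n : nat).
Hypotheses (x_neq0 : x != 0) (z_prim : n.-primitive_root z).
Hypotheses (zE : z \in E) (xnE : x ^+ n \in E).
Let d := adjoin_degree E x.

(* The constant term of the minimal polynomial is x ^+ d up to sign and an n-th root of unity. *)
Lemma kummer_expr_degree : x ^+ d \in E.
Proof.
have n0 := prim_order_gt0 z_prim.
have z0 : z != 0.
  by apply/eqP => z0; have := prim_expr_order z_prim; rewrite z0 expr0n gtn_eqF // => /eqP; rewrite eq_sym oner_eq0.
pose rs := [seq z ^+ i * x | i <- iota 0 n]; pose P : {poly L} := 'X^n - (x ^+ n)%:P.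
have szP : size P = n.+1 by rewrite size_XnsubC.
have lP : lead_coef P = 1 by apply/eqP; rewrite -monicE monicXnsubC.
have urs : uniq rs.
  rewrite map_inj_in_uniq ?iota_uniq // => i j; rewrite !mem_iota !add0n => /= ilt jlt.
  move/(mulIf x_neq0)/eqP; rewrite (eq_prim_root_expr z_prim) !modn_small // => /eqP //.
have rP : all (root P) rs.
  apply/allP => _ /mapP[i _ ->]; rewrite /root !hornerE exprMn exprAC.
  by rewrite (prim_expr_order z_prim) expr1n mul1r subrr.
have DP : P = \prod_(y <- rs) ('X - y%:P).
  by move: (@all_roots_prod_XsubC _ P rs); rewrite szP size_map size_iota uniq_rootsE lP scale1r; apply.
have : minPoly E x %| \prod_(y <- rs) ('X - y%:P).
  rewrite -DP minPoly_dvdp //; last by rewrite /root !hornerE subrr.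
  by rewrite rpredB ?rpredX ?polyOverX // polyOverC.
case/dvdp_prod_XsubC => m; set l := mask m rs.
rewrite eqp_monic ?monic_minPoly ?monic_prod_XsubC // => /eqP Dmin.
have szl : size l = d.
  by apply/eqP; rewrite -eqSS -(size_prod_XsubC l id) -Dmin size_minPoly.
have lP' y : y \in l -> exists e, [/\ e \in E, e != 0 & - y = e * x].
  move/mem_mask/mapP => [i _ ->]; exists (- z ^+ i).
  by rewrite rpredN rpredX // oppr_eq0 expf_neq0 // mulNr.
have [w [wE w0 hw]] : exists w, [/\ w \in E, w != 0 & \prod_(y <- l) - y = w * x ^+ size l].
  elim: l lP' {szl Dmin} => [|y l IH] hl.
    by exists 1; rewrite mem1v oner_neq0 big_nil mulr1.
  have [e [eE e0 he]] := hl y (mem_head _ _).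
  have [|w [wE w0 hw]] := IH; first by move=> y' hy'; apply: hl; rewrite inE hy' orbT.
  exists (e * w); rewrite rpredM // mulf_neq0 // big_cons hw he exprS; split=> //; ring.
have : (minPoly E x).[0] \in E by rewrite horner_coef0 (polyOverP (minPolyOver E x)).
rewrite Dmin horner_prod.
rewrite (eq_bigr (fun y => - y)) => [|y _]; last by rewrite !hornerE.
by rewrite hw szl => h; rewrite -[x ^+ d](mulKf w0) rpredM // rpredV.
Qed.

(** Otherwise the remainder r > 0 of j gives X^r - x^r over E, of degree below d and vanishing at
    x. *)
Lemma kummer_degree_dvd j : x ^+ j \in E -> (d %| j)%N.
Proof.
move=> xj; have dE := kummer_expr_degree; pose r := (j %% d)%N.
have xr : x ^+ r \in E.
  have : x ^+ j / (x ^+ d) ^+ (j %/ d) \in E by rewrite rpred_div // rpredX.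
  by rewrite {1}(divn_eq j d) exprD mulnC exprM mulrAC divff ?mul1r // !expf_neq0.
rewrite /dvdn; apply: contraT; rewrite -/r -lt0n => r0.
have rd : (r < d)%N by rewrite ltn_pmod.
have := @root_small_adjoin_poly _ _ E x ('X^r - (x ^+ r)%:P).
rewrite rpredB ?rpredX ?polyOverX ?polyOverC // size_XnsubC // => /(_ isT rd).
by rewrite /root !hornerE subrr eqxx => /esym; rewrite (negPf (monic_neq0 (monicXnsubC _ r0))).
Qed.

(** Write v as a polynomial in x over K and reduce it modulo X^d - x^d: its coefficients lie in
    K(x^d), which is inside E. Over E, the polynomial of degree < d with value v at x is unique,
    hence is the constant v. *)
Lemma kummer_inter (K : {subfield L}) v : (K <= E)%VS -> v \in E -> v \in <<K; x>>%VS ->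
  v \in <<K; x ^+ d>>%VS.
Proof.
move=> KE vE /Fadjoin_polyP[P PK vP]; have xdE := kummer_expr_degree.
set B := <<K; x ^+ d>>%VS; have BE : (B <= E)%VS by apply/FadjoinP.
have d0 : (0 < d)%N by [].
pose M : {poly L} := 'X^d - (x ^+ d)%:P; pose Q := P %% M.
have MB : M \is a polyOver B by rewrite rpredB ?rpredX ?polyOverX // polyOverC memv_adjoin.
have QB : Q \is a polyOver B.
  by apply: modp_polyOver => //; apply: polyOverSv PK; apply: subv_adjoin.
have vQ : v = Q.[x].
  by rewrite vP [in LHS](divp_eq P M) hornerD hornerM [M.[x]](_ : _ = 0) ?mulr0 ?add0r //; rewrite !hornerE subrr.
have szQ : (size Q <= d)%N.
  by rewrite -ltnS -(size_XnsubC (x ^+ d) d0) ltn_modp monic_neq0 // monicXnsubC.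
have := Fadjoin_poly_unique (polyOverSv BE QB) szQ (esym vQ).
rewrite Fadjoin_polyC // => hQ.
have -> : v = Q`_0 by rewrite -hQ coefC.
exact: (polyOverP QB).
Qed.
End Kummer.

(** * Transfer of generated fields and of sigma_a to algC *)

Lemma in_QadjM s y z : in_Qadj s y -> in_Qadj s z -> in_Qadj s (y * z).
Proof. by move=> [a <-] [b <-]; exists (a * b); rewrite rmorphM. Qed.

Lemma in_QadjV s y : in_Qadj s y -> in_Qadj s y^-1.
Proof. by move=> [a <-]; exists (a^-1); rewrite fmorphV. Qed.

Lemma in_QadjX s y k : in_Qadj s y -> in_Qadj s (y ^+ k).
Proof. by move=> [a <-]; exists (a ^+ k); rewrite rmorphXn. Qed.

Lemma in_Qadj_rat s r : in_Qadj s (ratr r).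
Proof. by exists r%:A; rewrite alg_num_field fmorph_rat. Qed.

Lemma in_Qadj_gen s y : y \in s -> in_Qadj s y.
Proof. by rewrite -{1}(map_Qadj_gens s) => /mapP[w _ ->]; exists w. Qed.

Lemma in_Qadj_Qz s m y : zeta m \in s -> Qz m y -> in_Qadj s y.
Proof.
move=> ms [p ->]; have [w hw] := in_Qadj_gen ms.
exists (map_poly ratr p).[w]; rewrite -horner_map hw /= -map_poly_comp.
by congr horner; apply: eq_map_poly => c /=; rewrite fmorph_rat.
Qed.

(** Fields [Qadj s] for different s are unrelated types; they are compared through their images in
    [algC]. *)
Lemma adjoin_transfer (K L : fieldExtType rat) (iK : {rmorphism K -> algC})
    (iL : {rmorphism L -> algC}) (V : {subfield L}) (rs : seq K) :
    (forall r, r \in rs -> exists2 w, w \in V & iL w = iK r) ->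
  forall y, y \in <<1 & rs>>%VS -> exists2 w, w \in V & iL w = iK y.
Proof.
elim/last_ind: rs => [|rs x IH] hrs y.
  rewrite Fadjoin_nil => /vlineP[k ->]; exists (k%:A); first by rewrite rpredZ // mem1v.
  by rewrite !alg_num_field !fmorph_rat.
rewrite adjoin_rcons => /Fadjoin_polyP[p /polyOverP pV ->].
have [|wx wxV hx] := hrs x; first by rewrite mem_rcons mem_head.
have IH' := IH (fun r hr => hrs r (etrans (mem_rcons _ _ _) (predU1r _ _ hr))).
rewrite horner_coef; apply: (big_ind (fun y => exists2 w, w \in V & iL w = iK y)).
- by exists 0; rewrite ?mem0v // !rmorph0.
- by move=> y1 y2 [w1 h1 e1] [w2 h2 e2]; exists (w1 + w2); rewrite ?rpredD // !rmorphD e1 e2.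
move=> i _; have [w wV hw] := IH' _ (pV i).
by exists (w * wx ^+ i); rewrite ?rpredM ?rpredX // !rmorphM !rmorphXn /= hw hx.
Qed.

Lemma Qzeta_gen m (x : Qzeta m) : x \in <<1; zetaQ m>>%VS.
Proof.
suff -> : <<1; zetaQ m>>%VS = {: Qzeta m}%VS by exact: memvf.
rewrite -(Qadj_gensP [:: zeta m]) /zetaQ.
have := map_Qadj_gens [:: zeta m]; case: Qadj_gens => // z [|//] _ /=.
by rewrite adjoin_seq1.
Qed.

Lemma in_Qadj1 m y : in_Qadj [:: zeta m] y <-> Qz m y.
Proof.
split; last by apply: in_Qadj_Qz; rewrite inE.
case=> w <-; have /Fadjoin1_polyP[p ->] := Qzeta_gen w; exists p; rewrite -horner_map /= zetaQE -map_poly_comp.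
by congr horner; apply: eq_map_poly => c /=; rewrite alg_num_field fmorph_rat.
Qed.

Lemma sigma_aut a f (haf : coprime a f) (u : {rmorphism algC -> algC}) x :
  u (zeta f) = zeta f ^+ a ->
  Qadj_inj [:: zeta f] (sigma haf x) = u (Qadj_inj [:: zeta f] x).
Proof.
move=> hu; have hs : sigma haf (zetaQ f) = zetaQ f ^+ a by exact: (svalP (sigma_exists haf)).
have /Fadjoin1_polyP[p ->] := Qzeta_gen x; rewrite -!horner_map /= hs rmorphXn /= !zetaQE hu -!map_poly_comp.
congr horner; apply: eq_map_poly => c /=.
by rewrite !alg_num_field !fmorph_rat.
Qed.

(** Any extension u of sigma_a to [algC] will do, so u can be chosen to suit zeta_n. *)
Lemma sigma_fixesP a f (haf : coprime a f) g n (u : {rmorphism algC -> algC}) :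
    u (zeta f) = zeta f ^+ a ->
  sigma_fixes haf g n <->
  (forall y, Qz f y -> in_Qadj [:: zeta n; rat_root g n] y -> u y = y).
Proof.
move=> hu; split=> h.
  move=> y /in_Qadj1[x xy]; rewrite -xy => /h hx.
  by rewrite -(sigma_aut haf _ hu) hx.
move=> x hx; apply: (fmorph_inj (Qadj_inj [:: zeta f])).
by rewrite (sigma_aut haf _ hu) h //; apply/in_Qadj1; exists x.
Qed.

(** The cofactors m/f and m/n are coprime, so a Bezout relation recovers zeta_m from its powers of
    these exponents. *)
Lemma zeta_lcm f n : (0 < f)%N -> (0 < n)%N ->
  exists i j, zeta (lcmn f n) = zeta f ^+ i * zeta n ^+ j.
Proof.
move=> f0 n0; set m := lcmn f n; have m0 : (0 < m)%N by rewrite lcmn_gt0 f0.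
have [c1 hc1] : exists c, m = (c * f)%N by apply/dvdnP/dvdn_lcml.
have [c2 hc2] : exists c, m = (c * n)%N by apply/dvdnP/dvdn_lcmr.
have c10 : (0 < c1)%N by move: m0; rewrite hc1 muln_gt0 => /andP[].
have cop : gcdn c1 c2 = 1%N.
  set e := gcdn c1 c2; have e0 : (0 < e)%N by rewrite gcdn_gt0 c10.
  have [k1 hk1] : exists k, c1 = (k * e)%N by apply/dvdnP/dvdn_gcdl.
  have [k2 hk2] : exists k, c2 = (k * e)%N by apply/dvdnP/dvdn_gcdr.
  have em : (e %| m)%N by rewrite hc1 hk1 -mulnA mulnCA dvdn_mulr.
  have : (m %| m %/ e)%N.
    rewrite {1}/m dvdn_lcm; apply/andP; split; apply/dvdnP.
      by exists k1; rewrite hc1 hk1 -mulnA mulnCA mulKn.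
    by exists k2; rewrite hc2 hk2 -mulnA mulnCA mulKn.
  move/dvdn_leq; rewrite divn_gt0 // dvdn_leq // => /(_ isT).
  by case: (ltngtP e 1%N) => // [|e1]; [rewrite ltnS leqn0 gtn_eqF | rewrite leqNgt ltn_Pdiv].
have zf : (zeta m ^+ c1) ^+ f = 1 by rewrite -exprM -hc1 zetaX.
have zn : (zeta m ^+ c2) ^+ n = 1 by rewrite -exprM -hc2 zetaX.
have [i hi] := prim_rootP (zeta_prim f0) zf.
have [j hj] := prim_rootP (zeta_prim n0) zn.
have [u v huv _] := egcdnP c2 c10; rewrite cop in huv.
(* The factor m - 1 stands for -1 modulo m. *)
exists (i * u)%N, (j * (v * m.-1))%N.
rewrite exprM -hi [zeta n ^+ _]exprM -hj -(exprM _ c1) -(exprM _ c2) -exprD.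
rewrite -[LHS]expr1; apply/eqP; rewrite zetaX_eq //.
have -> : (c1 * u + c2 * (v * m.-1) = 1 + v * c2 * m)%N.
  by rewrite mulnC huv -{2}(prednK m0); ring.
by rewrite addnC modnMDl.
Qed.

Lemma sqrt_rat_mulE (g t : rat) (D : int) (x y : algC) : t != 0 -> g = D%:~R * t ^+ 2 ->
  x ^+ 2 = ratr g -> y ^+ 2 = D%:~R -> x = ratr t * y \/ x = - (ratr t * y).
Proof.
move=> t0 gE x2 y2; have /eqP : x ^+ 2 = (ratr t * y) ^+ 2.
  by rewrite x2 gE exprMn y2 rmorphM rmorphXn /= ratr_int mulrC.
by rewrite eqf_sqr => /orP[] /eqP; [left | right].
Qed.

(** If p does not divide h, a relation u p = v h + 1 gives g = (r^u / s^v)^(p h), against the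
    maximality of h. *)
Lemma max_power_dvd (g : rat) h p s : g != 0 -> prime p -> (0 < h)%N ->
    (exists r, g = r ^+ h) ->
    (forall k, (0 < k)%N -> (exists r : rat, g = r ^+ k) -> (k <= h)%N) ->
  g = s ^+ p -> (p %| h)%N.
Proof.
move=> g0 pp h0 [r hr] hmax hs; apply: contraT; rewrite -prime_coprime // => cop.
have p0 := prime_gt0 pp; have [u v huv _] := egcdnP h p0.
rewrite (eqP cop) in huv.
have : (p * h <= h)%N.
  apply: hmax; first by rewrite muln_gt0 p0.
  exists (r ^+ u / s ^+ v); rewrite expr_div_n -!exprM.
  have -> : (u * (p * h) = h * (u * p))%N by ring.
  have -> : (v * (p * h) = p * (v * h))%N by ring.
  by rewrite [r ^+ _]exprM -hr [s ^+ _]exprM -hs huv addn1 exprS mulfK // expf_neq0.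
by rewrite leqNgt ltn_Pmull ?prime_gt1.
Qed.

Lemma Qadj_gens_mem s w : w \in Qadj_gens s -> Qadj_inj s w \in s.
Proof. by move/(map_f (Qadj_inj s)); rewrite map_Qadj_gens. Qed.

Section RadicalField.
Variables (f n h : nat) (g r : rat).
Hypotheses (f_gt0 : (0 < f)%N) (n_sqf : squarefree n) (g_neq0 : g != 0).
Hypotheses (h_odd : odd h) (gE : g = r ^+ h).
Hypothesis h_max : forall k : nat, (0 < k)%N -> (exists r : rat, g = r ^+ k) -> (k <= h)%N.
Let m := lcmn f n.
Let alpha := rat_root g n.
Let n_gt0 : (0 < n)%N. Proof. by case/squarefreeP: n_sqf. Qed.
Let m_gt0 : (0 < m)%N. Proof. by rewrite lcmn_gt0 f_gt0. Qed.
Let e := gcdn n h.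
Variable eps : bool.
Hypothesis epsP : eps <-> (2 %| n)%N /\ Qz m (alpha ^+ (n %/ 2)).
(** Shown below to be the degree of [alpha] over Q(zeta_m). *)
Let d := (n %/ (e * 2 ^ eps))%N.

Let alphaX : alpha ^+ n = ratr g. Proof. exact: rootCK. Qed.

Let alpha0 : alpha != 0.
Proof.
apply/eqP => a0; move/eqP: alphaX; rewrite a0 expr0n gtn_eqF // eq_sym fmorph_eq0.
by rewrite (negPf g_neq0).
Qed.

Let e_gt0 : (0 < e)%N. Proof. by rewrite gcdn_gt0 n_gt0. Qed.
Let e_odd : odd e. Proof. by apply: dvdn_odd h_odd; apply: dvdn_gcdr. Qed.
Let en : (e %| n)%N. Proof. exact: dvdn_gcdl. Qed.
Let eh : (e %| h)%N. Proof. exact: dvdn_gcdr. Qed.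

Let e2n : (e * 2 ^ eps %| n)%N.
Proof.
have : eps -> (2 %| n)%N by move=> /epsP[].
case: (eps) => [/(_ isT) n2|_]; last by rewrite muln1.
by rewrite expn1 Gauss_dvd ?en // coprimen2.
Qed.

Let dE : (n = d * (e * 2 ^ eps))%N. Proof. by rewrite divnK. Qed.

(** alpha^(n/e) and r^(h/e) have the same e-th power g, so they differ by an e-th root of unity, and
    e | n. The field Q(zeta_n), rather than Q(zeta_m), matters for automorphisms known only to fix
    zeta_n. *)
Lemma alpha_pow_e : Qz n (alpha ^+ (n %/ e)).
Proof.
have he : (alpha ^+ (n %/ e)) ^+ e = (ratr r ^+ (h %/ e)) ^+ e.
  by rewrite -!exprM !divnK // alphaX gE rmorphXn.
have r0 : ratr r != 0 :> algC.
  by rewrite fmorph_eq0; apply: contraNneq g_neq0 => r0; rewrite gE r0 expr0n gtn_eqF //; case: (h) h_odd.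
have : (alpha ^+ (n %/ e) / ratr r ^+ (h %/ e)) ^+ e = 1.
  by rewrite expr_div_n he divff // !expf_neq0.
case/(prim_rootP (zeta_prim e_gt0)) => k hk.
rewrite -[X in Qz n X](divfK (expf_neq0 (h %/ e) r0)) hk; apply: QzM.
  by apply: QzX; apply: Qz_dvd (Qz_zeta e).
by apply: QzX; apply: Qz_rat.
Qed.

Let L : fieldExtType rat := Qadj [:: zeta f; zeta n; alpha].
Let iota := Qadj_inj [:: zeta f; zeta n; alpha].

Let gen_exists y : y \in [:: zeta f; zeta n; alpha] -> exists w : L, iota w = y.
Proof. exact: in_Qadj_gen. Qed.

(** Presents the field as E(A) over E = Q(zeta_m), a simple radical extension to which the Kummer
    lemmas apply. *)
Lemma radical_field : exists (Z zn A : L) (E := <<1; Z>>%AS), [/\ iota Z = zeta m, iota zn = zeta n,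
  iota A = alpha, <<E; A>>%VS = {: L}%VS & zn \in E].
Proof.
have [zf hzf] := @gen_exists (zeta f) (mem_head _ _).
have [zn hzn] : exists w : L, iota w = zeta n by apply: gen_exists; rewrite !inE eqxx orbT.
have [A hA] : exists w : L, iota w = alpha by apply: gen_exists; rewrite !inE eqxx !orbT.
have [i [j hij]] := zeta_lcm f_gt0 n_gt0.
pose Z := zf ^+ i * zn ^+ j; pose E := <<1; Z>>%AS.
have hZ : iota Z = zeta m by rewrite rmorphM !rmorphXn /= hzf hzn.
have pw k w : (k %| m)%N -> iota w = zeta k -> w \in E.
  move=> km hw; have [c hc] := zeta_pow m_gt0 km.
  have -> : w = Z ^+ c by apply: (fmorph_inj iota); rewrite hw hc rmorphXn /= hZ.
  by rewrite rpredX // memv_adjoin.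
have zfE : zf \in E by apply: pw hzf; apply: dvdn_lcml.
have znE : zn \in E by apply: pw hzn; apply: dvdn_lcmr.
exists Z, zn, A; split=> //.
apply/eqP; rewrite eqEsubv subvf /= -(Qadj_gensP [:: zeta f; zeta n; alpha]).
apply/Fadjoin_seqP; split; first exact: sub1v.
move=> w wg; have : iota w \in [:: zeta f; zeta n; alpha] by apply: Qadj_gens_mem.
have inj y : iota w = iota y -> w = y by apply: fmorph_inj.
rewrite !inE => /or3P[] /eqP hw.
- have -> : w = zf by apply: inj; rewrite hw hzf.
  by rewrite (subvP (subv_adjoin _ _)).
- have -> : w = zn by apply: inj; rewrite hw hzn.
  by rewrite (subvP (subv_adjoin _ _)).
- have -> : w = A by apply: inj; rewrite hw hA.
  by rewrite memv_adjoin.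
Qed.

Let mem_E (Z w : L) : iota Z = zeta m -> w \in <<1; Z>>%VS <-> Qz m (iota w).
Proof.
move=> hZ; have hm p : map_poly ratr p = map_poly iota (map_poly (in_alg L) p).
  by rewrite -map_poly_comp; apply: eq_map_poly => c /=; rewrite alg_num_field fmorph_rat.
split=> [/Fadjoin1_polyP[p ->]|[p hp]].
  by exists p; rewrite hm -hZ horner_map.
apply/Fadjoin1_polyP; exists p; apply: (fmorph_inj iota).
by rewrite hp hm -hZ horner_map.
Qed.

Let dim_E (Z : L) : iota Z = zeta m -> \dim <<1; Z>>%VS = totient m.
Proof.
move=> hZ; rewrite dim_Fadjoin dimv1 muln1; apply/eqP; rewrite -eqSS -size_minPoly.
have mP := zeta_prim m_gt0.
have hm (p : {poly rat}) : map_poly ratr p = map_poly iota (map_poly (in_alg L) p).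
  by rewrite -map_poly_comp; apply: eq_map_poly => c /=; rewrite alg_num_field fmorph_rat.
pose Phi : {poly rat} := map_poly intr 'Phi_m.
have PhiC : map_poly ratr Phi = cyclotomic (zeta m) m by exact: ratr_Cyclotomic.
have szPhi : size Phi = (totient m).+1.
  by rewrite -(size_cyclotomic (zeta m)) -PhiC size_map_poly.
have rPhi : root (map_poly (in_alg L) Phi) Z.
  rewrite -(fmorph_root iota) -hm PhiC hZ root_cyclotomic //.
have le1 : (size (minPoly 1 Z) <= (totient m).+1)%N.
  rewrite -szPhi -(size_map_poly (in_alg L)); apply: dvdp_leq.
    by rewrite map_poly_eq0 -size_poly_eq0 szPhi.
  by apply: minPoly_dvdp rPhi; apply: alg_polyOver.
rewrite eqn_leq le1 /=.
have /polyOver1P[q hq] := minPolyOver 1 Z.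
have [P [hP _ hdvd]] := minCpolyP (zeta m).
have qroot : root (map_poly ratr q) (zeta m).
  by rewrite hm -hq -hZ fmorph_root root_minPoly.
have q0 : q != 0 by rewrite -(map_poly_eq0 (in_alg L)) -hq monic_neq0 // monic_minPoly.
rewrite hq size_map_poly; rewrite hdvd in qroot.
apply: leq_trans (dvdp_leq q0 qroot).
by rewrite -(size_map_poly (ratr : {rmorphism rat -> algC})) -hP (minCpoly_cyclotomic mP) size_cyclotomic.
Qed.

Let nroot (zn : L) : iota zn = zeta n -> n.-primitive_root zn.
Proof. by move=> hz; rewrite -(fmorph_primitive_root iota) hz; apply: zeta_prim. Qed.

(** When eps holds, put b = n / (2e). The exponents n/e = 2b and n/2 = e b both give elements of
    Q(zeta_m), and since e is odd, b = e b - 2b (e - 1)/2. *)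
Lemma alpha_pow_d : Qz m (alpha ^+ d).
Proof.
have he : Qz m (alpha ^+ (n %/ e)) by apply: Qz_dvd alpha_pow_e; rewrite // dvdn_lcmr.
have := epsP; rewrite /d; case: (eps) => [[+ _]|_]; last by rewrite muln1.
case=> // n2 hrho; have [Z [zn [A [hZ hzn hA _ _]]]] := radical_field.
rewrite expn1; set b := (n %/ (e * 2))%N.
have bn : (n = b * (e * 2))%N.
  by rewrite divnK // Gauss_dvd ?en // coprimen2.
have b2 : (n %/ e = b * 2)%N by rewrite bn mulnCA mulnC mulnK.
have be : (n %/ 2 = b * e)%N by rewrite bn mulnA mulnK.
have h2 : A ^+ (b * 2) \in <<1; Z>>%VS by apply/(mem_E _ hZ); rewrite rmorphXn /= hA -b2.
have h3 : A ^+ (b * e) \in <<1; Z>>%VS by apply/(mem_E _ hZ); rewrite rmorphXn /= hA -be.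
have A0 : A != 0 by rewrite -(fmorph_eq0 iota) hA.
suff : A ^+ b \in <<1; Z>>%VS by move/(mem_E _ hZ); rewrite rmorphXn /= hA.
have -> : A ^+ b = A ^+ (b * e) / (A ^+ (b * 2)) ^+ e./2.
  rewrite -{1}(odd_double_half e) e_odd mulnDr muln1 exprD -mul2n mulnA [A ^+ (b * 2 * _)]exprM.
  by rewrite mulfK // !expf_neq0.
by rewrite rpred_div // rpredX.
Qed.

(** The true degree d' divides d and n, say n = c d'. For a prime p | c, alpha^(n/p) is a p-th root
    of g in Q(zeta_m): if p = 2 this is eps, and if p is odd then g is a p-th power and p | h. So
    the squarefree c divides e 2^eps, whence d | d'. *)
Lemma adjoin_degree_radical (Z zn A : L) (E := <<1; Z>>%AS) : iota Z = zeta m -> iota zn = zeta n ->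
  iota A = alpha -> zn \in E -> adjoin_degree E A = d.
Proof.
move=> hZ hzn hA znE.
have A0 : A != 0 by rewrite -(fmorph_eq0 iota) hA.
have AnE : A ^+ n \in E.
  by apply/(mem_E _ hZ); rewrite rmorphXn /= hA alphaX; apply: Qz_rat.
have nP := nroot hzn.
set d' := adjoin_degree E A.
have d'd : (d' %| d)%N.
  apply: (kummer_degree_dvd A0 nP znE AnE); apply/(mem_E _ hZ).
  by rewrite rmorphXn /= hA; apply: alpha_pow_d.
have [c hc] : exists c, n = (c * d')%N by apply/dvdnP/(kummer_degree_dvd A0 nP znE AnE).
have d'0 : (0 < d')%N by [].
have sc : squarefree c.
  have c0 : (0 < c)%N by move: n_gt0; rewrite hc muln_gt0 => /andP[].
  apply/squarefreeP; split=> // p; have [_ /(_ p)] := squarefreeP _ n_sqf.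
  by apply: leq_trans; rewrite hc lognM // leq_addr.
have et0 : (0 < e * 2 ^ eps)%N by rewrite muln_gt0 e_gt0 expn_gt0.
have c_dvd : (c %| e * 2 ^ eps)%N.
  apply/(squarefree_dvdP sc et0) => p pp /dvdnP[c' hc'].
  have pn : (p %| n)%N by rewrite hc hc' mulnAC dvdn_mull.
  have xE : Qz m (alpha ^+ (n %/ p)).
    rewrite -hA -rmorphXn; apply/(mem_E _ hZ).
    have -> : (n %/ p = d' * c')%N by rewrite hc hc' mulnAC mulnK ?prime_gt0 // mulnC.
    by rewrite exprM rpredX // (kummer_expr_degree A0 nP znE AnE).
  have xp : (alpha ^+ (n %/ p)) ^+ p = ratr g by rewrite -exprM divnK.
  have [p2|op] := even_prime pp.
    have -> : eps by apply/epsP; rewrite -p2.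
    by rewrite p2 dvdn_mull.
  have pm : (p %| m)%N by apply: dvdn_trans pn _; apply: dvdn_lcmr.
  have [s hs] := Qz_root_rat m_gt0 pp op pm xE xp.
  have h0 : (0 < h)%N by case: (h) h_odd.
  rewrite dvdn_mulr // dvdn_gcd pn /=.
  by apply: (max_power_dvd g_neq0 pp h0 _ h_max hs); exists r.
apply/eqP; rewrite eqn_dvd d'd /=.
have hcd : (c * d' = d * (e * 2 ^ eps))%N by rewrite -hc -dE.
have /dvdnP[k hk] := c_dvd; have c0 : (0 < c)%N by move: n_gt0; rewrite hc muln_gt0 => /andP[].
apply/dvdnP; exists k; apply/eqP; rewrite -(eqn_pmul2l c0) hcd hk; apply/eqP; ring.
Qed.

Lemma degQ_radical : (degQ [:: zeta f; zeta n; alpha] * (e * 2 ^ eps) = n * totient m)%N.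
Proof.
have [Z [zn [A [hZ hzn hA hgen znE]]]] := radical_field.
rewrite /degQ -/L -hgen dim_Fadjoin (adjoin_degree_radical hZ hzn hA znE) dim_E //.
by rewrite mulnAC -dE.
Qed.

(** By [kummer_inter] over K = Q(zeta_n), the intersection lies in Q(zeta_n, alpha^d). *)
Lemma radical_inter_fixed (u : {rmorphism algC -> algC}) y :
    u (zeta n) = zeta n -> u (alpha ^+ d) = alpha ^+ d ->
    Qz f y -> in_Qadj [:: zeta n; alpha] y -> u y = y.
Proof.
move=> un ud yf yn; have [Z [zn [A [hZ hzn hA hgen znE]]]] := radical_field.
have A0 : A != 0 by rewrite -(fmorph_eq0 iota) hA.
have AnE : A ^+ n \in <<1; Z>>%VS.
  by apply/(mem_E _ hZ); rewrite rmorphXn /= hA alphaX; apply: Qz_rat.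
have nP := nroot hzn.
have [w wF hw] : exists2 w : L, w \in <<<<1; zn>>; A>>%VS & iota w = y.
  case: yn => y' <-; apply: (@adjoin_transfer _ _ _ iota <<<<1; zn>>; A>>%AS
     (Qadj_gens [:: zeta n; alpha])); last by rewrite Qadj_gensP memvf.
  move=> s sg; have : Qadj_inj [:: zeta n; alpha] s \in [:: zeta n; alpha] by apply: Qadj_gens_mem.
  rewrite !inE => /orP[] /eqP ->; last by exists A => //; apply: memv_adjoin.
  by exists zn => //; apply: (subvP (subv_adjoin _ _)); apply: memv_adjoin.
have wE : w \in <<1; Z>>%VS.
  by apply/(mem_E _ hZ); rewrite hw; apply: Qz_dvd yf; rewrite // dvdn_lcml.
have KE : (<<1; zn>> <= <<1; Z>>)%VS by apply/FadjoinP; split=> //; apply: sub1v.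
have := kummer_inter (E := <<1; Z>>%AS) A0 nP znE AnE (K := <<1; zn>>%AS) KE wE wF.
rewrite (adjoin_degree_radical hZ hzn hA znE) -hw.
case/Fadjoin_polyP => P /polyOverP hP ->.
have coef i : u (iota P`_i) = iota P`_i.
  have /Fadjoin1_polyP[q ->] := hP i.
  rewrite -horner_map /= -!horner_map /= hzn un -!map_poly_comp; congr horner.
  by apply: eq_map_poly => c /=; rewrite alg_num_field !fmorph_rat.
rewrite horner_coef !rmorph_sum; apply: eq_bigr => i _.
have hd : iota (A ^+ d) = alpha ^+ d by rewrite rmorphXn /= hA.
have -> : iota (P`_i * (A ^+ d) ^+ i) = iota P`_i * (alpha ^+ d) ^+ i by rewrite rmorphM rmorphXn /= hd.
have -> c (x : algC) : u (c * x ^+ i) = u c * u x ^+ i by rewrite rmorphM rmorphXn.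
by rewrite coef ud.
Qed.
End RadicalField.

(** * Entanglement of square roots with cyclotomic fields *)

(** The exponent (b - 1)/2 in gamma is negative when b < 0; only its parity counts. *)
Lemma N1_exprz (z : int) : (-1 : int) ^ z = (-1) ^+ odd `|z|.
Proof.
case: z => n; first by rewrite -exprnP signr_odd.
rewrite -[`|Negz n|%N]/n.+1; transitivity ((-1 : int) ^- n.+1); first by [].
by rewrite -[in LHS]signr_odd; case: (odd _); rewrite ?expr1 ?expr0 ?invr1 ?invrN1.
Qed.

Lemma sign_mod4 (b : int) : odd `|b| -> (((-1) ^ ((b - 1) %/ 2)%Z * b) %% 4)%Z = 1.
Proof.
move=> ob; rewrite N1_exprz.
have [[k bE]|[k bE]] : (exists k, b = 4 * k + 1) \/ (exists k, b = 4 * k + 3).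
  have [h|h] : (b %% 4)%Z = 1 \/ (b %% 4)%Z = 3 by lia.
    by left; exists (b %/ 4)%Z; lia.
  by right; exists (b %/ 4)%Z; lia.
- rewrite bE (_ : ((4 * k + 1 - 1) %/ 2)%Z = 2 * k); last by lia.
  by rewrite abszM oddM /= expr0; lia.
- rewrite bE (_ : ((4 * k + 3 - 1) %/ 2)%Z = 2 * k + 1); last by lia.
  by rewrite (_ : odd `|2 * k + 1|); [rewrite expr1; lia | lia].
Qed.

Lemma sign_sqr (z : int) : ((-1 : int) ^ z) * ((-1) ^ z) = 1.
Proof. by rewrite N1_exprz -expr2 sqrr_sign. Qed.

Section DiscSplit.
Variables (D : int) (f : nat).
Hypothesis D_fund : fund_disc D.
Let b : int := (D %/ gcdz f%:Z D)%Z.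
Let gamma : int := (-1) ^ ((b - 1) %/ 2)%Z * gcdz f%:Z D.
Let G := gcdn f `|D|.

Let gcdE : gcdz f%:Z D = G%:Z. Proof. by []. Qed.
Let DE : D = b * G%:Z. Proof. by rewrite /b -gcdE divzK // dvdz_gcdr. Qed.
Let DabsE : `|D|%N = (`|b| * G)%N. Proof. by rewrite {1}DE abszM. Qed.

Lemma disc_gamma_abs : `|gamma|%N = G.
Proof. by rewrite /gamma gcdE N1_exprz abszMsign absz_nat. Qed.

Lemma disc_gamma_dvd : (`|gamma| %| f)%N.
Proof. by rewrite disc_gamma_abs dvdn_gcdl. Qed.

Let D4 : exists e, sqfree `|e| /\ (D = e \/ D = 4 * e).
Proof. by case: D_fund => e [se [[-> _]|[-> _]]]; exists e; split=> //; [left | right]. Qed.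

Lemma odd_prime_sq_disc p : prime p -> odd p -> ~~ (p ^ 2 %| `|D|)%N.
Proof.
move=> pp op; case: D4 => e [[_ se] [->|->]]; first exact: se.
rewrite abszM Gauss_dvdr; first exact: se.
by rewrite coprimeXl // (coprimeXr 2 (_ : coprime p 2)) // coprimen2.
Qed.

Hypothesis b_odd : odd `|b|.

Let odd_dvd p : (p %| `|b|)%N -> odd p. Proof. by move=> pb; apply: dvdn_odd b_odd. Qed.

Lemma disc_b_sqfree : sqfree `|b|.
Proof.
split=> [|p pp]; first by case: (`|b|%N) b_odd.
apply/negP => pb; have op : odd p by apply: odd_dvd; apply: dvdn_trans pb; rewrite dvdn_exp.
by have /negP := odd_prime_sq_disc pp op; apply; rewrite DabsE dvdn_mulr.
Qed.

(** A common prime p is odd and divides (f, D) too, so p^2 would divide D = b (f, D). *)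
Lemma disc_b_coprime : coprime `|b| f.
Proof.
have b0 : (0 < `|b|)%N by case: disc_b_sqfree.
rewrite /coprime; apply/eqP; apply/eqP; apply: contraT => g1.
have g_gt1 : (1 < gcdn `|b| f)%N.
  by have : (0 < gcdn `|b| f)%N; [rewrite gcdn_gt0 b0 | case: (gcdn _ _) g1 => [|[]]].
have pp := pdiv_prime g_gt1; set p := pdiv _ in pp.
have : (p %| gcdn `|b| f)%N by apply: pdiv_dvd.
rewrite dvdn_gcd => /andP[pb pf].
have /negP := odd_prime_sq_disc pp (odd_dvd pb); case.
rewrite DabsE expnS expn1 dvdn_mul // dvdn_gcd pf DabsE dvdn_mulr //.
Qed.

Let sg : int := (-1) ^ ((b - 1) %/ 2)%Z.
Let b' : int := sg * b.

Let b'4 : (b' %% 4)%Z = 1. Proof. exact: sign_mod4. Qed.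
Let b'abs : `|b'|%N = `|b|%N. Proof. by rewrite /b' /sg N1_exprz abszMsign. Qed.
Let Dgb : D = gamma * b'.
Proof. by rewrite /gamma /b' -/sg gcdE mulrACA /sg sign_sqr mul1r mulrC -DE. Qed.

(** The signed b' is 1 mod 4, so dividing the squarefree part of D by it preserves the residue mod
    4, and gamma is fundamental of the same type as D. *)
Lemma disc_split : exists b1 : int, [/\ fund_disc b1, fund_disc gamma, D = gamma * b1 &
  `|b1|%N = `|b|%N].
Proof.
exists b'; split=> //; first by exists b'; rewrite b'abs; split; [exact: disc_b_sqfree | left].
have [k hk] : exists k, b' = 4 * k + 1 by exists (b' %/ 4)%Z; move: b'4; clear; move: b' => z; lia.
case: D_fund => e [se [[De e1]|[De e1]]].
  exists gamma; split.
    by apply: sqfree_dvd se; rewrite -De Dgb abszM dvdn_mulr.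
  left; split=> //; move: e1; rewrite -De Dgb hk mulrDr mulr1 mulrCA mulrC modzMDl //.
have /dvdnP[c hc] : (`|b'| %| `|e|)%N.
  have : (`|b'| %| `|(4 * e)%R|)%N by rewrite -De Dgb abszM dvdn_mull.
  by rewrite abszM Gauss_dvdr // b'abs (coprimeXr 2 (_ : coprime `|b| 2)) // coprimen2.
have /dvdzP[e' ee'] : (b' %| e)%Z by rewrite dvdzE hc dvdn_mull.
have b'0 : b' != 0 by rewrite -absz_gt0 b'abs; case: disc_b_sqfree.
exists e'; split; first by apply: sqfree_dvd se; rewrite ee' abszM dvdn_mulr.
right; split; first by apply: (mulIf b'0); rewrite -Dgb De ee' mulrA.
by move: e1; rewrite ee' hk mulrDr mulr1 mulrCA mulrC modzMDl.
Qed.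
End DiscSplit.

(** b is coprime to f / (f, D), hence |D| | lcm(f, n) forces b | n. If b were even, then 4 | D and D
    would have larger 2-adic valuation than f; it also exceeds that of the squarefree n, so D could
    not divide the lcm. *)
Lemma disc_dvd_lcm (D : int) f n (b := (D %/ gcdz f%:Z D)%Z) :
    fund_disc D -> (0 < f)%N -> squarefree n -> (2 %| n)%N ->
  (`|D| %| lcmn f n)%N = odd `|b| && (`|b| %| n)%N.
Proof.
move=> fD f0 sn n2; have [n0 hn] := squarefreeP _ sn.
have D0 := fund_disc_gt0 fD; pose G := gcdn f `|D|.
have G0 : (0 < G)%N by rewrite gcdn_gt0 f0.
have DabsE : `|D|%N = (`|b| * G)%N.
  by rewrite -[G]absz_nat -abszM divzK // dvdz_gcdr.
have b0 : (0 < `|b|)%N by move: D0; rewrite DabsE muln_gt0 => /andP[].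
apply/idP/andP => [Dl|[ob bn]]; last first.
  rewrite DabsE Gauss_dvd.
    by rewrite (dvdn_trans bn) ?dvdn_lcmr // (dvdn_trans (dvdn_gcdl _ _)) ?dvdn_lcml.
  exact: coprime_dvdr (dvdn_gcdl f `|D|) (disc_b_coprime fD ob).
have bn : (`|b| %| n)%N.
  have cop : coprime `|b| (f %/ G).
    rewrite /coprime -(eqn_pmul2r G0) mul1n muln_gcdl -DabsE divnK ?dvdn_gcdl //.
    by rewrite gcdnC.
  rewrite -(Gauss_dvdr _ cop) -(dvdn_pmul2r G0) -DabsE mulnAC divnK ?dvdn_gcdl //.
  by apply: dvdn_trans Dl _; rewrite dvdn_lcm dvdn_mulr // dvdn_mull.
split=> //; rewrite -[odd _]negbK -dvdn2; apply/negP => b2.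
have D4 : (2 ^ 2 %| `|D|)%N.
  case: fD => e [_ [[De e1]|[-> _]]]; last by rewrite abszM dvdn_mulr.
  have D2 : (2 %| `|D|)%N by rewrite DabsE dvdn_mulr.
  by exfalso; move: D2 e1; rewrite -De; clear; lia.
have lD : (1 < logn 2 `|D|)%N by rewrite -pfactor_dvdn.
have l0 : (0 < lcmn f n)%N by rewrite lcmn_gt0 f0.
have lbpos : (0 < logn 2 `|b|)%N by rewrite logn_gt0 mem_primes b0 b2.
have lsum : logn 2 `|D| = (logn 2 `|b| + logn 2 G)%N by rewrite DabsE lognM.
have lG : logn 2 G = minn (logn 2 f) (logn 2 `|D|) by rewrite logn_gcd.
have llcm : logn 2 (lcmn f n) = maxn (logn 2 f) (logn 2 n) by rewrite logn_lcm.
have lle : (logn 2 `|D| <= maxn (logn 2 f) (logn 2 n))%N by rewrite -llcm dvdn_leq_log.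
have ln := hn 2%N.
move: lD lbpos lsum lG lle ln; clear.
move: (logn 2 _) (logn 2 _) (logn 2 _) (logn 2 _) (logn 2 _) => x1 x2 x3 x4 x5; lia.
Qed.

Section Setting.
Variables (g : rat) (h : nat) (Delta : int) (a f : nat).
Hypotheses (g_neq0 : g != 0) (g_nonsquare : ~ exists r : rat, g = r ^+ 2).
Hypothesis h_power : exists r : rat, g = r ^+ h.
Hypothesis h_max : forall k : nat, (0 < k)%N -> (exists r : rat, g = r ^+ k) -> (k <= h)%N.
Hypothesis D_fund : fund_disc Delta.
Hypothesis gDelta : exists2 t : rat, t != 0 & g = Delta%:~R * t ^+ 2.
Hypotheses (f_gt0 : (0 < f)%N) (a_gt0 : (0 < a)%N) (haf : coprime a f).
Let b : int := (Delta %/ gcdz f%:Z Delta)%Z.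
Let gamma : int := (-1) ^ ((b - 1) %/ 2)%Z * gcdz f%:Z Delta.

Lemma power_odd : odd h.
Proof.
apply: contraT => he; exfalso; apply: g_nonsquare; have [r hr] := h_power.
by exists (r ^+ h./2); rewrite -exprM muln2 even_halfK.
Qed.

Definition entangled (n : nat) : bool := [&& (2 %| n)%N, odd `|b| & (`|b| %| n)%N].

Let rho2 n : (2 %| n)%N -> (0 < n)%N -> (rat_root g n ^+ (n %/ 2)) ^+ 2 = ratr g.
Proof. by move=> n2 n0; rewrite -exprM divnK // rootCK. Qed.

Lemma entangledP n : squarefree n ->
  entangled n <-> (2 %| n)%N /\ Qz (lcmn f n) (rat_root g n ^+ (n %/ 2)).
Proof.
move=> sn; have [n0 _] := squarefreeP _ sn; have [t t0 gE] := gDelta.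
have l0 : (0 < lcmn f n)%N by rewrite lcmn_gt0 f_gt0.
have tC : ratr t != 0 :> algC by rewrite fmorph_eq0.
rewrite /entangled; split=> [/and3P[n2 ob bn]|[n2 hQ]].
  split=> //; have [s [sZ s2 _]] := fund_disc_sqrt D_fund.
  have sQ : Qz (lcmn f n) s.
    by apply: Qz_dvd (Zz_Qz sZ) => //; rewrite (disc_dvd_lcm D_fund) // ob.
  have [->|->] := sqrt_rat_mulE t0 gE (rho2 n2 n0) s2; first by apply: QzM => //; apply: Qz_rat.
  by rewrite -mulNr -rmorphN; apply: QzM => //; apply: Qz_rat.
rewrite n2 /= -(disc_dvd_lcm D_fund) //.
apply: (@conductor_dvd _ _ (ratr t^-1 * rat_root g n ^+ (n %/ 2)) l0 D_fund); last first.
  by apply: QzM => //; apply: Qz_rat.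
by rewrite exprMn rho2 // gE fmorphV rmorphM rmorphXn /= ratr_int exprVn mulrC mulfK // expf_neq0.
Qed.

Lemma gamma_sign (u : {rmorphism algC -> algC}) : odd `|b| -> u (zeta f) = zeta f ^+ a ->
  exists s : algC, [/\ Zz f s, s != 0, s ^+ 2 = gamma%:~R & u s = (kronecker gamma a)%:~R * s].
Proof.
move=> ob hu; have [b1 [_ fg _ _]] := disc_split D_fund ob.
have [s [sZ s2 sodd]] := fund_disc_sqrt fg.
have gf := disc_gamma_dvd Delta f.
have g0 : gamma != 0 by rewrite -absz_gt0; apply: fund_disc_gt0 fg.
exists s; split=> //; first exact: Zz_dvd sZ.
  by have : s ^+ 2 != 0; [rewrite s2 intr_eq0 | rewrite expf_eq0].
apply: (kronecker_sqrt a_gt0 _ g0 sZ s2 sodd).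
  exact: coprime_dvdr gf haf.
exact: aut_zeta_dvd hu.
Qed.

Lemma kronecker_gamma_sign : odd `|b| -> kronecker gamma a = 1 \/ kronecker gamma a = -1.
Proof.
move=> ob; have [u hu] := aut_zeta haf; have [s [_ s0 s2 us]] := gamma_sign ob hu.
have /eqP : (u s) ^+ 2 = s ^+ 2 by rewrite -rmorphXn s2 /= rmorph_int.
rewrite eqf_sqr us => /orP[] /eqP hs; [left | right]; apply/eqP; rewrite -(eqr_int algC).
  by apply/eqP; apply: (mulIf s0); rewrite hs rmorph1 mul1r.
by apply/eqP; apply: (mulIf s0); rewrite hs rmorphN1 mulN1r.
Qed.

(** Necessity is tested on zeta_(f,n) and sqrt gamma; the latter lies in Q(zeta_n, g^(1/n)) as a
    rational multiple of sqrt g / sqrt b'. For sufficiency, sigma_a is extended by an automorphism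
    fixing zeta_n, and it remains to see that it fixes alpha^d. *)
Lemma c_coefE n : squarefree n ->
  c_coef haf g n = (a == 1 %[mod gcdn f n])%N && (entangled n ==> (kronecker gamma a == 1)) :> nat.
Proof.
move=> sn; have [n0 _] := squarefreeP _ sn.
have [r gr] := h_power; have epsP := entangledP sn.
have sqrtE (u : {rmorphism algC -> algC}) : entangled n -> u (zeta f) = zeta f ^+ a ->
    exists (s sb : algC) (q : rat), [/\ [/\ Qz f s, s != 0 & u s = (kronecker gamma a)%:~R * s],
      [/\ Qz n sb, sb != 0 & q != 0] & rat_root g n ^+ (n %/ 2) = ratr q * (s * sb)].
  case/and3P => n2 ob bn hu; have [t t0 gE] := gDelta.
  have [s [sZ s0 s2 us]] := gamma_sign ob hu.
  have [b1 [fb1 _ DE b1E]] := disc_split D_fund ob.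
  have [sb [sbZ sb2 _]] := fund_disc_sqrt fb1.
  have ssb2 : (s * sb) ^+ 2 = Delta%:~R by rewrite exprMn s2 sb2 -rmorphM /= -DE.
  have sbQ : Qz n sb by apply: Qz_dvd (Zz_Qz sbZ); rewrite // b1E.
  have sb0 : sb != 0.
    by have : sb ^+ 2 != 0; [rewrite sb2 intr_eq0 -absz_gt0 (fund_disc_gt0 fb1) | rewrite expf_eq0].
  exists s, sb; have [hE|hE] := sqrt_rat_mulE t0 gE (rho2 n2 n0) ssb2.
    by exists t; split=> //; split=> //; apply: Zz_Qz.
  exists (- t); rewrite oppr_eq0 rmorphN mulNr; split=> //; split=> //; exact: Zz_Qz.
rewrite /c_coef; case: asboolP => [hfix|hnfix].
  have [u hu] := aut_zeta haf; move/(sigma_fixesP haf g n hu) in hfix.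
  suff -> : (a == 1 %[mod gcdn f n])%N && (entangled n ==> (kronecker gamma a == 1)) by [].
  apply/andP; split.
    have g0 : (0 < gcdn f n)%N by rewrite gcdn_gt0 f_gt0.
    rewrite -(zetaX_eq a 1 g0) expr1 -(aut_zeta_dvd f_gt0 (dvdn_gcdl f n) hu); apply/eqP.
    apply: hfix; first by apply: Qz_dvd (Qz_zeta _) => //; apply: dvdn_gcdl.
    have [k ->] := zeta_pow n0 (dvdn_gcdr f n).
    by apply: in_QadjX; apply: in_Qadj_gen; rewrite inE eqxx.
  apply/implyP => en; have [s [sb [q [[sQ s0 us] [sbQ sb0 q0] hrho]]]] := sqrtE u en hu.
  have sin : in_Qadj [:: zeta n; rat_root g n] s.
    have -> : s = rat_root g n ^+ (n %/ 2) * (ratr q * sb)^-1.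
      have qC : ratr q * sb != 0 :> algC by rewrite mulf_neq0 // fmorph_eq0.
      by rewrite hrho (_ : ratr q * (s * sb) = s * (ratr q * sb)); [rewrite mulfK | ring].
    apply: in_QadjM; first by apply: in_QadjX; apply: in_Qadj_gen; rewrite !inE eqxx orbT.
    apply: in_QadjV; apply: in_QadjM; first exact: in_Qadj_rat.
    by apply: in_Qadj_Qz sbQ; rewrite inE eqxx.
  rewrite -(eqr_int algC) rmorph1; apply/eqP; apply: (mulIf s0).
  by rewrite -us mul1r; apply: hfix.
suff /negPf -> : ~~ ((a == 1 %[mod gcdn f n])%N && (entangled n ==> (kronecker gamma a == 1))) by [].
apply/negP => /andP[/eqP a1 hent]; apply: hnfix.
have [u [hu un]] := aut_crt a_gt0 f_gt0 n0 haf a1.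
apply/(sigma_fixesP haf g n hu) => y yf yn.
apply: (radical_inter_fixed f_gt0 sn g_neq0 power_odd gr h_max epsP un _ yf yn).
have he : u (rat_root g n ^+ (n %/ gcdn n h)) = rat_root g n ^+ (n %/ gcdn n h).
  exact: Qz_aut_id un (alpha_pow_e sn g_neq0 power_odd gr).
case: (boolP (entangled n)) hent => [en /= /eqP kr1|_ _]; last by rewrite muln1.
have [n2 _] := epsP.1 en.
have [s [sb [q [[sQ s0 us] [sbQ sb0 q0] hrho]]]] := sqrtE u en hu.
have urho : u (rat_root g n ^+ (n %/ 2)) = rat_root g n ^+ (n %/ 2).
  have uq : u (ratr q) = ratr q by rewrite fmorph_rat.
  transitivity (u (ratr q) * (u s * u sb)); first by rewrite hrho !rmorphM.
  by rewrite us kr1 uq (Qz_aut_id un sbQ) mul1r hrho.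
set e := gcdn n h in he *; set al := rat_root g n in he urho *.
have oe : odd e by apply: dvdn_odd power_odd; apply: dvdn_gcdr.
rewrite expn1; set c := (n %/ (e * 2))%N.
have nE : (n = c * (e * 2))%N by rewrite divnK // Gauss_dvd ?dvdn_gcdl // coprimen2.
have e0 : (0 < e)%N by rewrite gcdn_gt0 n0.
have c2 : (n %/ e = c * 2)%N by rewrite {1}nE mulnCA mulKn.
have ce : (n %/ 2 = c * e)%N by rewrite {1}nE mulnA mulnK.
have al0 : al != 0.
  apply/eqP => al0; have := rootCK n0 (ratr g : algC); rewrite -/(rat_root g n) -/al al0.
  by rewrite expr0n gtn_eqF // => /esym/eqP; rewrite fmorph_eq0 (negPf g_neq0).
(* u fixes the powers of al with exponents c e and 2 c; as e is odd, it fixes al^c. *)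
have hsplit : al ^+ (c * e) = al ^+ c * (al ^+ (c * 2)) ^+ e./2.
  by rewrite -exprM -exprD -mulnA mul2n -{1}(odd_double_half e) oe mulnDr muln1.
apply: (mulIf (expf_neq0 e./2 (expf_neq0 (c * 2) al0))).
have uh : u ((al ^+ (c * 2)) ^+ e./2) = (al ^+ (c * 2)) ^+ e./2.
  by rewrite [LHS]rmorphXn -c2 he.
transitivity (u (al ^+ c * (al ^+ (c * 2)) ^+ e./2)); first by rewrite [RHS]rmorphM uh.
by rewrite -hsplit -ce urho.
Qed.

Lemma degree_formula n : squarefree n ->
  (degQ [:: zeta f; zeta n; rat_root g n] * (gcdn n h * 2 ^ entangled n) = n * totient (lcmn f n))%N.
Proof.
move=> sn; have [r gr] := h_power.
by have := degQ_radical f_gt0 sn g_neq0 power_odd gr h_max (entangledP sn).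
Qed.
End Setting.

(** * Local factors *)

Lemma gcdn_mul_prime k p n : prime p -> ~~ (p %| n)%N ->
  gcdn k (p * n) = (gcdn k p * gcdn k n)%N.
Proof.
move=> pp pn; have cpn : coprime p n by rewrite prime_coprime.
have [/dvdnP[k' ->]|pk] := boolP (p %| k)%N.
  rewrite [gcdn (k' * p) p](gcdn_idPr _) ?dvdn_mull // [(k' * p)%N]mulnC -muln_gcdr; congr (_ * _)%N.
  by rewrite [RHS]gcdnC Gauss_gcdr 1?gcdnC // coprime_sym.
have cpk : coprime p k by rewrite prime_coprime.
by rewrite Gauss_gcdr 1?coprime_sym // [gcdn k p]gcdnC (eqP cpk) mul1n.
Qed.

Lemma primes_mul_prime p n : prime p -> (0 < n)%N -> ~~ (p %| n)%N ->
  perm_eq (primes (p * n)) (p :: primes n).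
Proof.
move=> pp n0 pn; have p0 := prime_gt0 pp.
apply: uniq_perm; rewrite ?primes_uniq //= ?primes_uniq ?andbT.
  by rewrite mem_primes (negPf pn) !andbF.
by move=> q; rewrite primesM // inE primes_prime // inE.
Qed.

Lemma squarefree_prod (R : comPzRingType) (F : nat -> R) n : F 1%N = 1 ->
    (forall p m, prime p -> (0 < m)%N -> ~~ (p %| m)%N -> F (p * m)%N = F p * F m) ->
  squarefree n -> F n = \prod_(p <- primes n) F p.
Proof.
move=> F1 FM; have [N hN] := ubnP n; elim: N => // N IH in n hN *.
move=> /squarefreeP[n0 hn]; have [->|n1] := eqVneq n 1%N; first by rewrite big_nil.
have n_gt1 : (1 < n)%N by case: n n0 n1 {hN hn} => [|[]].
have pp := pdiv_prime n_gt1; have /dvdnP[m hm] := pdiv_dvd n.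
set p := pdiv n in pp hm; rewrite mulnC in hm; have p0 := prime_gt0 pp.
have m0 : (0 < m)%N by move: n0; rewrite hm muln_gt0 => /andP[].
have lp : logn p m = 0%N.
  by have := hn p; rewrite hm lognM // (logn_prime p pp) eqxx; case: (logn p m).
have pm : ~~ (p %| m)%N.
  by apply/negP => pm; have := logn_gt0 p m; rewrite lp mem_primes pp m0 pm.
rewrite hm (perm_big _ (primes_mul_prime pp m0 pm)) big_cons FM // (IH m) //.
  by rewrite hm in hN; have := prime_gt1 pp; nia.
apply/squarefreeP; split=> // q; apply: leq_trans (hn q).
by rewrite hm lognM // leq_addl.
Qed.

Lemma totient_le k : (totient k <= k)%N.
Proof.
rewrite totient_count_coprime -[leqRHS]subn0 -[leqRHS]muln1 -sum_nat_const_nat.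
by apply: leq_sum => i _; apply: leq_b1.
Qed.

Section LocalFactor.
Variables (R : realType) (a f h : nat).
Hypotheses (a_gt0 : (0 < a)%N) (f_gt0 : (0 < f)%N) (h_gt0 : (0 < h)%N).

(* phi(f) times the n-th term of the series, for squarefree n, when the factors due to the
   entanglement of sqrt g are left out. *)
Definition weight (n : nat) : R :=
  (-1) ^+ size (primes n) * (a == 1 %[mod gcdn f n])%N%:R * (gcdn n h)%:R *
  (totient (gcdn f n))%:R / ((totient n)%:R * n%:R).

Definition local_weight (p : nat) : R :=
  if (p %| f)%N then if (p %| a - 1)%N then - ((gcdn p h)%:R / p%:R) else 0
  else - ((gcdn p h)%:R / (p%:R * (p%:R - 1))).

Lemma weight_prime p : prime p -> weight p = local_weight p.
Proof.
move=> pp; rewrite /weight /local_weight primes_prime //= expr1.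
have p0 : (p%:R : R) != 0 by rewrite pnatr_eq0 -lt0n prime_gt0.
have p1 : (p%:R - 1 : R) != 0 by rewrite subr_eq0 pnatr_eq1 gtn_eqF // prime_gt1.
have pE : ((p.-1)%:R : R) = p%:R - 1 by rewrite -subn1 natrB ?prime_gt0.
rewrite (totient_prime pp) pE; case: ifPn => pf.
  rewrite (gcdn_idPr pf) (totient_prime pp) pE eqn_mod_dvd //.
  by case: (p %| a - 1)%N; rewrite /= ?mulr1n ?mulr0n; [field; rewrite p0 p1 | ring].
have -> : gcdn f p = 1%N by apply/eqP; rewrite gcdnC -/(coprime p f) prime_coprime.
by rewrite !modn1 eqxx (_ : totient 1 = 1%N) // !mulr1n; field; rewrite p0 p1.
Qed.

Lemma weight_prod n : squarefree n -> weight n = \prod_(p <- primes n) local_weight p.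
Proof.
move=> sn; rewrite (squarefree_prod _ _ sn).
- by rewrite big_seq [RHS]big_seq; apply: eq_bigr => p; rewrite mem_primes => /andP[pp _]; apply: weight_prime.
- by rewrite /weight /= gcdn1 gcd1n !modn1 eqxx expr0 (_ : totient 1 = 1%N) // !mulr1n; field.
move=> p m pp m0 pm; rewrite /weight (perm_size (primes_mul_prime pp m0 pm)) /=.
have cpm : coprime p m by rewrite prime_coprime.
have cg : coprime (gcdn f p) (gcdn f m).
  exact: coprime_dvdl (dvdn_gcdr f p) (coprime_dvdr (dvdn_gcdr f m) cpm).
rewrite (gcdn_mul_prime f pp pm) chinese_remainder // (totient_coprime cg) (totient_coprime cpm).
rewrite [gcdn (p * m) h]gcdnC (gcdn_mul_prime h pp pm) ![gcdn h _]gcdnC -mulnb.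
rewrite (primes_prime pp) exprS expr1 !(natrM R) !invfM; ring.
Qed.

(** The constant bounds (p, h) by h and phi((f, p)) by f. *)
Lemma local_weight_le p : prime p ->
  `|local_weight p| <= (h * f)%:R * (p%:R * (p%:R - 1))^-1.
Proof.
move=> pp; rewrite -weight_prime // /weight primes_prime //= expr1 (totient_prime pp).
have p0 : (0 : R) < p%:R by rewrite ltr0n prime_gt0.
have p1 : (0 : R) < p%:R - 1 by rewrite subr_gt0 ltr1n prime_gt1.
have pE : ((p.-1)%:R : R) = p%:R - 1 by rewrite -subn1 natrB ?prime_gt0.
rewrite pE !normrM normrN1 mul1r normfV !normr_nat normrM normr_nat (gtr0_norm p1) [(p%:R - 1) * _]mulrC.
rewrite ler_pM2r ?invr_gt0 ?mulr_gt0 // -!natrM ler_nat.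
apply: leq_mul; last by apply: leq_trans (dvdn_leq f_gt0 (dvdn_gcdl f p)); apply: totient_le.
rewrite -[leqRHS]mul1n; apply: leq_mul; first exact: leq_b1.
by apply: dvdn_leq => //; apply: dvdn_gcdr.
Qed.

Lemma prod_prime_dvd (F : nat -> R) (Q : pred nat) k N : (0 < k)%N -> (k < N)%N ->
  \prod_(0 <= p < N | prime p) (if (p %| k)%N && Q p then F p else 1) =
  \prod_(p <- primes k | Q p) F p.
Proof.
move=> k0 kN; rewrite -big_mkcondr /= -[LHS]big_filter -[RHS]big_filter.
apply: perm_big; apply: uniq_perm; rewrite ?filter_uniq ?iota_uniq ?primes_uniq //.
move=> p; rewrite !mem_filter mem_primes k0 /= mem_index_iota /=.
have [pk|pk] := boolP (p %| k)%N; last by rewrite !andbF.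
by rewrite (leq_ltn_trans (dvdn_leq k0 pk) kN) /= !andbT andbC.
Qed.

Lemma artin_cvg : cvgn (artin_partial R f h).
Proof.
have fac p : prime p -> 0 <= 1 - (p%:R * (p%:R - 1))^-1 :> R /\ 1 - (p%:R * (p%:R - 1))^-1 <= 1 :> R.
  move=> pp; have p2 : (2 : R) <= p%:R by rewrite (ler_nat _ 2) prime_gt1.
  have q1 : (1 : R) <= p%:R * (p%:R - 1) by nra.
  have q0 : (0 : R) < p%:R * (p%:R - 1) by apply: lt_le_trans q1.
  by rewrite subr_ge0 lerBlDr lerDl invr_ge0 (ltW q0) invf_le1.
have ge0 N : 0 <= artin_partial R f h N.
  by apply: prodr_ge0 => p /and3P[/fac[]].
apply: nonincreasing_is_cvgn; last by exists 0 => _ [N _ <-].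
apply/nonincreasing_seqP => N; rewrite /artin_partial big_mkcond big_nat_recr //= -big_mkcond /=.
case: ifP => [/and3P[/fac[_ h1] _ _]|_]; last by rewrite mulr1.
by rewrite ler_piMr //; apply: ge0.
Qed.

(** With (p, h) in the numerator, X vanishes exactly when (a - 1, f, h) > 1, which absorbs the case
    distinction in [Afactor]. *)
Let X : R := \prod_(p <- primes (gcdn (a - 1) f)) (1 - (gcdn p h)%:R / p%:R).
Let Y : R := \prod_(p <- primes h | ~~ (p %| f)%N) (1 - (p%:R - 1)^-1).

Lemma AfactorE : Afactor R a f h = X * Y * limn (artin_partial R f h).
Proof.
rewrite /Afactor; have g0 : (0 < gcdn (a - 1) f)%N by rewrite gcdn_gt0 f_gt0 orbT.
case: eqP => hg.
  congr (_ * _ * _); rewrite /X big_seq [RHS]big_seq; apply: eq_bigr => p.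
  rewrite mem_primes => /and3P[pp _ pg]; rewrite (_ : gcdn p h = 1%N) ?div1r //.
  apply/eqP; rewrite -dvdn1 -hg dvdn_gcd dvdn_gcdr andbT.
  by apply: dvdn_trans (dvdn_gcdl _ _) pg.
have k1 : (1 < gcdn (gcdn (a - 1) f) h)%N.
  by have : (0 < gcdn (gcdn (a - 1) f) h)%N; [rewrite gcdn_gt0 g0 | case: (gcdn _ h) hg => [|[]]].
have pp := pdiv_prime k1; set p := pdiv _ in pp.
have : (p %| gcdn (gcdn (a - 1) f) h)%N by apply: pdiv_dvd.
rewrite dvdn_gcd => /andP[pg ph].
suff -> : X = 0 by rewrite !mul0r.
have pin : p \in primes (gcdn (a - 1) f) by rewrite mem_primes pp g0 pg.
rewrite /X (bigD1_seq p) ?primes_uniq //= (gcdn_idPl ph) divff ?subrr ?mul0r //.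
by rewrite pnatr_eq0 -lt0n prime_gt0.
Qed.

Lemma euler_prod_split N : (f < N)%N -> (h < N)%N ->
  \prod_(0 <= p < N | prime p) (1 + local_weight p) = X * Y * artin_partial R f h N.
Proof.
move=> fN hN; have g0 : (0 < gcdn (a - 1) f)%N by rewrite gcdn_gt0 f_gt0 orbT.
have gN : (gcdn (a - 1) f < N)%N by apply: leq_ltn_trans fN; apply: dvdn_leq (dvdn_gcdr _ _).
have -> : X = \prod_(0 <= p < N | prime p)
    (if (p %| gcdn (a - 1) f)%N && xpredT p then 1 - (gcdn p h)%:R / p%:R else 1) by rewrite prod_prime_dvd.
rewrite /Y -(prod_prime_dvd _ _ h_gt0 hN) /artin_partial.
rewrite [X in _ = _ * X](_ : _ = \prod_(0 <= p < N | prime p)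
    (if ~~ (p %| f)%N && ~~ (p %| h)%N then 1 - (p%:R * (p%:R - 1))^-1 else 1)); last first.
  by rewrite big_mkcondr.
rewrite -!big_split /=; apply: eq_bigr => p pp; rewrite andbT dvdn_gcd /local_weight.
have p0 : (p%:R : R) != 0 by rewrite pnatr_eq0 -lt0n prime_gt0.
have [pf|pf] /= := boolP (p %| f)%N.
  by rewrite andbT andbF; case: ifP => _; rewrite ?addr0 !mulr1.
rewrite andbF andbT mul1r; have [ph|ph] /= := boolP (p %| h)%N.
  by rewrite (gcdn_idPl ph) mulr1 invfM mulrA divff // mul1r.
have -> : gcdn p h = 1%N by apply/eqP; rewrite -/(coprime p h) prime_coprime.
by rewrite !mul1r.
Qed.

(** At p | t the factor is W(p) in place of 1 + W(p); as the latter is nonzero there, the product is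
    the one for t = 1 times finitely many quotients, even when its limit is 0. *)
Lemma euler_cvg_dvd t : squarefree t ->
    (forall p, prime p -> (p %| t)%N -> 1 + local_weight p != 0) ->
  ((fun N => \prod_(0 <= p < N | prime p) ((~~ (p %| t)%N)%:R + local_weight p)) @ \oo -->
   Afactor R a f h * \prod_(p <- primes t) (local_weight p / (1 + local_weight p)))%classic.
Proof.
move=> st ht; have [t0 _] := squarefreeP _ st; rewrite AfactorE.
set K := \prod_(p <- primes t) _.
have hlim : ((fun N => X * Y * artin_partial R f h N * K) @ \oo -->
    X * Y * limn (artin_partial R f h) * K)%classic.
  by apply: cvgMl; apply: cvgMr; exact: artin_cvg.
apply: cvg_trans hlim; apply: near_eq_cvg; near=> N.
have fN : (f < N)%N by near: N; exists f.+1.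
have hN : (h < N)%N by near: N; exists h.+1.
have tN : (t < N)%N by near: N; exists t.+1.
rewrite -euler_prod_split // /K -(big_rmcond_in xpredT) //.
rewrite -(prod_prime_dvd _ xpredT t0 tN) -big_split /=; apply: eq_bigr => p pp.
rewrite andbT; case: ifPn => pt; last by rewrite mulr1.
by rewrite add0r mulrC divfK // ht.
Unshelve. all: by end_near. Qed.
End LocalFactor.

(** * The density *)

Lemma moebius_squarefree n : squarefree n -> moebius n = (-1) ^+ size (primes n).
Proof. by rewrite /squarefree /moebius => /andP[_ ->]. Qed.

Lemma moebius_nsquarefree n : (0 < n)%N -> ~~ squarefree n -> moebius n = 0.
Proof. by rewrite /squarefree /moebius => -> /= /negPf ->. Qed.

Lemma sqfree_squarefree n : sqfree n -> squarefree n.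
Proof.
case=> n0 h; apply/squarefreeP; split=> // p; rewrite leqNgt; apply/negP => hp.
have pp : prime p by have : (0 < logn p n)%N; [apply: ltnW | rewrite logn_gt0 mem_primes => /andP[]].
by have /negP := h p pp; apply; rewrite pfactor_dvdn.
Qed.

(** As n is squarefree, k = n / (f, n) is prime to f, and lcm(f, n) = k f. *)
Lemma totient_gcd_lcm f n : (0 < f)%N -> squarefree n ->
  (totient (lcmn f n) * totient (gcdn f n) = totient f * totient n)%N.
Proof.
move=> f0 sn; have [n0 hn] := squarefreeP _ sn.
pose k := (n %/ gcdn f n)%N.
have g0 : (0 < gcdn f n)%N by rewrite gcdn_gt0 f0.
have nE : n = (k * gcdn f n)%N by rewrite divnK // dvdn_gcdr.
have k0 : (0 < k)%N by move: n0; rewrite nE muln_gt0 => /andP[].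
have cop p : prime p -> (p %| k)%N -> (p %| f)%N -> False.
  move=> pp pk pf; have pn : (p %| n)%N by rewrite nE dvdn_mulr.
  have pg : (p %| gcdn f n)%N by rewrite dvdn_gcd pf.
  have := hn p; rewrite leqNgt -pfactor_dvdn // => /negP; apply.
  by rewrite nE expnS expn1 dvdn_mul.
have ckf : coprime k f.
  rewrite /coprime; apply: contraT => c1.
  have c_gt1 : (1 < gcdn k f)%N.
    by have : (0 < gcdn k f)%N; [rewrite gcdn_gt0 k0 | case: (gcdn k f) c1 => [|[]]].
  have /andP[pk pf] : (pdiv (gcdn k f) %| k)%N && (pdiv (gcdn k f) %| f)%N.
    by rewrite -dvdn_gcd pdiv_dvd.
  by case: (cop _ (pdiv_prime c_gt1) pk pf).
have lE : lcmn f n = (k * f)%N.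
  by apply/eqP; rewrite -(eqn_pmul2r g0) muln_lcm_gcd {1}nE; apply/eqP; ring.
have tE : totient n = (totient k * totient (gcdn f n))%N.
  by rewrite {1}nE totient_coprime //; apply: coprime_dvdr ckf; apply: dvdn_gcdl.
by rewrite lE (totient_coprime ckf) tE; ring.
Qed.

Section Term.
Variables (R : realType) (g : rat) (h : nat) (Delta : int) (a f : nat).
Hypotheses (g_neq0 : g != 0) (g_nonsquare : ~ exists r : rat, g = r ^+ 2).
Hypotheses (h_gt0 : (0 < h)%N) (h_power : exists r : rat, g = r ^+ h).
Hypothesis h_max : forall k : nat, (0 < k)%N -> (exists r : rat, g = r ^+ k) -> (k <= h)%N.
Hypothesis D_fund : fund_disc Delta.
Hypothesis gDelta : exists2 t : rat, t != 0 & g = Delta%:~R * t ^+ 2.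
Hypotheses (f_gt0 : (0 < f)%N) (a_gt0 : (0 < a)%N) (haf : coprime a f).
Let b : int := (Delta %/ gcdz f%:Z Delta)%Z.
Let gamma : int := (-1) ^ ((b - 1) %/ 2)%Z * gcdz f%:Z Delta.
(** For even b the second sum has coefficient kappa = 0, and [tb] = 1 is a squarefree default that
    keeps the convergence lemma applicable. *)
Let kappa : R := if odd `|b| then (kronecker gamma a)%:~R else 0.
Let tb : nat := if odd `|b| then (2 * `|b|)%N else 1%N.

Let W n : R := \prod_(p <- primes n) local_weight R a f h p.

Lemma delta_term n : (0 < n)%N ->
  (moebius n)%:~R * (c_coef haf g n)%:R / (degQ [:: zeta f; zeta n; rat_root g n])%:R =
  (totient f)%:R^-1 * ((if squarefree n && (1 %| n)%N then W n else 0) +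
    kappa * (if squarefree n && (tb %| n)%N then W n else 0)) :> R.
Proof.
move=> n0; have [sn|sn] /= := boolP (squarefree n); last first.
  by rewrite (moebius_nsquarefree n0 sn) mulr0 addr0 mulr0 !mul0r.
rewrite dvd1n (c_coefE g_neq0 g_nonsquare h_power h_max D_fund gDelta f_gt0 a_gt0 haf sn).
rewrite (moebius_squarefree sn) /W -(weight_prod R f h a_gt0 sn) -/b -/gamma.
have deg := degree_formula g_neq0 g_nonsquare h_power h_max D_fund gDelta f_gt0 sn.
set d := degQ _ in deg *; have tot := totient_gcd_lcm f_gt0 sn.
set e := gcdn n h in deg; set ent := entangled Delta f n in deg *.
have e0 : (0 < e)%N by rewrite gcdn_gt0 n0.
have tf0 : (0 < totient f)%N by rewrite totient_gt0.
have tn0 : (0 < totient n)%N by rewrite totient_gt0.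
have tg0 : (0 < totient (gcdn f n))%N by rewrite totient_gt0 gcdn_gt0 f_gt0.
have tl0 : (0 < totient (lcmn f n))%N by rewrite totient_gt0 lcmn_gt0 f_gt0.
have d0 : (0 < d)%N.
  have : (0 < d * (e * 2 ^ ent))%N by rewrite deg muln_gt0 n0.
  by rewrite muln_gt0 => /andP[].
have nz k : (0 < k)%N -> (k%:R : R) != 0 by rewrite pnatr_eq0 -lt0n.
have degR : (d%:R : R)^-1 = (e%:R * (2 ^ ent)%:R * (totient (gcdn f n))%:R) /
    (n%:R * (totient f)%:R * (totient n)%:R).
  apply: (mulfI (nz _ d0)); rewrite divff ?nz //; apply: (mulIf (_ : n%:R * (totient f)%:R * (totient n)%:R != 0)).
    by rewrite !mulf_neq0 ?nz.
  rewrite mul1r [d%:R * _]mulrA divfK; last by rewrite !mulf_neq0 ?nz.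
  rewrite -!natrM; congr (_%:R); transitivity ((d * (e * 2 ^ ent)) * totient (gcdn f n))%N; last by ring.
  by rewrite deg -[RHS]mulnA tot mulnA.
rewrite degR rmorphXn rmorphN1 /weight -/e.
(* For entangled n the degree is halved and c_a(n) requires (gamma/a) = 1; since the symbol is 1 or
   -1, twice this indicator is 1 + (gamma/a). *)
have key : (((a == 1 %[mod gcdn f n])%N && (ent ==> (kronecker gamma a == 1)) : nat)%:R * (2 ^ ent)%:R : R) =
    (a == 1 %[mod gcdn f n])%N%:R * (1 + (if (tb %| n)%N then kappa else 0)).
  have [en|en] := boolP ent.
    have /and3P[n2 ob bn] := en; rewrite /tb /kappa ob.
    rewrite Gauss_dvd ?coprime2n // n2 bn /= expn1.
    have [->|->] := kronecker_gamma_sign D_fund f_gt0 a_gt0 haf ob.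
      by rewrite andbT rmorph1 -(natrD _ 1 1).
    by rewrite andbF rmorphN1 subrr mulr0 mul0r.
  rewrite andbT expn0 mulr1; suff -> : (if (tb %| n)%N then kappa else 0) = 0 by rewrite addr0 mulr1.
  move: en; rewrite /ent /entangled -/b /tb /kappa; case: (boolP (odd `|b|)) => ob /=; last by rewrite if_same.
  by rewrite Gauss_dvd ?coprime2n // => /negPf ->.
have fz := nz _ tf0; have tz := nz _ tn0; have nnz := nz _ n0.
transitivity ((-1) ^+ size (primes n) *
   (((a == 1 %[mod gcdn f n])%N && (ent ==> (kronecker gamma a == 1)) : nat)%:R * (2 ^ ent)%:R) *
   (e%:R * (totient (gcdn f n))%:R) / (n%:R * (totient f)%:R * (totient n)%:R) : R).
  by field; rewrite fz tz nnz.
by rewrite key; case: (tb %| n)%N; field; rewrite fz tz nnz.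
Qed.

Let h_odd : odd h. Proof. exact: power_odd g_nonsquare h_power. Qed.

(** h is odd, and if f is even then a is odd, so that 2 | a - 1: both cases give the same value. *)
Lemma local_weight2 : local_weight R a f h 2 = - 2^-1.
Proof.
have hg : gcdn 2 h = 1%N by apply/eqP; rewrite -/(coprime 2 h) coprime2n.
rewrite /local_weight hg; case: ifPn => f2.
  have -> : (2 %| a - 1)%N.
    have oa : odd a by rewrite -coprimen2; apply: coprime_dvdr f2 haf.
    by rewrite dvdn2 oddB // oa.
  by rewrite div1r.
have -> : (2%:R - 1 : R) = 1 by rewrite -[2%:R](natrD _ 1 1) addrK.
by rewrite mulr1 div1r.
Qed.

(** p is prime to f, so 1 + W(p) is (p - 2)/(p - 1) or (p^2 - p - 1)/(p (p - 1)), nonzero because p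
    >= 3. *)
Lemma local_weight_b p : odd `|b| -> prime p -> (p %| `|b|)%N ->
  [/\ odd p, 1 + local_weight R a f h p != 0 &
   local_weight R a f h p / (1 + local_weight R a f h p) =
   - (if (p %| h)%N then p%:R - 2 else p%:R ^+ 2 - p%:R - 1)^-1].
Proof.
move=> ob pp pb; have op : odd p by apply: dvdn_odd ob.
have pf : ~~ (p %| f)%N.
  rewrite -prime_coprime //; apply: coprime_dvdl pb _.
  exact: disc_b_coprime D_fund ob.
have p3 : (3 : R) <= p%:R.
  by rewrite (ler_nat _ 3); have := prime_gt1 pp; case: (p) op => [|[|[|]]].
have p0 : (p%:R : R) != 0 by apply/eqP => h0; move: p3; rewrite h0; lra.
have p1 : (p%:R - 1 : R) != 0 by apply/eqP => h0; lra.
have p2 : (p%:R - 2 : R) != 0 by apply/eqP => h0; lra.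
have pq : (p%:R ^+ 2 - p%:R - 1 : R) != 0 by apply/eqP => h0; nra.
rewrite /local_weight (negPf pf); case: ifPn => ph.
  rewrite (gcdn_idPl ph).
  have e1 : 1 - p%:R / (p%:R * (p%:R - 1)) = (p%:R - 2) / (p%:R - 1) :> R by field; rewrite p0 p1.
  split=> //; first by rewrite e1 mulf_neq0 // invr_eq0.
  by rewrite e1; field; rewrite p0 p1 p2.
have -> : gcdn p h = 1%N by apply/eqP; rewrite -/(coprime p h) prime_coprime.
have e1 : 1 - 1%:R / (p%:R * (p%:R - 1)) = (p%:R ^+ 2 - p%:R - 1) / (p%:R * (p%:R - 1)) :> R.
  by field; rewrite p0 p1.
split=> //; first by rewrite e1 mulf_neq0 // invr_eq0 mulf_neq0.
by rewrite e1; field; rewrite p0 p1 pq.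
Qed.

Let tb_squarefree : squarefree tb.
Proof.
rewrite /tb; case: ifP => // ob; have sb := disc_b_sqfree D_fund ob.
have /squarefreeP[b0 hb] := sqfree_squarefree sb.
apply/squarefreeP; split=> [|p]; first by rewrite muln_gt0 b0.
rewrite lognM // (logn_prime p (isT : prime 2)); case: eqP => [->|_]; last exact: hb.
rewrite (_ : logn 2 `|b| = 0%N) //; apply/eqP; rewrite -leqn0 leqNgt logn_gt0 mem_primes b0 /=.
by rewrite dvdn2 negbK -/b ob.
Qed.

Let tb_neq0 p : prime p -> (p %| tb)%N -> 1 + local_weight R a f h p != 0.
Proof.
rewrite /tb; case: ifP => ob pp; last by rewrite dvdn1 => /eqP p1; move: pp; rewrite p1.
rewrite Euclid_dvdM // => /orP[|pb]; last by case: (local_weight_b ob pp pb).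
rewrite dvdn_prime2 // => /eqP ->; rewrite local_weight2; apply/eqP => h0; lra.
Qed.

(** Each prime of 2|b| contributes a sign -1, and these make up the Moebius value; the prime 2
    contributes nothing else. *)
Lemma tb_factor : odd `|b| ->
  \prod_(p <- primes tb) (local_weight R a f h p / (1 + local_weight R a f h p)) =
  (moebius (2 * `|b|)%N)%:~R / ((\prod_(p <- primes `|b| | (p %| h)%N) (p%:R - 2)) *
            (\prod_(p <- primes `|b| | ~~ (p %| h)%N) (p%:R ^+ 2 - p%:R - 1))).
Proof.
move=> ob; have := tb_squarefree; rewrite /tb ob => st.
have b0 : (0 < `|b|)%N by case: (`|b|%N) ob.
have b2 : ~~ (2 %| `|b|)%N by rewrite dvdn2 negbK.
rewrite (moebius_squarefree st) (perm_size (primes_mul_prime (isT : prime 2) b0 b2)).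
rewrite (perm_big _ (primes_mul_prime (isT : prime 2) b0 b2)) big_cons /= local_weight2.
have -> : - 2^-1 / (1 + - 2^-1) = -1 :> R by field.
rewrite rmorphXn rmorphN1 exprS -mulrA; congr (_ * _).
pose F p : R := if (p %| h)%N then p%:R - 2 else p%:R ^+ 2 - p%:R - 1.
rewrite [X in _ / X](_ : _ = \prod_(p <- primes `|b|) F p); last first.
  rewrite [RHS](bigID (fun p => p %| h)%N) /=; congr (_ * _); apply: eq_bigr => p.
    by rewrite /F => ->.
  by rewrite /F => /negPf ->.
have hF p : p \in primes `|b| ->
    local_weight R a f h p / (1 + local_weight R a f h p) = - (F p)^-1.
  by rewrite mem_primes => /and3P[pp _ pb]; case: (local_weight_b ob pp pb).
elim: (primes `|b|) hF => [|p s IH] hF; first by rewrite !big_nil expr0 invr1 mulr1.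
rewrite !big_cons hF ?mem_head // IH; last by move=> q qs; apply: hF; rewrite inE qs orbT.
by rewrite /= exprS invfM; ring.
Qed.

Lemma delta_partial_cvg :
  (delta_partial R haf g @ \oo --> (totient f)%:R^-1 * (Afactor R a f h +
     kappa * (Afactor R a f h *
       \prod_(p <- primes tb) (local_weight R a f h p / (1 + local_weight R a f h p)))))%classic.
Proof.
have sum_cvg t : squarefree t ->
    (forall p, prime p -> (p %| t)%N -> 1 + local_weight R a f h p != 0) ->
  ((fun N => \sum_(1 <= n < N) (if squarefree n && (t %| n)%N then W n else 0)) @ \oo -->
   Afactor R a f h * \prod_(p <- primes t) (local_weight R a f h p / (1 + local_weight R a f h p)))%classic.
  move=> st ht; apply: (squarefree_dvd_sum_cvg _ st (euler_cvg_dvd f_gt0 h_gt0 st ht)).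
  by move=> p pp; apply: (local_weight_le R a_gt0 f_gt0 h_gt0 pp).
have ndvd1 p : prime p -> (p %| 1)%N -> 1 + local_weight R a f h p != 0.
  by move=> pp; rewrite dvdn1 => /eqP p1; rewrite p1 in pp.
have h1 := sum_cvg 1%N isT ndvd1.
rewrite (_ : primes 1 = [::]) // big_nil mulr1 in h1.
have h2 := sum_cvg tb tb_squarefree tb_neq0.
rewrite (_ : delta_partial R haf g = (fun N => (totient f)%:R^-1 *
  (\sum_(1 <= n < N) (if squarefree n && (1 %| n)%N then W n else 0) +
   kappa * \sum_(1 <= n < N) (if squarefree n && (tb %| n)%N then W n else 0)))); last first.
  apply: funext => N; rewrite /delta_partial mulr_sumr -big_split mulr_sumr /=.
  by apply: eq_big_nat => n /andP[n0 _]; apply: delta_term.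
by apply: cvgMr; apply: cvgD h1 _; apply: cvgMr.
Qed.
End Term.

Theorem theorem2 (R : realType) (g : rat) (h : nat) (Delta : int) (a f : nat)
    (g_neq0 : g != 0) (g_neqN1 : g != -1)
    (g_nonsquare : ~ exists r : rat, g = r ^+ 2)
    (h_gt0 : (0 < h)%N) (h_power : exists r : rat, g = r ^+ h)
    (h_max : forall k : nat, (0 < k)%N -> (exists r : rat, g = r ^+ k) -> (k <= h)%N)
    (Delta_disc : is_discriminant (Qadj [:: rat_root g 2]) Delta)
    (f_gt0 : (0 < f)%N) (a_gt0 : (0 < a)%N) (a_le_f : (a <= f)%N)
    (haf : coprime a f) :
  let b : int := (Delta %/ gcdz f%:Z Delta)%Z in
  let gamma : int := (-1) ^ ((b - 1) %/ 2)%Z * gcdz f%:Z Delta in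
  cvgn (delta_partial R haf g) /\
  delta R haf g =
    Afactor R a f h / (totient f)%:R *
    (1 + if odd `|b|%N then
           (kronecker gamma a)%:~R * (moebius (2 * `|b|%N)%N)%:~R /
           ((\prod_(p <- primes `|b|%N | (p %| h)%N) (p%:R - 2)) *
            (\prod_(p <- primes `|b|%N | ~~ (p %| h)%N) (p%:R ^+ 2 - p%:R - 1)))
         else 0).
Proof.
move=> b gamma; have [fD gD] := rat_root_disc g_neq0 g_nonsquare Delta_disc.
have hc := delta_partial_cvg (R := R) g_neq0 g_nonsquare h_gt0 h_power h_max fD gD f_gt0 a_gt0 haf.
split; first by apply/cvg_ex; eexists; exact: hc.
rewrite /delta (cvg_lim _ hc) //; case: ifP => ob.
  have := tb_factor R g_nonsquare h_power fD a_gt0 haf ob; rewrite -/b ob => ->.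
  by rewrite -/gamma; ring.
by ring.
Qed.
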